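(* Let $n\ge 3$. Every super-maximal representation $\rho:\pi_1(\Sigma_{0,n})\to G=\mathrm{PSL}(2,\mathbb R)$ is totally non hyperbolic: for every $\gamma\in\pi_1(\Sigma_{0,n})$ which is freely homotopic to a simple closed curve, $\rho(\gamma)$ is a non hyperbolic element of $G$.
   Context: $\Sigma_{0,n}$ is the oriented sphere minus $n$ points (punctures). $G=\mathrm{PSL}(2,\mathbb R)$ acts by orientation-preserving isometries on $\mathbb H^+=\{\Im z>0\}$ with the metric $(dx^2+dy^2)/y^2$. The $c_i\in\pi_1(\Sigma_{0,n})$, $1\le i\le n$, are elements freely homotopic to positive loops around the punctures. The function $\theta:G\to[0,2\pi]$ is: $\theta(g)=0$ if $g$ is hyperbolic or positive parabolic (a parabolic translating its horocycles anti-clockwise, i.e. conjugate in $G$ to $z\mapsto z+1$); $\theta(g)=2\pi$ if $g$ is negative parabolic (the other parabolics) or the identity; $\theta(g)\in(0,2\pi)$ is the rotation angle of $g$ on $\mathbb H^+$ if $g$ is elliptic. Put $\theta_i(\rho)=\theta(\rho(c_i))$ and $\Theta(\rho)=\sum_{i=1}^n\theta_i(\rho)$. The volume $\mathrm{Vol}(\rho)$ is $\int_{\Sigma_{0,n}} f^*\big(\frac{dx\wedge dy}{y^2}\big)$ for a smooth $\rho$-equivariant map $f:\widetilde{\Sigma_{0,n}}\to\mathbb H^+$ such that, near each puncture, the completion of $f^*\big(\frac{dx^2+dy^2}{y^2}\big)$ is a cone, a parabolic cusp, or an annulus with totally geodesic boundary. Equivalently (known formula of Burger--Iozzi--Wienhard),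 $\mathrm{Vol}(\rho)=-\sum_{i=1}^n T(\tilde\rho(c_i))$, where $\tilde\rho$ is any lift of $\rho$ to the universal cover $\widetilde G$ of $G$ and $T(g)=\lim_k (g^k(x)-x)/k$ is the translation number, $\widetilde{\mathbb R\mathbf P^1}$ being identified with $\mathbb R$ (oriented anti-clockwise as the boundary of $\mathbb H^+$) so that the positive generator of the covering group is $x\mapsto x+2\pi$. The relative Euler class is $\mathbf{eu}(\rho)=\frac1{2\pi}\big(\mathrm{Vol}(\rho)+\Theta(\rho)\big)\in\mathbb Z$. A representation $\rho:\pi_1(\Sigma_{0,n})\to G$ is super-maximal if $\mathbf{eu}(\rho)=n-1$ or $\mathbf{eu}(\rho)=n$. *)

(* Defs.v *)
From HB Require Import structures.
From mathcomp Require Import all_boot all_order all_algebra.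
From mathcomp Require Import generic_quotient.
From mathcomp Require Import all_classical all_reals all_analysis.
From mathcomp Require Import ring lra.

Set Implicit Arguments.
Unset Strict Implicit.
Unset Printing Implicit Defensive.

Import Order.TTheory GRing.Theory Num.Theory.
Import numFieldNormedType.Exports.
Local Open Scope classical_set_scope.
Local Open Scope ring_scope.
Local Open Scope quotient_scope.

Definition unit_itv {R : realType} : set R := `[0, 1].
Arguments unit_itv : simpl never.

Section homotopy.
Context {R : realType} {X : topologicalType}.
Implicit Types (f g h : R -> X) (phi psi : R -> R) (P : set (R -> X)).

(* Paths are functions on R of which only the restriction to [0, 1] matters;
   a homotopy H (s, t) deforms f (s = 0) into g (s = 1) through paths
   satisfying P. *)
Definition homotopic_through P f g := exists H : R * R -> X,
  [/\ {within unit_itv `*` unit_itv, continuous H},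
      forall t, unit_itv t -> H (0, t) = f t /\ H (1, t) = g t &
      forall s, unit_itv s -> P (fun t => H (s, t))].

Definition closed_curve f :=
  {within unit_itv, continuous f} /\ f 0 = f 1.

Definition simple_closed_curve f :=
  closed_curve f /\ {in `[0, 1[ &, injective f}.

Definition freely_homotopic f g := homotopic_through [set h | h 0 = h 1] f g.

Definition based_homotopic x f g :=
  homotopic_through [set h | h 0 = x /\ h 1 = x] f g.

Definition concat f g t := if t <= 2^-1 then f (2 * t) else g (2 * t - 1).

Definition reverse f t := f (1 - t).

Lemma unit_itvE (t : R) : unit_itv t = (0 <= t <= 1) :> Prop.
Proof. by rewrite /unit_itv /= in_itv. Qed.

Lemma within_comp (Y Z W : topologicalType) (A : set Y) (B : set Z)
    (u : Y -> Z) (v : Z -> W) :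
  {within A, continuous u} -> (forall y, A y -> B (u y)) ->
  {within B, continuous v} -> {within A, continuous (v \o u)}.
Proof.
move=> /subspace_continuousP cu AB /subspace_continuousP cv.
apply/subspace_continuousP => y Ay.
have uB : u @ within A (nbhs y) --> within B (nbhs (u y)).
  move=> V /= BV.
  have := cu y Ay _ BV; rewrite /nbhs /= /within /=.
  apply: filterS => z + Az; apply => //; exact: AB.
exact: cvg_comp uB (cv _ (AB _ Ay)).
Qed.

Lemma within_paste (Y W : topologicalType) (A B C : set Y) (u v w : Y -> W) :
  closed A -> closed B -> C `<=` A `|` B ->
  {within A `&` C, continuous u} -> {within B `&` C, continuous v} ->
  closed C ->
  (forall y, A y -> C y -> w y = u y) ->
  (forall y, B y -> C y -> w y = v y) ->
  {within C, continuous w}.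
Proof.
move=> cA cB CAB cu cv cC wu wv.
apply: (@continuous_subspaceW _ _ _ ((A `&` C) `|` (B `&` C))).
  by move=> y Cy; case: (CAB y Cy) => ?; [left|right].
apply: withinU_continuous; [exact: closedI..| |].
- apply: subspace_eq_continuous cu => y /set_mem[Ay Cy].
  by rewrite /from_subspace wu.
- apply: subspace_eq_continuous cv => y /set_mem[By Cy].
  by rewrite /from_subspace wv.
Qed.

Lemma closed_unit_itv : closed (@unit_itv R).
Proof. exact: interval_closed. Qed.

Lemma closed_square : closed (@unit_itv R `*` @unit_itv R).
Proof.
apply: (@closedI _ (fst @^-1` unit_itv) (snd @^-1` unit_itv)).
  apply: preimage_closed => [? _|]; [exact: cvg_fst|exact: closed_unit_itv].
apply: preimage_closed => [? _|]; [exact: cvg_snd|exact: closed_unit_itv].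
Qed.

Lemma continuous_affine (a b : R) : continuous (fun t : R => a * t + b).
Proof.
move=> t; apply: cvgD; last exact: cvg_cst.
by apply: cvgM; [exact: cvg_cst|exact: cvg_id].
Qed.

Lemma continuous_fst_affine (a b : R) :
  continuous (fun st : R * R => (a * st.1 + b, st.2)).
Proof.
move=> st; apply: (@cvg_pair _ _ _ (nbhs st) (nbhs _) (nbhs _)); last exact: cvg_snd.
by apply: (@continuous_comp _ _ _ fst (fun t => a * t + b)); [exact: cvg_fst|exact: continuous_affine].
Qed.

Lemma continuous_snd_affine (a b : R) :
  continuous (fun st : R * R => (st.1, a * st.2 + b)).
Proof.
move=> st; apply: (@cvg_pair _ _ _ (nbhs st) (nbhs _) (nbhs _)); first exact: cvg_fst.
by apply: (@continuous_comp _ _ _ snd (fun t => a * t + b)); [exact: cvg_snd|exact: continuous_affine].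
Qed.

Lemma closed_fst_le (a : R) : closed [set st : R * R | st.1 <= a].
Proof. by apply: (@preimage_closed _ _ fst [set x : R | x <= a]) => [? _|];
  [exact: cvg_fst|exact: closed_le]. Qed.

Lemma closed_fst_ge (a : R) : closed [set st : R * R | a <= st.1].
Proof. by apply: (@preimage_closed _ _ fst [set x : R | a <= x]) => [? _|];
  [exact: cvg_fst|exact: closed_ge]. Qed.

Lemma closed_snd_le (a : R) : closed [set st : R * R | st.2 <= a].
Proof. by apply: (@preimage_closed _ _ snd [set x : R | x <= a]) => [? _|];
  [exact: cvg_snd|exact: closed_le]. Qed.

Lemma closed_snd_ge (a : R) : closed [set st : R * R | a <= st.2].
Proof. by apply: (@preimage_closed _ _ snd [set x : R | a <= x]) => [? _|];
  [exact: cvg_snd|exact: closed_ge]. Qed.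

Lemma homotopic_through_refl P f : {within unit_itv, continuous f} ->
  P f -> homotopic_through P f f.
Proof.
move=> cf Pf; exists (fun st => f st.2); split => //.
apply: (@within_comp _ _ _ _ _ snd f) cf.
  by apply: continuous_subspaceT => ?; exact: cvg_snd.
by move=> [? ?] [].
Qed.

Lemma homotopic_through_sym P f g :
  homotopic_through P f g -> homotopic_through P g f.
Proof.
move=> [H [cH Hfg HP]]; exists (fun st => H (1 - st.1, st.2)); split.
- rewrite (_ : (fun _ => _) = H \o (fun st => (-1 * st.1 + 1, st.2))).
    apply: within_comp cH.
      by apply: continuous_subspaceT; exact: continuous_fst_affine.
    move=> [s t] [] /=; rewrite !unit_itvE => ? ?; split => /=; lra.
  by apply/funext => -[s t] /=; rewrite mulN1r addrC.
- by move=> t It; rewrite /= subr0 subrr; have [] := Hfg t It.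
- move=> s; rewrite unit_itvE => Is; apply: (HP (1 - s)); rewrite unit_itvE; lra.
Qed.

Lemma homotopic_through_trans P f g h :
  homotopic_through P f g -> homotopic_through P g h ->
  homotopic_through P f h.
Proof.
move=> [H [cH Hfg HP]] [K [cK Kgh KP]].
exists (fun st => if st.1 <= 2^-1 then H (2 * st.1, st.2)
                  else K (2 * st.1 - 1, st.2)); split.
- apply: (within_paste (closed_fst_le (a := 2^-1))
    (closed_fst_ge (a := 2^-1))
    (u := H \o (fun st => (2 * st.1 + 0, st.2)))
    (v := K \o (fun st => (2 * st.1 + -1, st.2)))).
  + by move=> [s t] _ /=; case: (leP s 2^-1) => ?; [left|right; exact: ltW].
  + apply: within_comp cH.
      by apply: continuous_subspaceT; exact: continuous_fst_affine.
    move=> [s t] [/= ? []] /=; rewrite !unit_itvE => ? ?; split => /=; lra.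
  + apply: within_comp cK.
      by apply: continuous_subspaceT; exact: continuous_fst_affine.
    move=> [s t] [/= ? []] /=; rewrite !unit_itvE => ? ?; split => /=; lra.
  + exact: closed_square.
  + by move=> [s t] /= -> _; rewrite addr0.
  + move=> [s t] /= s2 [_ /= It]; case: ifPn => // s2'.
    have -> : s = 2^-1 by apply/le_anti/andP.
    rewrite divff ?pnatr_eq0// subrr.
    by rewrite (Hfg t It).2 (Kgh t It).1.
- move=> t It /=; rewrite mulr0 invr_ge0 ler0n.
  have -> : (1 <= 2^-1 :> R) = false by apply/negbTE; rewrite -ltNge; lra.
  rewrite (Hfg t It).1; split => //.
  by rewrite (_ : 2 * 1 - 1 = 1) ?(Kgh t It).2//; ring.
- move=> s; rewrite unit_itvE => Is /=.
  by case: (leP s 2^-1) => ?; [apply: (HP (2 * s))|apply: (KP (2 * s - 1))]; rewrite unit_itvE; lra.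
Qed.

Lemma continuous_concat f g : f 1 = g 0 ->
  {within unit_itv, continuous f} -> {within unit_itv, continuous g} ->
  {within unit_itv, continuous (concat f g)}.
Proof.
move=> fg cf cg.
apply: (@within_paste _ _ [set x : R | x <= 2^-1] [set x : R | 2^-1 <= x] _
    (f \o (fun t => 2 * t + 0)) (g \o (fun t => 2 * t + -1))).
- exact: closed_le.
- exact: closed_ge.
- by move=> t _ /=; case: (leP t 2^-1) => ?; [left|right; exact: ltW].
- apply: within_comp cf.
    by apply: continuous_subspaceT; exact: continuous_affine.
  by move=> t /= [? /=]; rewrite !unit_itvE => ?; lra.
- apply: within_comp cg.
    by apply: continuous_subspaceT; exact: continuous_affine.
  by move=> t /= [? /=]; rewrite !unit_itvE => ?; lra.
- exact: closed_unit_itv.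
- by move=> t /= t2 _; rewrite /concat t2 addr0.
- move=> t /= t2 _; rewrite /concat; case: ifPn => // t2'.
  have -> : t = 2^-1 by apply/le_anti/andP.
  by rewrite divff ?pnatr_eq0// subrr.
Qed.

Lemma continuous_reverse f : {within unit_itv, continuous f} ->
  {within unit_itv, continuous (reverse f)}.
Proof.
move=> cf; rewrite (_ : reverse f = f \o (fun t => -1 * t + 1)).
  apply: within_comp cf.
    by apply: continuous_subspaceT; exact: continuous_affine.
  by move=> t /=; rewrite !unit_itvE => ?; lra.
by apply/funext => t; rewrite /reverse /= mulN1r addrC.
Qed.

Lemma based_homotopic_concat x f f' g g' :
  based_homotopic x f f' -> based_homotopic x g g' ->
  based_homotopic x (concat f g) (concat f' g').
Proof.
move=> [H [cH Hf HP]] [K [cK Kg KP]].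
exists (fun st => concat (fun t => H (st.1, t)) (fun t => K (st.1, t)) st.2).
split.
- apply: (within_paste (closed_snd_le (a := 2^-1))
    (closed_snd_ge (a := 2^-1))
    (u := H \o (fun st => (st.1, 2 * st.2 + 0)))
    (v := K \o (fun st => (st.1, 2 * st.2 + -1)))).
  + by move=> [s t] _ /=; case: (leP t 2^-1) => ?; [left|right; exact: ltW].
  + apply: within_comp cH.
      by apply: continuous_subspaceT; exact: continuous_snd_affine.
    move=> [s t] [/= ? []] /=; rewrite !unit_itvE => ? ?; split => /=; lra.
  + apply: within_comp cK.
      by apply: continuous_subspaceT; exact: continuous_snd_affine.
    move=> [s t] [/= ? []] /=; rewrite !unit_itvE => ? ?; split => /=; lra.
  + exact: closed_square.
  + by move=> [s t] /= t2 _; rewrite /concat t2 addr0.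
  + move=> [s t] /= t2 [/= Is _]; rewrite /concat; case: ifPn => // t2'.
    have -> : t = 2^-1 by apply/le_anti/andP.
    rewrite divff ?pnatr_eq0// subrr.
    by rewrite (HP s Is).2 (KP s Is).1.
- move=> t; rewrite unit_itvE => It /=; rewrite /concat; case: (leP t 2^-1) => ?.
    by have [] := Hf (2 * t); rewrite ?unit_itvE //; lra.
  by have [] := Kg (2 * t - 1); rewrite ?unit_itvE //; lra.
- move=> s Is /=; rewrite /concat mulr0 invr_ge0 ler0n (HP s Is).1.
  have -> : (1 <= 2^-1 :> R) = false by apply/negbTE; rewrite -ltNge; lra.
  split => //.
  by rewrite (_ : 2 * 1 - 1 = 1) ?(KP s Is).2//; ring.
Qed.

Lemma based_homotopic_reverse x f f' :
  based_homotopic x f f' -> based_homotopic x (reverse f) (reverse f').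
Proof.
move=> [H [cH Hf HP]].
exists (H \o (fun st => (st.1, -1 * st.2 + 1))); split.
- apply: within_comp cH.
    by apply: continuous_subspaceT; exact: continuous_snd_affine.
  move=> [s t] [] /=; rewrite !unit_itvE => ? ?; split => /=; lra.
- move=> t; rewrite unit_itvE => It /=; rewrite /reverse mulN1r addrC.
  by apply: Hf; rewrite unit_itvE; lra.
- move=> s Is /=; rewrite mulr0 add0r mulr1 addNr.
  by have [-> ->] := HP s Is.
Qed.

Lemma based_homotopic_reparam x f g h phi psi :
  {within unit_itv, continuous f} -> continuous phi -> continuous psi ->
  (forall t, unit_itv t -> unit_itv (phi t) /\ unit_itv (psi t)) ->
  phi 0 = psi 0 -> phi 1 = psi 1 -> f (phi 0) = x -> f (phi 1) = x ->
  (forall t, unit_itv t -> g t = f (phi t)) ->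
  (forall t, unit_itv t -> h t = f (psi t)) ->
  based_homotopic x g h.
Proof.
move=> cf cphi cpsi I01 e0 e1 f0 f1 gE hE.
exists (f \o (fun st => (1 - st.1) * phi st.2 + st.1 * psi st.2)); split.
- apply: within_comp cf.
    apply: continuous_subspaceT => st.
    apply: cvgD; apply: cvgM.
    + by apply: cvgB; [exact: cvg_cst|exact: cvg_fst].
    + by apply: (@continuous_comp _ _ _ snd phi); [exact: cvg_snd|exact: cphi].
    + exact: cvg_fst.
    + by apply: (@continuous_comp _ _ _ snd psi); [exact: cvg_snd|exact: cpsi].
  move=> [s t] [/= Is /I01 /= []]; move: Is; rewrite !unit_itvE.
  move=> /andP[s0 s1] /andP[p0 p1] /andP[q0 q1].
  have ? : 0 <= 1 - s by lra.
  rewrite addr_ge0 ?mulr_ge0//=.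
  have : (1 - s) * phi t <= (1 - s) * 1 by rewrite ler_wpM2l.
  have : s * psi t <= s * 1 by rewrite ler_wpM2l.
  lra.
- move=> t It /=; rewrite subr0 subrr !mul0r !mul1r addr0 add0r.
  by rewrite gE// hE.
- by move=> s Is /=; rewrite -e0 -e1 -!mulrDl subrK !mul1r.
Qed.

End homotopy.

Section fundamental_group.
Context (R : realType) {X : topologicalType} (x : X).

Record loop := Loop {
  loop_fun :> R -> X;
  loop_continuous : {within unit_itv, continuous loop_fun};
  loop_0 : loop_fun 0 = x;
  loop_1 : loop_fun 1 = x }.

HB.instance Definition _ := gen_eqMixin loop.
HB.instance Definition _ := gen_choiceMixin loop.

Definition loop_eqv (a b : loop) := `[< based_homotopic x a b >].

Lemma loop_eqv_refl : reflexive loop_eqv.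
Proof.
move=> a; apply/asboolP; apply: homotopic_through_refl; last first.
  by rewrite /= loop_0 loop_1.
exact: loop_continuous.
Qed.

Lemma loop_eqv_sym : symmetric loop_eqv.
Proof.
by move=> a b; apply/asboolP/asboolP; exact: homotopic_through_sym.
Qed.

Lemma loop_eqv_trans : transitive loop_eqv.
Proof.
move=> b a c /asboolP ab /asboolP bc; apply/asboolP.
exact: homotopic_through_trans ab bc.
Qed.

Canonical loop_equiv := EquivRel loop_eqv loop_eqv_refl loop_eqv_sym
  loop_eqv_trans.

Definition pi1 := {eq_quot loop_equiv}.

HB.instance Definition _ := Choice.on pi1.
HB.instance Definition _ := EqQuotient.on pi1.

Lemma loop_concat_subproof (a b : loop) :
  [/\ {within unit_itv, continuous (concat a b)},
      concat a b 0 = x & concat a b 1 = x].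
Proof.
split; rewrite ?/concat.
- apply: continuous_concat; rewrite ?loop_0 ?loop_1//; exact: loop_continuous.
- by rewrite invr_ge0 ler0n mulr0 loop_0.
- rewrite ifF; last by apply/negbTE; rewrite -ltNge; lra.
  by rewrite (_ : 2 * 1 - 1 = 1) ?loop_1//; ring.
Qed.

Definition loop_concat (a b : loop) : loop :=
  let: And3 c e0 e1 := loop_concat_subproof a b in Loop c e0 e1.

Lemma loop_rev_subproof (a : loop) :
  [/\ {within unit_itv, continuous (reverse a)},
      reverse a 0 = x & reverse a 1 = x].
Proof.
rewrite /reverse subr0 subrr loop_0 loop_1; split => //.
by apply: continuous_reverse; exact: loop_continuous.
Qed.

Definition loop_rev (a : loop) : loop :=
  let: And3 c e0 e1 := loop_rev_subproof a in Loop c e0 e1.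

Definition loop_cst : loop :=
  @Loop (fun=> x) (continuous_subspaceT (@cst_continuous _ _ x)) erefl erefl.

(* The product of the classes of a and b is the class of "a, then b". *)
Definition pi1_mul (g h : pi1) : pi1 := \pi_pi1 (loop_concat (repr g) (repr h)).
Definition pi1_inv (g : pi1) : pi1 := \pi_pi1 (loop_rev (repr g)).
Definition pi1_one : pi1 := \pi_pi1 loop_cst.

Lemma loop_concatE (a b : loop) : loop_concat a b = concat a b :> (R -> X).
Proof. by rewrite /loop_concat; case: loop_concat_subproof. Qed.

Lemma loop_revE (a : loop) : loop_rev a = reverse a :> (R -> X).
Proof. by rewrite /loop_rev; case: loop_rev_subproof. Qed.

Lemma pi1P (a b : loop) : (\pi_pi1 a = \pi_pi1 b) <-> based_homotopic x a b.
Proof.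
split => [/eqmodP/asboolP//|ab]; apply/eqmodP; exact/asboolP.
Qed.

Lemma pi1_mulE (a b : loop) :
  pi1_mul (\pi_pi1 a) (\pi_pi1 b) = \pi_pi1 (loop_concat a b).
Proof.
apply/pi1P; rewrite !loop_concatE; apply: based_homotopic_concat;
  by apply/pi1P; rewrite reprK.
Qed.

Lemma pi1_invE (a : loop) : pi1_inv (\pi_pi1 a) = \pi_pi1 (loop_rev a).
Proof.
apply/pi1P; rewrite !loop_revE; apply: based_homotopic_reverse.
by apply/pi1P; rewrite reprK.
Qed.

Lemma loop_reparam (a b c : loop) (phi psi : R -> R) :
  continuous phi -> continuous psi ->
  (forall t, unit_itv t -> unit_itv (phi t) /\ unit_itv (psi t)) ->
  phi 0 = psi 0 -> phi 1 = psi 1 -> a (phi 0) = x -> a (phi 1) = x ->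
  (forall t, unit_itv t -> b t = a (phi t)) ->
  (forall t, unit_itv t -> c t = a (psi t)) ->
  \pi_pi1 b = \pi_pi1 c.
Proof.
move=> cphi cpsi I01 e0 e1 a0 a1 bE cE; apply/pi1P.
exact: (based_homotopic_reparam (loop_continuous (l := a)) cphi cpsi).
Qed.

Let continuous_minr (phi psi : R -> R) : continuous phi -> continuous psi ->
  continuous (fun t => Num.min (phi t) (psi t)).
Proof. by move=> cphi cpsi t; apply: (@continuous_min _ _ phi psi); [exact: cphi|exact: cpsi]. Qed.

Let continuous_maxr (phi psi : R -> R) : continuous phi -> continuous psi ->
  continuous (fun t => Num.max (phi t) (psi t)).
Proof. by move=> cphi cpsi t; apply: (@continuous_max _ _ phi psi); [exact: cphi|exact: cpsi]. Qed.

Lemma pi1_mulA : associative pi1_mul.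
Proof.
elim/quotW => a; elim/quotW => b; elim/quotW => c.
rewrite (pi1_mulE a b) (pi1_mulE b c) !pi1_mulE.
pose phi (t : R) := Num.min (2 * t + 0) (Num.min (1 * t + 4^-1) (2^-1 * t + 2^-1)).
have phi1 t : t <= 4^-1 -> phi t = 2 * t.
  by move=> ?; rewrite /phi min_l ?addr0// le_min; apply/andP; split; lra.
have phi2 t : 4^-1 <= t <= 2^-1 -> phi t = t + 4^-1.
  by move=> ?; rewrite /phi min_r ?min_l ?mul1r//; lra.
have phi3 t : 2^-1 <= t -> phi t = (t + 1) / 2.
  move=> ?; rewrite /phi min_r; last by rewrite min_r; lra.
  by rewrite min_r; lra.
apply/esym/(@loop_reparam (loop_concat a (loop_concat b c)) _ _ phi id) => //.
- apply: continuous_minr; first exact: continuous_affine.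
  by apply: continuous_minr; exact: continuous_affine.
- by move=> t; exact: cvg_id.
- move=> t; rewrite unit_itvE => It; split => //; rewrite unit_itvE.
  have [t4|t4] := leP t 4^-1; first by rewrite phi1//; lra.
  by have [t2|t2] := leP t 2^-1; [rewrite phi2|rewrite phi3]; lra.
- by rewrite phi1 ?mulr0// invr_ge0.
- by rewrite phi3; lra.
- by rewrite phi1 ?mulr0 ?loop_0// invr_ge0.
- have -> : phi 1 = 1 by rewrite phi3; lra.
  exact: loop_1.
- move=> t _; rewrite !loop_concatE /concat.
  have [t4|t4] := leP t 4^-1.
    rewrite phi1//.
    have -> : t <= 2^-1 by lra.
    by have -> : 2 * t <= 2^-1 by lra.
  have [t2|t2] := leP t 2^-1.
    rewrite phi2; last lra.
    have -> : (2 * t <= 2^-1) = false by apply/negbTE; rewrite -ltNge; lra.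
    have -> : (t + 4^-1 <= 2^-1) = false by apply/negbTE; rewrite -ltNge; lra.
    have -> : 2 * (t + 4^-1) - 1 <= 2^-1 by lra.
    by congr (b _); field.
  rewrite phi3; last lra.
  have -> : ((t + 1) / 2 <= 2^-1) = false.
    by apply/negbTE; rewrite -ltNge; lra.
  have -> : (2 * ((t + 1) / 2) - 1 <= 2^-1) = false.
    by apply/negbTE; rewrite -ltNge; lra.
  by congr (c _); field.
Qed.

Lemma pi1_mul1g : left_id pi1_one pi1_mul.
Proof.
elim/quotW => a; rewrite pi1_mulE.
apply/(@loop_reparam a _ _ (fun t => Num.max 0 (2 * t + -1)) id) => //.
- apply: continuous_maxr; first exact: cst_continuous.
  exact: continuous_affine.
- by move=> t; exact: cvg_id.
- move=> t; rewrite unit_itvE => It; split => //; rewrite unit_itvE.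
  by rewrite ge_max le_max lexx ler01/=; lra.
- by rewrite max_l//; lra.
- by rewrite max_r; lra.
- have -> : Num.max 0 (2 * 0 + -1) = 0 :> R by rewrite max_l; lra.
  exact: loop_0.
- have -> : Num.max 0 (2 * 1 + -1) = 1 :> R by rewrite max_r; lra.
  exact: loop_1.
- move=> t _; rewrite loop_concatE /concat; have [t2|t2] := leP t 2^-1.
    by rewrite max_l ?loop_0//; lra.
  by rewrite max_r//; lra.
Qed.

Lemma pi1_mulg1 : right_id pi1_one pi1_mul.
Proof.
elim/quotW => a; rewrite pi1_mulE.
apply/(@loop_reparam a _ _ (fun t => Num.min (2 * t + 0) 1) id) => //.
- apply: continuous_minr; last exact: cst_continuous.
  exact: continuous_affine.
- by move=> t; exact: cvg_id.
- move=> t; rewrite unit_itvE => It; split => //; rewrite unit_itvE.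
  by rewrite le_min ge_min lexx orbT ler01/=; lra.
- by rewrite min_l; lra.
- by rewrite min_r//; lra.
- have -> : Num.min (2 * 0 + 0) 1 = 0 :> R by rewrite min_l; lra.
  exact: loop_0.
- have -> : Num.min (2 * 1 + 0) 1 = 1 :> R by rewrite min_r; lra.
  exact: loop_1.
- move=> t _; rewrite loop_concatE /concat; have [t2|t2] := leP t 2^-1.
    by rewrite min_l ?addr0//; lra.
  by rewrite min_r ?loop_1//; lra.
Qed.

Lemma pi1_mulgV : right_inverse pi1_one pi1_inv pi1_mul.
Proof.
elim/quotW => a; rewrite pi1_invE pi1_mulE.
apply/(@loop_reparam a _ _
  (fun t => Num.min (2 * t + 0) (- 2 * t + 2)) (fun=> 0)) => //.
- by apply: continuous_minr; exact: continuous_affine.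
- by move=> t; exact: cst_continuous.
- move=> t; rewrite !unit_itvE => It; split; last by rewrite lexx ler01.
  rewrite le_min ge_min; apply/andP; split; first by apply/andP; split; lra.
  by have [?|?] := leP t 2^-1; apply/orP; [left|right]; lra.
- by rewrite min_l; lra.
- by rewrite min_r; lra.
- have -> : Num.min (2 * 0 + 0) (- 2 * 0 + 2) = 0 :> R by rewrite min_l; lra.
  exact: loop_0.
- have -> : Num.min (2 * 1 + 0) (- 2 * 1 + 2) = 0 :> R by rewrite min_r; lra.
  exact: loop_0.
- move=> t _; rewrite loop_concatE /concat; have [t2|t2] := leP t 2^-1.
    by rewrite min_l ?addr0//; lra.
  rewrite loop_revE /reverse min_r; last lra.
  by congr (a _); ring.
- by move=> t _; rewrite loop_0.
Qed.

Lemma pi1_mulVg : left_inverse pi1_one pi1_inv pi1_mul.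
Proof.
elim/quotW => a; rewrite pi1_invE pi1_mulE.
apply/(@loop_reparam a _ _
  (fun t => Num.max (- 2 * t + 1) (2 * t + -1)) (fun=> 1)) => //.
- by apply: continuous_maxr; exact: continuous_affine.
- by move=> t; exact: cst_continuous.
- move=> t; rewrite !unit_itvE => It; split; last by rewrite lexx ler01.
  rewrite le_max ge_max; apply/andP; split; last by apply/andP; split; lra.
  by have [?|?] := leP t 2^-1; apply/orP; [left|right]; lra.
- by rewrite max_l; lra.
- by rewrite max_r; lra.
- have -> : Num.max (- 2 * 0 + 1) (2 * 0 + -1) = 1 :> R by rewrite max_l; lra.
  exact: loop_1.
- have -> : Num.max (- 2 * 1 + 1) (2 * 1 + -1) = 1 :> R by rewrite max_r; lra.
  exact: loop_1.
- move=> t _; rewrite loop_concatE /concat; have [t2|t2] := leP t 2^-1.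
    rewrite loop_revE /reverse max_l; last lra.
    by congr (a _); ring.
  by rewrite max_r//; lra.
- by move=> t _; rewrite loop_1.
Qed.

HB.instance Definition _ := isGroup.Build pi1
  pi1_mulA pi1_mul1g pi1_mulg1 pi1_mulVg pi1_mulgV.

End fundamental_group.

Section PSL2.
Context (R : realType).

Record SL2 := Sl2 { sl2_val : 'M[R]_2; sl2_det : \det sl2_val == 1 }.

HB.instance Definition _ := [isSub for sl2_val].
HB.instance Definition _ := [Choice of SL2 by <:].

Definition sl2_opp_eqv (A B : SL2) := (val A == val B) || (val A == - val B).

Lemma sl2_opp_eqv_refl : reflexive sl2_opp_eqv.
Proof. by move=> A; rewrite /sl2_opp_eqv eqxx. Qed.

Lemma sl2_opp_eqv_sym : symmetric sl2_opp_eqv.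
Proof.
move=> A B; rewrite /sl2_opp_eqv [val B == val A]eq_sym.
by rewrite [val B == - _]eq_sym eqr_oppLR.
Qed.

Lemma sl2_opp_eqv_trans : transitive sl2_opp_eqv.
Proof.
move=> B A C; rewrite /sl2_opp_eqv => /orP[]/eqP -> /orP[]/eqP ->;
  by rewrite ?opprK eqxx ?orbT.
Qed.

Canonical sl2_opp_equiv :=
  EquivRel sl2_opp_eqv sl2_opp_eqv_refl sl2_opp_eqv_sym sl2_opp_eqv_trans.

Definition PSL2 := {eq_quot sl2_opp_equiv}.

HB.instance Definition _ := Choice.on PSL2.
HB.instance Definition _ := EqQuotient.on PSL2.

Lemma sl2_mul_subproof (A B : SL2) : \det (val A *m val B) == 1.
Proof. by rewrite det_mulmx (eqP (sl2_det A)) (eqP (sl2_det B)) mulr1. Qed.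

Lemma sl2_inv_subproof (A : SL2) : \det (invmx (val A)) == 1.
Proof. by rewrite det_inv (eqP (sl2_det A)) invr1. Qed.

Lemma sl2_one_subproof : \det (1%:M : 'M[R]_2) == 1.
Proof. by rewrite det1. Qed.

Definition sl2_mul (A B : SL2) : SL2 := Sl2 (sl2_mul_subproof A B).
Definition sl2_inv (A : SL2) : SL2 := Sl2 (sl2_inv_subproof A).
Definition sl2_one : SL2 := Sl2 sl2_one_subproof.

Definition psl2_mul (g h : PSL2) : PSL2 := \pi_PSL2 (sl2_mul (repr g) (repr h)).
Definition psl2_inv (g : PSL2) : PSL2 := \pi_PSL2 (sl2_inv (repr g)).
Definition psl2_one : PSL2 := \pi_PSL2 sl2_one.

Lemma psl2P (A B : SL2) :
  \pi_PSL2 A = \pi_PSL2 B <-> val A = val B \/ val A = - val B.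
Proof.
split => [/eqmodP/orP[]/eqP ->|AB]; [by left|by right|].
by apply/eqmodP/orP; case: AB => ->; rewrite eqxx; [left|right].
Qed.

Lemma psl2_mulE (A B : SL2) :
  psl2_mul (\pi_PSL2 A) (\pi_PSL2 B) = \pi_PSL2 (sl2_mul A B).
Proof.
apply/psl2P => /=.
have /psl2P := reprK (\pi_PSL2 A); have /psl2P := reprK (\pi_PSL2 B).
move=> [] -> [] ->; rewrite ?mulNmx ?mulmxN ?opprK; by [left|right].
Qed.

Lemma sl2_unitmx (A : SL2) : val A \in unitmx.
Proof. by rewrite unitmxE (eqP (sl2_det A)) unitr1. Qed.

Lemma psl2_invE (A : SL2) : psl2_inv (\pi_PSL2 A) = \pi_PSL2 (sl2_inv A).
Proof.
apply/psl2P => /=.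
have /psl2P := reprK (\pi_PSL2 A) => -[] ->; [by left|right].
by rewrite -scaleN1r invmxZ ?unitmxZ ?unitrN1 ?sl2_unitmx// invrN1 scaleN1r.
Qed.

Lemma psl2_mulA : associative psl2_mul.
Proof.
elim/quotW => A; elim/quotW => B; elim/quotW => C.
rewrite (psl2_mulE A B) (psl2_mulE B C) !psl2_mulE.
by congr (\pi_PSL2 _); apply/val_inj; rewrite /= mulmxA.
Qed.

Lemma psl2_mul1g : left_id psl2_one psl2_mul.
Proof.
elim/quotW => A; rewrite psl2_mulE.
by congr (\pi_PSL2 _); apply/val_inj; rewrite /= mul1mx.
Qed.

Lemma psl2_mulg1 : right_id psl2_one psl2_mul.
Proof.
elim/quotW => A; rewrite psl2_mulE.
by congr (\pi_PSL2 _); apply/val_inj; rewrite /= mulmx1.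
Qed.

Lemma psl2_mulVg : left_inverse psl2_one psl2_inv psl2_mul.
Proof.
elim/quotW => A; rewrite psl2_invE psl2_mulE.
by congr (\pi_PSL2 _); apply/val_inj; rewrite /= mulVmx// sl2_unitmx.
Qed.

Lemma psl2_mulgV : right_inverse psl2_one psl2_inv psl2_mul.
Proof.
elim/quotW => A; rewrite psl2_invE psl2_mulE.
by congr (\pi_PSL2 _); apply/val_inj; rewrite /= mulmxV// sl2_unitmx.
Qed.

HB.instance Definition _ := isGroup.Build PSL2
  psl2_mulA psl2_mul1g psl2_mulg1 psl2_mulVg psl2_mulgV.

End PSL2.

Section isometries.
Context {R : realType}.
Implicit Types g : PSL2 R.

(* One of the two matrices representing g; everything below is insensitive
   to its sign. *)
Definition psl2_mx g : 'M[R]_2 := val (repr g).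

Definition mx22 (a b c d : R) : 'M[R]_2 :=
  \matrix_(i, j) if i == 0 then (if j == 0 then a else b)
                 else (if j == 0 then c else d).

Lemma det_mx22E a b c d : \det (mx22 a b c d) = a * d - b * c.
Proof.
rewrite (expand_det_row _ ord0) !big_ord_recl big_ord0 /cofactor !det_mx11.
by rewrite !mxE /= expr0 expr1; ring.
Qed.

Lemma shift_subproof : \det (mx22 1 1 0 1) == 1.
Proof. by rewrite det_mx22E mulr1 mulr0 subr0. Qed.

Lemma rotation_subproof t :
  \det (mx22 (cos (t / 2)) (sin (t / 2)) (- sin (t / 2)) (cos (t / 2))) == 1.
Proof. by rewrite det_mx22E mulrN opprK -!expr2 cos2Dsin2. Qed.

(* z |-> z + 1 *)
Definition shift : PSL2 R := \pi_(PSL2 R) (Sl2 shift_subproof).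

(* The isometry of the upper half-plane fixing 'i with derivative exp('i t)
   there, i.e. the anti-clockwise rotation of angle t about 'i. *)
Definition rotation (t : R) : PSL2 R :=
  \pi_(PSL2 R) (Sl2 (rotation_subproof t)).

Definition conjugate g h := exists k, g = (h ^ k)%g.

Definition hyperbolic g := 2 < `|\tr (psl2_mx g)|.

Definition elliptic g := `|\tr (psl2_mx g)| < 2.

Definition positive_parabolic g := conjugate g shift.

Definition rotation_angle g : R :=
  xget 0 [set t | 0 < t < 2 * pi /\ conjugate g (rotation t)].

(* The last case consists of the negative parabolic elements and of the
   identity. *)
Definition theta g : R :=
  if `[< hyperbolic g \/ positive_parabolic g >] then 0
  else if elliptic g then rotation_angle g
  else 2 * pi.

(* The point u / v of the boundary of the upper half-plane with
   u = sin (x / 2) and v = cos (x / 2), as the line of direction (u, v); the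
   boundary is oriented anti-clockwise by increasing u / v, that is, by
   increasing x, and x is determined up to 2 pi. *)
Definition direction (x : R) : 'cV[R]_2 :=
  \col_i if i == 0 then sin (x / 2) else cos (x / 2).

(* The universal cover of PSL2 R, realised as the group (for composition) of
   the lifts to R of the projective action on the boundary: f is an element of
   it that lies over g. For instance x |-> x + t lies over rotation t. *)
Definition lies_over (f : R -> R) g := continuous f /\
  forall x, exists l, psl2_mx g *m direction x = l *: direction (f x).

(* The limit exists and does not depend on the starting point, here 0. *)
Definition translation_number (f : R -> R) : R :=
  lim ((fun k => iter k f 0 / k%:R) @ \oo).

End isometries.

Section punctured_sphere.
Context {R : realType} {n : nat}.
Implicit Types p : 'I_n -> 'rV[R]_3.

Definition dot (u v : 'rV[R]_3) : R := (u *m v^T) 0 0.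

Definition punctured_sphere p : set 'rV[R]_3 :=
  [set v | dot v v = 1 /\ forall i, v != p i].

(* A round circle on the sphere bounding a spherical disc of centre p i that
   contains no other puncture. It runs anti-clockwise around p i for the
   orientation of the sphere by its outward normal: (u, v, p i) is a direct
   orthonormal frame. *)
Definition positive_circle p (i : 'I_n) (f : R -> punctured_sphere p) :=
  exists u v r,
  [/\ [/\ dot u u = 1, dot v v = 1, dot u v = 0, dot u (p i) = 0
        & dot v (p i) = 0],
      \det (col_mx u (col_mx v (p i)) : 'M[R]_3) = 1,
      0 < r < pi,
      forall j, j != i -> dot (p j) (p i) < cos r &
      forall t, unit_itv t -> set_val (f t) = cos r *: p i +
        sin r *: (cos (2 * pi * t) *: u + sin (2 * pi * t) *: v)].

End punctured_sphere.

(* g is freely homotopic to f. *)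
Definition represented_by (R : realType) (X : topologicalType) (x : X)
    (g : pi1 R x) (f : R -> X) :=
  exists2 a : loop R x, g = \pi_(pi1 R x) a & freely_homotopic a f.

Section representations.
Context {R : realType} {n : nat} {p : 'I_n -> 'rV[R]_3}.
Context {x : punctured_sphere p}.
Implicit Types (c : 'I_n -> pi1 R x) (rho : {multiplicative pi1 R x -> PSL2 R}).

Definition peripheral_family c :=
  forall i, exists2 f, positive_circle i f & represented_by (c i) f.

Definition is_lift rho (rho' : pi1 R x -> R -> R) :=
  (forall g, lies_over (rho' g) (rho g)) /\
  (forall g h, rho' (g * h)%g = rho' g \o rho' h).

(* v is the volume of rho, i.e. the integral of the pull-back of the hyperbolic
   area form by a rho-equivariant map to the upper half-plane that is adapted
   to the punctures, computed by the formula of Burger, Iozzi and Wienhard. As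
   the fundamental group is free, rho has a lift rho'; changing it, or changing
   the c i in their conjugacy classes, does not change v. *)
Definition is_volume c rho (v : R) :=
  exists2 rho', is_lift rho rho' & v = - \sum_i translation_number (rho' (c i)).

Definition Theta c rho : R := \sum_i theta (rho (c i)).

Definition is_relative_euler_class c rho (e : R) :=
  exists2 v, is_volume c rho v & e = (v + Theta c rho) / (2 * pi).

Definition super_maximal c rho :=
  is_relative_euler_class c rho (n%:R - 1) \/
  is_relative_euler_class c rho n%:R.

Definition totally_non_hyperbolic rho := forall g : pi1 R x,
  (exists2 f, simple_closed_curve f & represented_by g f) ->
  ~ hyperbolic (rho g).

End representations.

(* Main.v *)
From HB Require Import structures.
Require Import Defs.
From mathcomp Require Import all_boot all_order all_algebra.
From mathcomp Require Import generic_quotient.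
From mathcomp Require Import all_classical all_reals all_analysis.
From mathcomp Require Import zify ring lra.

(** Let f be a lift to the line of an element g of PSL2 R. It is increasing and
    commutes with the translation by 2 pi, and 2 pi + T(f) - theta(g) is equal
    to 2 pi A for an integer A such that f x <= x + 2 pi A for all x
    ([peripheral_displacement]); the values of theta on the parabolic elements
    and on the identity are those that make this true. Write A_i for the integer
    attached to the lift of rho (c i). The sum of the A_i is n - eu(rho), so rho
    is super-maximal only if this sum is at most 1. Moreover the inequality
    f x <= x + 2 pi A is inherited by products, the integers being added, and by
    conjugates.

    A simple closed curve gamma separates the punctures into two sets I and J,
    and its class or its inverse is a product of conjugates of the c_i for i
    in I, while the opposite is a product of conjugates of the c_j for j in J
    ([simple_curve_two_sides]). If rho (gamma) were hyperbolic, its lift f would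
    satisfy x + 2 pi m < f x for some x and f y < y + 2 pi m for some y
    ([hyperbolic_displacement]). The first inequality forces the sum of the A_i
    on one side to exceed m, the second one, read for the inverse of gamma,
    forces the sum on the other side to exceed -m. So the sum of all the A_i
    would be at least 2, a contradiction.

    The factorizations on the two sides come from a lattice version of the
    Jordan curve theorem. Stereographic projection from a puncture i0 turns
    gamma into a curve of the plane. On a fine square grid it is homotopic, off
    the other punctures, to a closed lattice path. As gamma is injective, this
    path meets a vertex twice only at close times, so it can be made simple by
    erasing loops that lie in small squares without punctures
    ([curve_lattice_cycle]). Each edge of the lattice carries an element of the
    fundamental group, and the holonomy of a simple lattice cycle is a product
    of conjugates of the holonomies of the faces that it encloses, each of them
    once ([jordan]); the same holds for the faces between the cycle and a large
    square ([keyhole]). A face without puncture has trivial holonomy, a face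
    that contains the image of p i gives a conjugate of c_i, and the large
    square a conjugate of the inverse of c_i0. *)

Set Implicit Arguments.
Unset Strict Implicit.
Unset Printing Implicit Defensive.

Import Order.TTheory GRing.Theory Num.Theory.
Import numFieldNormedType.Exports.
Local Open Scope classical_set_scope.
Local Open Scope ring_scope.
Local Open Scope quotient_scope.

(** * Products of conjugates *)

Section products.
Context (G : groupType) (I : eqType) (F : I -> G).
Local Open Scope group_scope.

Fixpoint conj_prod (s : seq I) (g : G) : Prop :=
  if s is i :: s' then exists k h, g = (F i) ^ k * h /\ conj_prod s' h
  else g = 1.

Lemma conj_prod_cat s t g h :
  conj_prod s g -> conj_prod t h -> conj_prod (s ++ t) (g * h).
Proof.
elim: s g => [|i s IHs] g /= => [-> //|[k [g' [-> sg']]] th].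
  by rewrite mul1g.
by exists k, (g' * h); rewrite mulgA; split => //; exact: IHs.
Qed.

Lemma conj_prodJ s g k : conj_prod s g -> conj_prod s (g ^ k).
Proof.
elim: s g => [|i s IHs] g /= => [->|[l [h [-> sh]]]]; first by rewrite conj1g.
by exists (l * k), (h ^ k); rewrite conjMg conjgM; split => //; exact: IHs.
Qed.

Lemma conj_prod1 i k : conj_prod [:: i] ((F i) ^ k).
Proof. by exists k, 1; rewrite mulg1. Qed.

End products.

(** * Holonomy along lattice paths *)

Notation vertex := (nat * nat)%type.

Definition adj : rel vertex := fun u v =>
  ((u.1 == v.1) && ((u.2 == v.2.+1) || (v.2 == u.2.+1))) ||
  ((u.2 == v.2) && ((u.1 == v.1.+1) || (v.1 == u.1.+1))).

Lemma adj_sym u v : adj u v = adj v u.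
Proof. by case: u v => [u1 u2] [v1 v2]; rewrite /adj /=; lia. Qed.

Lemma last_rev_belast (T : Type) (u : T) s : last (last u s) (rev (belast u s)) = u.
Proof. by case: s => //= w s; rewrite rev_cons last_rcons. Qed.

Section holonomy.
Context (G : groupType) (phi : vertex -> vertex -> G).
Hypothesis phiV : forall u v, (phi v u = (phi u v)^-1)%g.
Local Open Scope group_scope.

(** Closed paths are lists in which the initial vertex is not repeated; their
    base point is the head of the list. *)
Fixpoint hol u s := if s is v :: s' then phi u v * hol v s' else 1.

Definition holc s := if s is u :: s' then hol u (rcons s' u) else 1.

Lemma hol_cat u s t : hol u (s ++ t) = hol u s * hol (last u s) t.
Proof. by elim: s u => [|v s IHs] u /=; rewrite ?mul1g// IHs mulgA. Qed.

Lemma hol_rcons u s v : hol u (rcons s v) = hol u s * phi (last u s) v.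
Proof. by rewrite -cats1 hol_cat /= mulg1. Qed.

Lemma hol_rev u s : hol (last u s) (rev (belast u s)) = (hol u s)^-1.
Proof.
elim: s u => [|v s IHs] u /=; first by rewrite invg1.
rewrite rev_cons hol_rcons IHs invgM last_rev_belast.
by rewrite (phiV u v).
Qed.

(** Moving the base point along the path conjugates the holonomy by the part
    of the path that is skipped. *)
Lemma holc_rot n s : exists k, holc (rot n s) = (holc s) ^ k.
Proof.
have [?|] := leqP (size s) n; first by exists 1; rewrite rot_oversize// conjg1.
elim: n => [|n IHn] ns; first by exists 1; rewrite rot0 conjg1.
have [k] := IHn (ltnW ns); rewrite rotS 1?ltnW//.
case: (rot n s) => [|u [|v t]] e; first by exists k.
  by exists k.
exists (k * phi u v); rewrite conjgM -e rot1_cons /= !hol_rcons conjgE.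
by rewrite !last_rcons -!mulgA mulKg.
Qed.

Lemma holc_rev s : exists k, holc (rev s) = ((holc s)^-1) ^ k.
Proof.
case: s => [|u s]; first by exists 1; rewrite /= invg1 conj1g.
have [k] := holc_rot 1 (rev (rcons s u)).
rewrite rev_rcons rot1_cons -rev_cons => ->; exists k; congr (_ ^ _).
have := hol_rev u (rcons s u).
by rewrite last_rcons belast_rcons rev_cons => <-.
Qed.

End holonomy.

(** * Winding numbers of lattice cycles *)

Ltac bool_cases := repeat (match goal with
  | |- context [@eq_op _ ?a ?b] => case: (@eqP _ a b) => ?
  | |- context [(?a <= ?b)%N] => case: (leqP a b) => ?
  end; rewrite /= ?andbF /=; try by []; try (exfalso; lia)); try by [].

Section winding.
Local Open Scope ring_scope.

Fixpoint psum (g : vertex -> vertex -> int) u s :=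
  if s is v :: s' then g u v + psum g v s' else 0.

Definition csum g s := if s is u :: s' then psum g u (rcons s' u) else 0.

Definition antisym g := forall u v : vertex, g v u = - g u v :> int.

Lemma psum_cat g u s t : psum g u (s ++ t) = psum g u s + psum g (last u s) t.
Proof. by elim: s u => [|v s IHs] u /=; rewrite ?add0r// IHs addrA. Qed.

Lemma psum_rcons g u s v : psum g u (rcons s v) = psum g u s + g (last u s) v.
Proof. by rewrite -cats1 psum_cat /= addr0. Qed.

Lemma psum_rev g u s : antisym g ->
  psum g (last u s) (rev (belast u s)) = - psum g u s.
Proof.
move=> gV; elim: s u => [|v s IHs] u /=; first by rewrite oppr0.
by rewrite rev_cons psum_rcons IHs last_rev_belast (gV u v); ring.
Qed.

Lemma csum_rot g n s : csum g (rot n s) = csum g s.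
Proof.
have [?|] := leqP (size s) n; first by rewrite rot_oversize.
elim: n => [|n IHn] ns; first by rewrite rot0.
rewrite -IHn 1?ltnW// rotS 1?ltnW//.
case: (rot n s) => [|u [|v t]] //.
by rewrite rot1_cons /= !psum_rcons !last_rcons; ring.
Qed.

Lemma csum_rev g s : antisym g -> csum g (rev s) = - csum g s.
Proof.
move=> gV; case: s => [|u s]; first by rewrite /= oppr0.
have := csum_rot g 1 (rev (rcons s u)).
rewrite rev_rcons rot1_cons -rev_cons => ->.
have := psum_rev u (rcons s u) gV.
by rewrite last_rcons belast_rcons rev_cons => <-.
Qed.

Lemma psumP (g : vertex -> vertex -> int) (P : vertex -> int) u s : (forall a b, adj a b -> g a b = P a - P b) ->
  path adj u s -> psum g u s = P u - P (last u s).
Proof.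
move=> gP; elim: s u => [|v s IHs] u /=; first by rewrite subrr.
by move=> /andP[uv vs]; rewrite gP// IHs//; ring.
Qed.

Lemma psum0 g u s :
  (forall a b, a \in u :: s -> b \in u :: s -> adj a b -> g a b = 0) ->
  path adj u s -> psum g u s = 0.
Proof.
elim: s u => [//|v s IHs] u g0 /= /andP[uv vs].
rewrite (g0 u v) ?inE ?eqxx ?orbT// IHs// => a b av bv.
by apply: g0; rewrite in_cons ?av ?bv orbT.
Qed.

Lemma psumD g1 g2 u s :
  psum (fun a b => g1 a b + g2 a b) u s = psum g1 u s + psum g2 u s.
Proof. by elim: s u => [|v s IHs] u //=; rewrite IHs; ring. Qed.

(** Faces are named by their top-left corner: f is the unit square with
    opposite corners f and (f.1.+1, f.2.-1). Signed passages through the left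
    edge of the face (k, j), downwards being positive. *)
Definition vedge (k j : nat) : vertex -> vertex -> int := fun u v =>
  ((u == (k, j)) && (v == (k, j.-1)) && (0 < j)%N)%:Z - ((v == (k, j)) && (u == (k, j.-1)) && (0 < j)%N)%:Z.

(** Signed crossings of the horizontal ray that goes left from the face f;
    their sum along a cycle is its winding number around the face. *)
Definition turn (f : vertex) : vertex -> vertex -> int := fun u v =>
  [&& u.1 == v.1, (u.1 <= f.1)%N, u.2 == f.2 & v.2.+1 == f.2]%:Z
  - [&& u.1 == v.1, (u.1 <= f.1)%N, v.2 == f.2 & u.2.+1 == f.2]%:Z.

(** Signed passages, leftwards being positive, through the edge between the
    faces (i, j) and (i, j.+1). *)
Definition hedge (i j : nat) : vertex -> vertex -> int := fun u v =>
  ((u == (i.+1, j)) && (v == (i, j)))%:Z - ((v == (i.+1, j)) && (u == (i, j)))%:Z.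

Lemma turn_antisym f : antisym (turn f).
Proof.
by case: f => i j [u1 u2] [v1 v2]; rewrite /turn /=; lia.
Qed.

Variant adj_spec : vertex -> vertex -> Prop :=
 | AdjUp x y : adj_spec (x, y) (x, y.+1)
 | AdjDown x y : adj_spec (x, y.+1) (x, y)
 | AdjLeft x y : adj_spec (x.+1, y) (x, y)
 | AdjRight x y : adj_spec (x, y) (x.+1, y).

Lemma adjP u v : adj u v -> adj_spec u v.
Proof.
case: u v => [u1 u2] [v1 v2]; rewrite /adj /=.
by case/orP => /andP[/eqP -> /orP[]/eqP ->]; constructor.
Qed.

Lemma eqSnn n : (n.+1 == n) = false. Proof. lia. Qed.
Lemma eqnSn n : (n == n.+1) = false. Proof. lia. Qed.
Lemma eqSSnn n : (n.+2 == n) = false. Proof. lia. Qed.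
Definition eqSE := (eqSnn, eqnSn, eqSSnn).

Lemma turnS i j u v : adj u v ->
  turn (i.+1, j) u v = turn (i, j) u v + vedge i.+1 j u v.
Proof.
move=> /adjP[] x y; rewrite /turn /vedge !xpair_eqE /=.
all: bool_cases.
Qed.

Lemma turn0 j u v : adj u v -> turn (0%N, j) u v = vedge 0 j u v.
Proof.
move=> /adjP[] x y; rewrite /turn /vedge !xpair_eqE /= ?eqSE ?eqxx /= ?andbF.
all: bool_cases.
Qed.

Definition below (i j : nat) (v : vertex) : int := ((v.2 == j) && (v.1 <= i)%N)%:Z.

(** Moving the ray up by one row changes the count by the passages through the
    edge between the two faces, up to the coboundary of the indicator function
    of the half-line between the two rays. *)
Lemma turn_jump i j u v : adj u v ->
  turn (i, j) u v - turn (i, j.+1) u v = hedge i j u v + (below i j u - below i j v).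
Proof.
move=> /adjP[] x y; rewrite /turn /hedge /below !xpair_eqE /= ?eqSE ?eqxx /= ?andbF.
all: bool_cases.
Qed.

Definition wind s f := csum (turn f) s.

End winding.

Section wind_theory.
Local Open Scope ring_scope.
Implicit Types (s t : seq vertex) (u v f : vertex).

Lemma psum_ext g h u s : (forall a b, adj a b -> g a b = h a b) ->
  path adj u s -> psum g u s = psum h u s.
Proof.
move=> gh; elim: s u => //= v s IHs u /andP[uv vs].
by rewrite gh// IHs.
Qed.

Lemma csum_ext g h s : (forall a b, adj a b -> g a b = h a b) ->
  cycle adj s -> csum g s = csum h s.
Proof. by case: s => //= u s gh; exact: psum_ext. Qed.

Lemma csum0 g s :
  (forall a b, a \in s -> b \in s -> adj a b -> g a b = 0) ->
  cycle adj s -> csum g s = 0.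
Proof.
case: s => //= u s g0; apply: psum0 => a b.
by rewrite !in_cons !mem_rcons !in_cons !orbA !orbb; exact: g0.
Qed.

Lemma csumP g (P : vertex -> int) s :
  (forall a b, adj a b -> g a b = P a - P b) -> cycle adj s -> csum g s = 0.
Proof.
case: s => //= u s gP us.
by rewrite (psumP gP us) last_rcons subrr.
Qed.

Lemma csumD g h s : csum (fun a b => g a b + h a b) s = csum g s + csum h s.
Proof. by case: s => //= u s; rewrite psumD. Qed.

Lemma wind_right s i j : cycle adj s ->
  wind s (i.+1, j) = wind s (i, j) + csum (vedge i.+1 j) s.
Proof. by move=> cs; rewrite /wind -csumD; apply: csum_ext cs => a b; exact: turnS. Qed.

Lemma wind_left s j : cycle adj s -> wind s (0%N, j) = csum (vedge 0 j) s.
Proof. by move=> cs; apply: csum_ext cs => a b; exact: turn0. Qed.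

Lemma wind_jump s i j : cycle adj s ->
  wind s (i, j) = wind s (i, j.+1) + csum (hedge i j) s.
Proof.
move=> cs; have := csumP (g := fun a b => below i j a - below i j b) (fun _ _ _ => erefl) cs.
move=> e0; rewrite -[csum (hedge i j) s]addr0 -e0 /wind -!csumD.
by apply: csum_ext cs => a b ab; have := turn_jump i j ab; lia.
Qed.

Lemma wind_rot n s f : wind (rot n s) f = wind s f.
Proof. exact: csum_rot. Qed.

Lemma wind_rev s f : wind (rev s) f = - wind s f.
Proof. exact/csum_rev/turn_antisym. Qed.

Definition corner f v :=
  ((v.1 == f.1) || (v.1 == f.1.+1)) && ((v.2 == f.2) || (v.2.+1 == f.2)).

Lemma vedge_notin s k j v : cycle adj s -> v \notin s ->
  v = (k, j) \/ v = (k, j.-1) -> csum (vedge k j) s = 0.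
Proof.
move=> cs vs vE; apply: csum0 cs => a b as_ bs _; rewrite /vedge.
have av : a != v by apply: contraNneq vs => <-.
have bv : b != v by apply: contraNneq vs => <-.
by case: vE av bv => -> /negbTE -> /negbTE ->; rewrite ?andbF.
Qed.

Lemma hedge_notin s i j v : cycle adj s -> v \notin s ->
  v = (i, j) \/ v = (i.+1, j) -> csum (hedge i j) s = 0.
Proof.
move=> cs vs vE; apply: csum0 cs => a b as_ bs _; rewrite /hedge.
have av : a != v by apply: contraNneq vs => <-.
have bv : b != v by apply: contraNneq vs => <-.
by case: vE av bv => -> /negbTE -> /negbTE ->; rewrite ?andbF.
Qed.

(** A vertex off the cycle has none of its four edges on the cycle, so the
    winding number does not jump around it. *)
Lemma wind_const s f g v : cycle adj s -> v \notin s ->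
  corner f v -> corner g v -> wind s f = wind s g.
Proof.
move=> cs vs; case: v vs => k j vs.
suff H h : corner h (k, j) -> wind s h = wind s (k, j).
  by move=> /H -> /H ->.
case: h => x y; rewrite /corner /= => /andP[xk yj].
have up : wind s (k, j) = wind s (k, j.+1).
  by rewrite wind_jump// (hedge_notin cs vs) ?addr0//; left.
have [<-|] : k = x \/ k = x.+1 by case/orP: xk => /eqP; [left|right].
  by case/orP: yj => /eqP <-.
move=> kx; rewrite {}kx in vs up *.
case/orP: yj => /eqP <-; last rewrite up.
  by rewrite wind_right// (vedge_notin cs vs) ?addr0//; left.
by rewrite wind_right// (vedge_notin cs vs) ?addr0//; right.
Qed.

Lemma adj_corner u v : adj u v -> exists2 f, corner f u & corner f v.
Proof.
move=> /adjP[] x y.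
- by exists (x, y.+1); rewrite /corner /= !eqxx ?orbT.
- by exists (x, y.+1); rewrite /corner /= !eqxx ?orbT.
- by exists (x, y); rewrite /corner /= !eqxx ?orbT.
- by exists (x, y); rewrite /corner /= !eqxx ?orbT.
Qed.

Lemma wind_const_path s v t f g : cycle adj s -> path adj v t ->
  (forall w, w \in v :: t -> w \notin s) ->
  corner f v -> corner g (last v t) -> wind s f = wind s g.
Proof.
move=> cs; elim: t v f => [|w t IHt] v f /=.
  by move=> _ vs fv; apply: wind_const cs _ fv; apply: vs; rewrite inE.
move=> /andP[/adj_corner[h hv hw] wt] ns fv gl.
rewrite -(IHt w h)//.
  by apply: wind_const cs _ fv hv; apply: ns; rewrite inE eqxx.
by move=> x xt; apply: ns; rewrite inE xt orbT.
Qed.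

(** Between neighbouring faces of a row the winding number jumps only at an
    edge used by the cycle. *)
Lemma wind_edge s i j : cycle adj s ->
  wind s (i, j) <> (if i is i'.+1 then wind s (i', j) else 0) ->
  exists j', [/\ j = j'.+1, (i, j) \in s & (i, j') \in s].
Proof.
move=> cs ne.
have {ne} : csum (vedge i j) s <> 0.
  case: i ne => [|i] ne e; apply: ne; first by rewrite wind_left.
  by rewrite wind_right// e addr0.
have [ij|ij] := boolP ((i, j) \in s); last first.
  by case; rewrite (vedge_notin cs ij)//; left.
have [ij'|ij'] := boolP ((i, j.-1) \in s); last first.
  by case; rewrite (vedge_notin cs ij')//; right.
case: j ij ij' => [|j] ij ij' e; last by exists j.
by case: e; apply: csum0 cs => a b _ _ _; rewrite /vedge ltnn !andbF.
Qed.

End wind_theory.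

(** * The Jordan theorem for simple lattice cycles *)

Lemma uniq_cat3 (T : eqType) (s1 s2 s3 : seq T) : uniq (s1 ++ s2 ++ s3) ->
  [/\ uniq s2, uniq s3, {in s2, forall v, v \notin s1},
      {in s3, forall v, v \notin s1} & {in s3, forall v, v \notin s2}].
Proof.
rewrite !cat_uniq has_cat negb_or => /and3P[_ /andP[/hasPn h1 /hasPn h2]].
by move=> /and3P[u2 /hasPn h3 u3].
Qed.

Lemma split_mem (T : eqType) (x : T) s : x \in s -> exists s1 s2, s = s1 ++ x :: s2.
Proof. by case/splitPr => s1 s2; exists s1, s2. Qed.

Section jordan.
Context (G : groupType) (phi : vertex -> vertex -> G).
Hypothesis phiV : forall u v, (phi v u = (phi u v)^-1)%g.
Local Open Scope ring_scope.
Implicit Types (s t : seq vertex) (u v f : vertex) (S : seq vertex).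

Definition face_cycle f : seq vertex :=
  [:: (f.1.+1, f.2); f; (f.1, f.2.-1); (f.1.+1, f.2.-1)].

Definition face_hol f := holc phi (face_cycle f).

(** A discrete Stokes formula: w is the indicator function of the set S of
    faces, and g plays the role of the holonomy of its boundary. *)
Definition region (w : vertex -> int) (g : G) S :=
  [/\ uniq S, forall f, w f = (f \in S)%:Z & conj_prod face_hol S g].

Definition enclosed s := region (wind s) (holc phi s).

Lemma region_ext w w' g S : region w g S -> (forall f, w' f = w f) -> region w' g S.
Proof. by move=> [uS wS cS] e; split => // f; rewrite e. Qed.

Lemma regionJ w g S k : region w g S -> region w (g ^ k)%g S.
Proof. by move=> [uS wS cS]; split => //; exact: conj_prodJ. Qed.

Lemma regionU w1 w2 g1 g2 S1 S2 : region w1 g1 S1 -> region w2 g2 S2 ->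
  (forall f, w1 f = 0 \/ w2 f = 0) ->
  region (fun f => w1 f + w2 f) (g1 * g2)%g (S1 ++ S2).
Proof.
move=> [u1 e1 c1] [u2 e2 c2] w0.
have dS f : f \in S2 -> f \notin S1.
  by move=> f2; apply/negP => f1; case: (w0 f); rewrite ?e1 ?e2 ?f1 ?f2.
split.
- by rewrite cat_uniq u1 u2 andbT; apply/hasPn => f /dS.
- move=> f; rewrite e1 e2 mem_cat; have := dS f.
  by case: (f \in S1); case: (f \in S2) => //= /(_ isT).
- exact: conj_prod_cat.
Qed.

Lemma enclosed_rot n s S : enclosed (rot n s) S -> enclosed s S.
Proof.
move=> eS; have [k e] := holc_rot phi n s.
rewrite /enclosed -[holc phi s](conjgK k) -e; apply: regionJ.
by apply: region_ext eS _ => f; rewrite wind_rot.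
Qed.

Lemma wind_face a y f : wind (face_cycle (a, y.+1)) f = (f == (a, y.+1))%:Z.
Proof.
case: f => i j; rewrite /wind /= /turn /= !xpair_eqE.
bool_cases.
Qed.

(** From left to right along a row of faces, the winding number of L or B can
    leave the value 0 only at an edge of that cycle, where the other winding
    number is 0 by assumption. *)
Lemma wind_disjoint L B q : cycle adj L -> cycle adj B ->
  (forall v f, v \in B -> v != q -> corner f v -> wind L f = 0) ->
  (forall v f, v \in L -> v != q -> corner f v -> wind B f = 0) ->
  forall f, wind L f = 0 \/ wind B f = 0.
Proof.
move=> cL cB L0 B0 [i j].
have hit M N k : cycle adj M -> (forall v f, v \in M -> v != q -> corner f v -> wind N f = 0) ->
    wind M (k, j) <> (if k is k'.+1 then wind M (k', j) else 0) -> wind N (k, j) = 0.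
  move=> cM N0 /(wind_edge cM)[j' [ej m1 m2]].
  have [/eqP e|ne] := boolP ((k, j) == q).
    apply: (N0 (k, j')) => //; last by rewrite /corner /= ej !eqxx orbT.
    by rewrite -e ej xpair_eqE eqxx eqSE.
  by apply: (N0 (k, j)) => //; rewrite /corner /= !eqxx.
have hL k := hit L B k cL B0; have hB k := hit B L k cB L0.
elim: i => [|i IHi].
  by have [?|/eqP/hL] := eqVneq (wind L (0%N, j)) 0; [left|right].
have [?|/eqP nL] := eqVneq (wind L (i.+1, j)) 0; first by left.
have [?|/eqP nB] := eqVneq (wind B (i.+1, j)) 0; first by right.
case: IHi => e0.
  by right; apply: hL; rewrite e0.
by left; apply: hB; rewrite e0.
Qed.

Lemma enclosed_face a y : enclosed (face_cycle (a, y.+1)) [:: (a, y.+1)].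
Proof.
split => // [f|]; first by rewrite wind_face inE.
by rewrite -[holc _ _]conjg1; exact: conj_prod1.
Qed.

Lemma enclosed2 u v : enclosed [:: u; v] [::].
Proof.
split => //= [f|]; last by rewrite mulg1 (phiV u v) mulgV.
by rewrite /wind /= addr0 turn_antisym addNr.
Qed.

Lemma enclosed_pos s f : wind s f = 1 ->
  (exists S, enclosed s S) \/ (exists S, enclosed (rev s) S) ->
  exists S, enclosed s S.
Proof.
move=> w1 []// [S [_ /(_ f)]]; rewrite wind_rev w1.
by case: (f \in S).
Qed.

(** The induction step of the Jordan theorem. The vertex t is the leftmost one
    among the highest vertices of C, so that C comes from b, on its right, and
    leaves to l, below it. The vertex q is the fourth corner of the face
    between them. *)
Section step.
Variables (a y : nat) (r : seq vertex).
Let b : vertex := (a.+1, y.+1).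
Let t : vertex := (a, y.+1).
Let l : vertex := (a, y).
Let q : vertex := (a.+1, y).
Let C := [:: b, t, l & r].
Hypothesis uC : uniq C.
Hypothesis cC : cycle adj C.
Hypothesis topleft : forall v, v \in C -> (v.2 <= y.+1)%N /\ (v.2 = y.+1 -> (a <= v.1)%N).
Hypothesis IH : forall s, uniq s -> cycle adj s -> (1 < size s)%N ->
  (size s < size C)%N \/ (size s = size C /\ (sumn (map snd s) < sumn (map snd C))%N) ->
  (exists S, enclosed s S) \/ (exists S, enclosed (rev s) S).

(** The ray from the face t crosses only edges with an end at the height of t
    and not to its right; the only such vertex of C is t. *)
Lemma wind_left0 s : cycle adj s -> t \notin s -> {subset s <= q :: C} ->
  wind s t = 0.
Proof.
move=> cs ts sC; rewrite /t.
have H k : (k <= a)%N -> wind s (k, y.+1) = 0.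
  elim: k => [|k IHk] ka; apply/eqP; apply: contraT => /eqP ne.
    have [j' [_ m _]] := wind_edge (i := 0) (j := y.+1) cs ne.
    move: (sC _ m); rewrite inE xpair_eqE eqSE andbF /= => /topleft[_ /(_ erefl)] /= ea.
    by move: ts; rewrite /t (_ : a = 0%N) ?m//; lia.
  have [|j' [_ m _]] := wind_edge (i := k.+1) (j := y.+1) cs.
    by rewrite IHk// ltnW.
  move: (sC _ m); rewrite inE xpair_eqE eqSE andbF /= => /topleft[_ /(_ erefl)] /= ea.
  by move: ts; rewrite /t (_ : a = k.+1) ?m//; lia.
exact: H.
Qed.

(** When q is off C, replacing the corner t by q gives a simple cycle of the
    same length and smaller total height that encloses one face less. *)
Lemma push_step : q \notin C -> exists S, enclosed C S.
Proof.
move=> qC.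
pose C' := [:: b, q, l & r].
have tqr : [/\ t \notin C', t != q & q \notin [:: b, l & r]].
  have /= := uC; have := qC; rewrite /C' !inE !negb_or !xpair_eqE !eqSE /= => ? ?.
  by split; lia.
case: tqr => tC' tq qblr.
have uC' : uniq C'.
  have /= := uC; have := qC; rewrite /C' !inE !negb_or /=.
  by rewrite [b == q]eq_sym => /and4P[-> _ -> ->] /and3P[/and3P[_ -> ->] _ /andP[-> ->]].
have adjq : adj b q && adj q l by rewrite /adj /= !eqxx ?orbT.
have cC' : cycle adj C'.
  by move: cC adjq; rewrite /= => /and3P[_ _ ->] /andP[-> ->].
have w0 : wind C' t = 0.
  by apply: wind_left0 => // v; rewrite !inE => /or4P[] ->; rewrite ?orbT.
have w1 : wind C' (a.+1, y.+1) = 1.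
  rewrite wind_right// w0 add0r /= psum0; last 2 first.
  - move=> u v uin vin _; rewrite /vedge /=.
    have qm w : w \in l :: rcons r b -> w != (a.+1, y).
      by apply: contraTneq => ->; move: qblr; rewrite !(inE, mem_rcons) !negb_or => /and3P[-> -> ->].
    by rewrite (negbTE (qm u uin)) (negbTE (qm v vin)) !andbF.
  - by move: cC; rewrite /= => /and3P[].
  by rewrite /vedge !xpair_eqE !eqxx !eqSE.
have lt : (size C' < size C)%N \/ size C' = size C /\ (sumn (map snd C') < sumn (map snd C))%N.
  by right; split => //=; rewrite ltn_add2l addSn.
have [S' eS'] := enclosed_pos w1 (IH uC' cC' isT lt).
exists ([:: (a, y.+1)] ++ S').
have := regionU (enclosed_face a y) eS'.
have -> : (holc phi (face_cycle (a, y.+1)) * holc phi C' = holc phi C)%g.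
  rewrite /= !mulg1 -!mulgA; congr (_ * (_ * _))%g.
  by rewrite (phiV b q) mulKg (phiV q l) mulKg.
move=> H; apply: region_ext (H _) _ => f.
  rewrite wind_face; have [->|_] := eqVneq f (a, y.+1); [by right|by left].
rewrite /wind /=.
rewrite [turn f q b]turn_antisym [turn f l _]turn_antisym; ring.
Qed.

(** When C passes through q, the two edges of the face at q cut C into the
    face, a cycle L through l and q, and a cycle B through q and b. As L and B
    have only q in common, each lies outside the other: it can be followed,
    off the other one, to a corner of the face t, around which both winding
    numbers vanish. *)
Lemma split_step r1 r2 : r = r1 ++ q :: r2 -> exists S, enclosed C S.
Proof.
move=> er.
pose L := l :: rcons r1 q; pose B := q :: rcons r2 b.
have [uL uB dLB] : [/\ uniq L, uniq B & forall v, v \in l :: r1 -> v \notin B].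
  move: uC; rewrite /C er -[[:: b, t, l & _]]/([:: b; t] ++ (l :: r1) ++ q :: r2).
  move=> /uniq_cat3[ulr uqr h1 h2 h3].
  split.
  - rewrite /L -rcons_cons rcons_uniq ulr andbT.
    by apply: h3; rewrite inE eqxx.
  - rewrite /B -rcons_cons rcons_uniq uqr andbT.
    by apply/negP => /h2; rewrite !inE eqxx.
  - move=> v v1; rewrite /B -rcons_cons mem_rcons inE negb_or; apply/andP; split.
      by have := h1 _ v1; rewrite !inE !negb_or => /andP[].
    by apply/negP => /h3; rewrite /= v1.
have tLB : t \notin L /\ t \notin B.
  move: (uC); rewrite /C er /= !inE !mem_cat !inE !mem_rcons !inE => /and4P[_].
  rewrite !negb_or => /and4P[t1 t2 t3 t4] _ _.
  by rewrite t1 t2 t3 t4 !xpair_eqE !eqSE.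
have [tL tB] := tLB.
have [adjq bq] : adj q l /\ adj b q by rewrite /adj /= !eqxx ?orbT.
have /and4P[_ _ pL pB] : [&& adj b t, adj t l, path adj l (rcons r1 q) & path adj q (rcons r2 b)].
  move: cC; rewrite /= er rcons_cat rcons_cons -cat_rcons cat_path last_rcons.
  by move=> /and4P[-> -> -> ->].
have cL : cycle adj L by rewrite /= rcons_path pL last_rcons adjq.
have cB : cycle adj B by rewrite /= rcons_path pB last_rcons bq.
have L0 : wind L t = 0.
  apply: wind_left0 => // v; rewrite /C er !(inE, mem_rcons, mem_cat).
  by case/or3P => ->; rewrite ?orbT.
have B0 : wind B t = 0.
  apply: wind_left0 => // v; rewrite /C er !(inE, mem_rcons, mem_cat).
  by case/or3P => ->; rewrite ?orbT.
have [S1 e1] : exists S, enclosed L S.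
  case er1: r1 => [|x r1']; first by exists [::]; rewrite /L er1; exact: enclosed2.
  have ltL : (size L < size C)%N.
    by rewrite /L /C /= er size_cat size_rcons /= addnS !ltnS -addnS leq_addr.
  have w1 : wind L l = 1.
    rewrite wind_jump// L0 add0r /L er1 /= psum_rcons last_rcons.
    have xq : x != q by move: uL; rewrite /L er1 /= mem_rcons inE negb_or => /and3P[_ /andP[]].
    rewrite psum0; last 2 first.
    - move=> u v uin vin _; rewrite /hedge.
      have lm w : w \in x :: rcons r1' q -> w != l.
        by apply: contraTneq => ->; move: uL; rewrite /L er1 => /andP[].
      by rewrite (negbTE (lm u uin)) (negbTE (lm v vin)) !andbF.
    - by move: pL; rewrite er1 /= => /andP[].
    by rewrite /hedge (negbTE xq) !xpair_eqE !eqxx !eqSE.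
  by apply: enclosed_pos w1 _; apply: IH => //; [rewrite /L /= size_rcons|left].
have [S2 e2] : exists S, enclosed B S.
  case er2: r2 => [|x r2']; first by exists [::]; rewrite /B er2; exact: enclosed2.
  have ltB : (size B < size C)%N.
    by rewrite /B /C /= er size_cat size_rcons /= addnS !ltnS ltnW// ltnS leq_addl.
  have w1 : wind B (a.+1, y.+1) = 1.
    rewrite wind_right// B0 add0r /B er2 /= psum_rcons last_rcons.
    have xb : x != b by move: uB; rewrite /B er2 /= mem_rcons inE negb_or => /and3P[_ /andP[]].
    rewrite psum0; last 2 first.
    - move=> u v uin vin _; rewrite /vedge.
      have lm w : w \in x :: rcons r2' b -> w != q.
        by apply: contraTneq => ->; move: uB; rewrite /B er2 => /andP[].
      by rewrite (negbTE (lm u uin)) (negbTE (lm v vin)) !andbF.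
    - by move: pB; rewrite er2 /= => /andP[].
    by rewrite /vedge (negbTE xb) !xpair_eqE !eqxx !eqSE.
  by apply: enclosed_pos w1 _; apply: IH => //; [rewrite /B /= size_rcons|left].
have dis : forall f, wind L f = 0 \/ wind B f = 0.
  apply: (wind_disjoint (q := q)) => // v f.
  - rewrite /B inE => /orP[->//|]; rewrite mem_rcons => vB vq fv.
    have {}vB : v \in rcons r2 b by rewrite mem_rcons.
    have [A [A' eA]] := split_mem vB; move: pB; rewrite eA.
    rewrite cat_path => /andP[_ /andP[_ pA']].
    have el : last v A' = b by have := congr1 (last v) eA; rewrite last_rcons last_cat.
    have cb : corner t (last v A') by rewrite el /corner /= !eqxx orbT.
    apply: etrans (wind_const_path cL pA' _ fv cb) L0.
    move=> w wA; apply/negP => wL; move: uB; rewrite /B eA /= => /andP[nq _].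
    have wr : w \in rcons r2 b by rewrite eA mem_cat wA orbT.
    have nw : w \in l :: r1 -> False by move=> /dLB; rewrite /B in_cons wr orbT.
    have : w \in l :: rcons r1 q by [].
    rewrite -rcons_cons mem_rcons inE => /orP[/eqP wq|/nw//].
    by move: nq; rewrite -wq mem_cat wA orbT.
  - rewrite /L -rcons_cons mem_rcons inE => /orP[/eqP->|vL vq fv]; first by rewrite eqxx.
    rewrite -B0; apply/esym.
    have cl : corner t l by rewrite /corner /= !eqxx ?orbT.
    move: vL; rewrite inE => /orP[/eqP vl|v1].
      apply: wind_const cB (dLB v _) _ fv; first by rewrite inE vl eqxx.
      by rewrite vl.
    have [A [A' eA]] := split_mem v1; move: pL; rewrite {1}eA.
    rewrite rcons_cat cat_path => /andP[pA /andP[Av _]].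
    apply: (wind_const_path (v := l) (t := rcons A v) cB) => //.
    + by rewrite rcons_path pA.
    + move=> w wA; apply: dLB; move: wA; rewrite eA !(inE, mem_rcons, mem_cat).
      by case/or3P => ->; rewrite ?orbT.
    + by rewrite last_rcons.
have b1 := enclosed_face a y.
have b2 := regionJ (phi l q * phi q b)%g e1.
have b3 := regionJ (phi q b) e2.
have b23 := regionU b2 b3 dis.
exists ([:: (a, y.+1)] ++ (S1 ++ S2)).
have := regionU b1 b23.
set g := (_ * (_ * _))%g; have -> : g = holc phi C.
  rewrite /g /holc /L /B /C /face_cycle -[(a.+1, y.+1)]/b -[(a, y.+1)]/t -/l -/q er.
  rewrite [in RHS]rcons_cons [in RHS]rcons_cons rcons_cat [in RHS]rcons_cons -cat_rcons [RHS]/= !hol_rcons !last_rcons hol_cat !hol_rcons last_rcons !conjgE /=.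
  rewrite (phiV b q) (phiV q l) !invgM !invgK mulg1 -!mulgA.
  by rewrite !(mulKg, mulVKg) mulgV mulg1.
move=> H; apply: region_ext (H _) _ => f.
  rewrite wind_face; have [->|_] := eqVneq f (a, y.+1); last by left.
  by right; rewrite L0 B0.
rewrite /wind /C er /csum /= rcons_cat rcons_cons -cat_rcons psum_cat !psum_rcons !last_rcons.
rewrite [turn f q b]turn_antisym [turn f l q]turn_antisym; ring.
Qed.

End step.

Lemma topleft_exists s u : u \in s -> exists2 t, t \in s &
  forall v, v \in s -> (v.2 <= t.2)%N /\ (v.2 = t.2 -> (t.1 <= v.1)%N).
Proof.
elim: s u => // w [|w' s] IHs u _.
  by exists w; rewrite ?inE// => v; rewrite inE => /eqP ->.
have [t ts tm] := IHs w' (mem_head _ _).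
case: (boolP ((w.2 < t.2) || ((w.2 == t.2) && (t.1 <= w.1)))%N) => [tw|tw].
  exists t; first by rewrite in_cons ts orbT.
  move=> v; rewrite in_cons => /orP[/eqP ->|/tm//].
  by case/orP: tw => [|/andP[/eqP -> ?]]; [split; lia|].
exists w; first by rewrite mem_head.
move=> v; rewrite in_cons => /orP[/eqP ->//|/tm].
move: tw; rewrite negb_or negb_and -leqNgt -ltnNge => /andP[h1 h2] [h3 h4].
split=> [|e]; first exact: leq_trans h3 h1.
have evt : v.2 = t.2 by apply/eqP; rewrite eqn_leq h3 e h1.
have h := h4 evt; case/orP: h2 => [/eqP|] h2; last exact: leq_trans (ltnW h2) h.
by case: h2; rewrite -e -evt.
Qed.

Lemma two_neighbours (t u v : vertex) : adj t u -> adj v t -> u != v ->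
  (forall w, w = u \/ w = v -> (w.2 <= t.2)%N /\ (w.2 = t.2 -> (t.1 <= w.1)%N)) ->
  (exists2 y, t.2 = y.+1 & u = (t.1, y) /\ v = (t.1.+1, y.+1)) \/
  (exists2 y, t.2 = y.+1 & v = (t.1, y) /\ u = (t.1.+1, y.+1)).
Proof.
move=> tu vt uv H; have := H u (or_introl erefl); have := H v (or_intror erefl).
move=> {H}; move: tu vt uv => /adjP[] x y /adjP; case E: _ / => [x' y'|x' y'|x' y'|x' y'];
  case: E => ? ?; subst => //=; rewrite ?eqxx// => _ [? h1] [? h2]; try (exfalso; lia).
- by left; exists y.
- by right; exists y'.
Qed.

Definition top_left a y s := forall v : vertex, v \in s ->
  (v.2 <= y)%N /\ (v.2 = y -> (a <= v.1)%N).

Lemma top_corner s : uniq s -> cycle adj s -> (2 < size s)%N ->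
  exists a y r, let C := [:: (a.+1, y.+1), (a, y.+1), (a, y) & r] in
  top_left a y.+1 C /\ ((exists i, rot i s = C) \/ (exists i, rot i (rev s) = C)).
Proof.
move=> us cs s2.
have [t ts tm] : exists2 t, t \in s &
    forall v, v \in s -> (v.2 <= t.2)%N /\ (v.2 = t.2 -> (t.1 <= v.1)%N).
  case: s s2 {us cs} => // u0 s _; exact: topleft_exists (mem_head u0 s).
have [i p ep] := rot_to ts.
have sp : (1 < size p)%N by rewrite -ltnS -[(size p).+1]/(size (t :: p)) -ep size_rot.
have pe : perm_eq (t :: p) s by rewrite -ep perm_rot.
have cp : cycle adj (t :: p) by rewrite -ep rot_cycle.
have up : uniq (t :: p) by rewrite -ep rot_uniq.
case: p sp ep pe cp up => [|u p] //; case/lastP: p => [|r v] // _ ep pe cp up.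
have tmp w : w \in [:: t, u & rcons r v] -> (w.2 <= t.2)%N /\ (w.2 = t.2 -> (t.1 <= w.1)%N).
  by rewrite -ep mem_rot; exact: tm.
have uv : u != v by move: up => /= /and3P[_]; rewrite mem_rcons inE negb_or => /andP[].
have [|||[y ty [eu ev]]|[y ty [ev eu]]] := @two_neighbours t u v _ _ uv.
- by move: cp => /= /andP[].
- by move: cp; rewrite /= rcons_path last_rcons => /and3P[].
- by move=> w [] ->; apply: tmp; rewrite !(inE, mem_rcons) eqxx ?orbT.
- have er : rot (size (t :: u :: r)) (rot i s) = [:: v, t, u & r].
    by rewrite ep -cats1 -!cat_cons rot_size_cat.
  exists t.1, y, r; rewrite /= -ty -surjective_pairing ty -eu -ev; split.
    by move=> w; rewrite -er -ty ep mem_rot; exact: tmp.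
  by left; exists (rot_add s i (size (t :: u :: r))); rewrite -rot_rot_add.
- have er : rot (size (v :: rev r)) (rev [:: t, u & rcons r v]) = [:: u, t, v & rev r].
    by rewrite !rev_cons rev_rcons -!cats1 -catA rot_size_cat.
  exists t.1, y, (rev r); rewrite /= -ty -surjective_pairing ty -eu -ev; split.
    by move=> w; rewrite -er -ty mem_rot mem_rev; exact: tmp.
  right; rewrite -er -ep rev_rot /rotr rot_rot_add size_rev.
  by exists (rot_add (rev s) (size s - i) (size (v :: rev r))).
Qed.

(** Induction on the length of the cycle, then on its total height: its
    top-left corner is pushed across a face, or the cycle is split there. *)
Theorem jordan s : uniq s -> cycle adj s -> (1 < size s)%N ->
  (exists S, enclosed s S) \/ (exists S, enclosed (rev s) S).
Proof.
have [n] := ubnP (size s); elim: n s => // n IHn s.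
have [m] := ubnP (sumn (map snd s)); elim: m s => // m IHm s ms ns us cs s2.
have IH (C : seq vertex) : size C = size s -> sumn (map snd C) = sumn (map snd s) ->
  forall s', uniq s' -> cycle adj s' -> (1 < size s')%N ->
  (size s' < size C)%N \/ (size s' = size C /\ (sumn (map snd s') < sumn (map snd C))%N) ->
  (exists S, enclosed s' S) \/ (exists S, enclosed (rev s') S).
  move=> -> -> s' us' cs' s2' [lt|[es lt]].
    by apply: IHn => //; apply: leq_trans lt _; rewrite -ltnS.
  by apply: IHm => //; rewrite ?es//; apply: leq_trans lt _; rewrite -ltnS.
have step (C : seq vertex) : perm_eq C s -> cycle adj C ->
    (exists a y r, C = [:: (a.+1, y.+1), (a, y.+1), (a, y) & r] /\
      top_left a y.+1 C) -> exists S, enclosed C S.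
  move=> Cs cC [a [y [r [eC tl]]]].
  have uC : uniq C by rewrite (perm_uniq Cs).
  have {}IH := IH C (perm_size Cs) (perm_sumn (perm_map snd Cs)).
  rewrite eC in uC cC tl IH *.
  have [|/push_step] := boolP ((a.+1, y) \in [:: (a.+1, y.+1), (a, y.+1), (a, y) & r]); last exact.
  rewrite !inE !xpair_eqE !eqSE !andbF /= => /split_mem[r1 [r2 er]].
  exact: split_step er.
have [s3|s3] := ltnP 2 (size s); last first.
  case: s us cs s2 s3 {ms ns IHn IHm IH step} => [|u0 [|u1 [|u2 s]]] // *.
  by left; exists [::]; exact: enclosed2.
have [a [y [r [tl [[k ek]|[k ek]]]]]] := top_corner us cs s3.
- left; rewrite -ek in tl; have [||S eS] := step _ _ _ (ex_intro _ a (ex_intro _ y (ex_intro _ r (conj ek tl)))).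
  + by rewrite perm_rot.
  + by rewrite rot_cycle.
  + by exists S; exact: enclosed_rot eS.
- right; rewrite -ek in tl; have [||S eS] := step _ _ _ (ex_intro _ a (ex_intro _ y (ex_intro _ r (conj ek tl)))).
  + by rewrite perm_rot perm_rev.
  + by rewrite rot_cycle rev_cycle (eq_cycle (e' := adj)) // => ? ?; exact: adj_sym.
  + by exists S; exact: enclosed_rot eS.
Qed.

End jordan.

(** * The outside of a simple lattice cycle *)

Section rectangle.
Local Open Scope ring_scope.
Implicit Types (x y w h n : nat) (v f : vertex).

(** Straight paths upwards, downwards, to the right and to the left, without
    their initial vertex; (x, y) is their lower or left end. *)
Fixpoint vup x y n : seq vertex :=
  if n is n'.+1 then (x, y.+1) :: vup x y.+1 n' else [::].
Fixpoint vdn x y n : seq vertex :=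
  if n is n'.+1 then (x, (y + n')%N) :: vdn x y n' else [::].
Fixpoint hrt x y n : seq vertex :=
  if n is n'.+1 then (x.+1, y) :: hrt x.+1 y n' else [::].
Fixpoint hlt x y n : seq vertex :=
  if n is n'.+1 then ((x + n')%N, y) :: hlt x y n' else [::].

Lemma mem_vup x y n v : (v \in vup x y n) = (v.1 == x) && (y < v.2 <= y + n)%N.
Proof.
case: v => a b; elim: n y => [|n IHn] y; first by rewrite in_nil addn0 /=; lia.
by rewrite /= in_cons IHn xpair_eqE /=; lia.
Qed.

Lemma mem_vdn x y n v : (v \in vdn x y n) = (v.1 == x) && (y <= v.2 < y + n)%N.
Proof.
case: v => a b; elim: n => [|n IHn]; first by rewrite in_nil addn0 /=; lia.
by rewrite /= in_cons IHn xpair_eqE /=; lia.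
Qed.

Lemma mem_hrt x y n v : (v \in hrt x y n) = (v.2 == y) && (x < v.1 <= x + n)%N.
Proof.
case: v => a b; elim: n x => [|n IHn] x; first by rewrite in_nil addn0 /=; lia.
by rewrite /= in_cons IHn xpair_eqE /=; lia.
Qed.

Lemma mem_hlt x y n v : (v \in hlt x y n) = (v.2 == y) && (x <= v.1 < x + n)%N.
Proof.
case: v => a b; elim: n => [|n IHn]; first by rewrite in_nil addn0 /=; lia.
by rewrite /= in_cons IHn xpair_eqE /=; lia.
Qed.

Lemma uniq_vup x y n : uniq (vup x y n).
Proof. by elim: n y => //= n IHn y; rewrite IHn mem_vup /= ltnn andbF. Qed.
Lemma uniq_vdn x y n : uniq (vdn x y n).
Proof. by elim: n => //= n IHn; rewrite IHn mem_vdn /= ltnn !andbF. Qed.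
Lemma uniq_hrt x y n : uniq (hrt x y n).
Proof. by elim: n x => //= n IHn x; rewrite IHn mem_hrt /= ltnn andbF. Qed.
Lemma uniq_hlt x y n : uniq (hlt x y n).
Proof. by elim: n => //= n IHn; rewrite IHn mem_hlt /= ltnn !andbF. Qed.

Lemma last_vup x y n : last (x, y) (vup x y n) = (x, y + n)%N.
Proof. by elim: n y => [|n IHn] y /=; rewrite ?addn0// IHn addSnnS. Qed.
Lemma last_vdn x y n : last (x, y + n)%N (vdn x y n) = (x, y).
Proof. by elim: n => [|n IHn] /=; rewrite ?addn0. Qed.
Lemma last_hrt x y n : last (x, y) (hrt x y n) = (x + n, y)%N.
Proof. by elim: n x => [|n IHn] x /=; rewrite ?addn0// IHn addSnnS. Qed.
Lemma last_hlt x y n : last (x + n, y)%N (hlt x y n) = (x, y).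
Proof. by elim: n => [|n IHn] /=; rewrite ?addn0. Qed.

Lemma path_vup x y n : path adj (x, y) (vup x y n).
Proof. by elim: n y => //= n IHn y; rewrite IHn /adj /= !eqxx orbT. Qed.
Lemma path_vdn x y n : path adj (x, y + n)%N (vdn x y n).
Proof. by elim: n => //= n IHn; rewrite IHn /adj /= !eqxx addnS eqxx. Qed.
Lemma path_hrt x y n : path adj (x, y) (hrt x y n).
Proof. by elim: n x => //= n IHn x; rewrite IHn /adj /= !eqxx !orbT. Qed.
Lemma path_hlt x y n : path adj (x + n, y)%N (hlt x y n).
Proof. by elim: n => //= n IHn; rewrite IHn /adj /= addnS !eqxx !orbT. Qed.

(** Anti-clockwise from the upper left corner. *)
Definition rect x y w h :=
  vdn x y h ++ hrt x y w ++ vup (x + w) y h ++ hlt x (y + h) w.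

Lemma path_rect x y w h : path adj (x, y + h)%N (rect x y w h).
Proof.
rewrite /rect !cat_path path_vdn last_vdn path_hrt last_hrt path_vup last_vup.
exact: path_hlt.
Qed.

Lemma last_rect x y w h : last (x, y + h)%N (rect x y w h) = (x, y + h)%N.
Proof. by rewrite /rect !last_cat last_vdn last_hrt last_vup last_hlt. Qed.

Lemma cycle_rect x y w h : cycle adj (rect x y w h).
Proof.
by rewrite (cycle_path (x, y + h)%N) last_rect path_rect.
Qed.

Lemma mem_rect x y w h v : (v \in rect x y w h) =
  [|| (v.1 == x) && (y <= v.2 < y + h), (v.2 == y) && (x < v.1 <= x + w),
   (v.1 == x + w) && (y < v.2 <= y + h) | (v.2 == y + h) && (x <= v.1 < x + w)]%N.
Proof. by rewrite !mem_cat mem_vdn mem_hrt mem_vup mem_hlt. Qed.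

Lemma uniq_rect x y w h : (0 < w)%N -> (0 < h)%N -> uniq (rect x y w h).
Proof.
move=> w0 h0; rewrite !cat_uniq uniq_vdn uniq_hrt uniq_vup uniq_hlt !andbT /=.
rewrite !has_cat !negb_or -!andbA; apply/and4P; split.
- by apply/hasPn => v; rewrite mem_hrt /= mem_vdn; lia.
- by apply/hasPn => v; rewrite mem_vup /= mem_vdn; lia.
- by apply/hasPn => v; rewrite mem_hlt /= mem_vdn; lia.
- apply/and3P; split.
  + by apply/hasPn => v; rewrite mem_vup /= mem_hrt; lia.
  + by apply/hasPn => v; rewrite mem_hlt /= mem_hrt; lia.
  + by apply/hasPn => v; rewrite mem_hlt /= mem_vup; lia.
Qed.

Lemma psum_vup f x y n : psum (turn f) (x, y) (vup x y n) =
  - ((x <= f.1) && (y < f.2 <= y + n))%N%:Z.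
Proof.
elim: n y => [|n IHn] y /=; first by rewrite addn0; lia.
by rewrite IHn /turn /= eqxx; bool_cases.
Qed.

Lemma psum_vdn f x y n : psum (turn f) (x, y + n)%N (vdn x y n) =
  ((x <= f.1) && (y < f.2 <= y + n))%N%:Z.
Proof.
elim: n => [|n IHn] /=; first by rewrite addn0; lia.
by rewrite IHn /turn /= eqxx; bool_cases.
Qed.

Lemma psum_hrt f x y n : psum (turn f) (x, y) (hrt x y n) = 0.
Proof. by elim: n x => [|n IHn] x //=; rewrite IHn /turn /= eqSE. Qed.

Lemma psum_hlt f x y n : psum (turn f) (x + n, y)%N (hlt x y n) = 0.
Proof. by elim: n => [|n IHn] //=; rewrite IHn /turn /= addnS eqSE. Qed.

Lemma csum_last g (u : vertex) s : csum g s = psum g (last u s) s.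
Proof.
case/lastP: s => [|s z] //; rewrite last_rcons.
by rewrite -(csum_rot g (size s)) -cats1 rot_size_cat cats1.
Qed.

Lemma wind_rect x y w h f : wind (rect x y w h) f =
  ((x <= f.1 < x + w) && (y < f.2 <= y + h))%N%:Z.
Proof.
rewrite /wind (csum_last _ (x, y + h)%N) last_rect /rect !psum_cat.
rewrite psum_vdn last_vdn psum_hrt last_hrt psum_vup last_vup psum_hlt.
bool_cases.
Qed.

End rectangle.

Lemma adj_rev_path u s : path adj u s -> path adj (last u s) (rev (belast u s)).
Proof. by rewrite rev_path; congr is_true; apply: eq_path => ? ?; exact: adj_sym. Qed.

Lemma last_back (u v : vertex) s : last u s = v -> last v (rev (belast u s)) = u.
Proof. by move=> <-; exact: last_rev_belast. Qed.

Lemma psum_back g u v s : antisym g -> last u s = v ->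
  psum g v (rev (belast u s)) = (- psum g u s)%R.
Proof. by move=> gV <-; exact: psum_rev. Qed.

Section reversal.
Implicit Types (x y n : nat).

Lemma vup_rcons x y n : vup x y n.+1 = rcons (vup x y n) (x, y + n.+1)%N.
Proof. by elim: n y => [|n IHn] y; rewrite ?addn1// -addSnnS /= -IHn. Qed.

Lemma vdn_rcons x y n : vdn x y n.+1 = rcons (vdn x y.+1 n) (x, y).
Proof. by elim: n => [|n IHn]; rewrite /= ?addn0// addSnnS -IHn. Qed.

Lemma rev_vup x y n : rev (belast (x, y) (vup x y n)) = vdn x y n.
Proof. by elim: n y => // n IHn y; rewrite vdn_rcons /= rev_cons IHn. Qed.

Lemma rev_vdn x y n : rev (belast (x, y + n)%N (vdn x y n)) = vup x y n.
Proof. by elim: n => // n IHn; rewrite vup_rcons /= rev_cons IHn. Qed.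

Lemma hlt_split x y n k : (k.+1 < n)%N ->
  exists A A', hlt x y n = A ++ [:: (x + k.+1, y), (x + k, y) & A']%N.
Proof.
elim: n => // n IHn; rewrite ltnS leq_eqVlt => /orP[/eqP <-|/IHn[A [A' e]]].
  by exists [::], (hlt x y k).
by exists ((x + n, y)%N :: A), A'; rewrite /= e.
Qed.

End reversal.

Lemma uniq_cat4 (T : eqType) (s1 s2 s3 s4 : seq T) :
  [/\ uniq s1, uniq s2, uniq s3 & uniq s4] ->
  (forall v, v \in s2 -> v \notin s1) -> (forall v, v \in s3 -> v \notin s1) ->
  (forall v, v \in s4 -> v \notin s1) -> (forall v, v \in s3 -> v \notin s2) ->
  (forall v, v \in s4 -> v \notin s2) -> (forall v, v \in s4 -> v \notin s3) ->
  uniq (s1 ++ s2 ++ s3 ++ s4).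
Proof.
move=> [u1 u2 u3 u4] h21 h31 h41 h32 h42 h43.
have H (s s' : seq T) : (forall v, v \in s' -> v \notin s) -> has (mem s) s' = false.
  by move=> h; apply/negbTE/hasPn => v /h.
by rewrite !cat_uniq u1 u2 u3 u4 !has_cat !H.
Qed.

Section keyhole.
Context (G : groupType) (phi : vertex -> vertex -> G).
Hypothesis phiV : forall u v, (phi v u = (phi u v)^-1)%g.
Local Open Scope ring_scope.

Lemma holc_last u s : exists k, holc phi s = (hol phi (last u s) s ^ k)%g.
Proof.
case/lastP: s => [|s z]; first by exists 1%g; rewrite conjg1.
have [k e] := holc_rot phi (size s) (rcons s z).
exists k^-1%g; rewrite last_rcons -[LHS](conjgK k) -e; congr (_ ^ _)%g.
by rewrite -cats1 rot_size_cat cats1.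
Qed.

Variables (M a y : nat) (r : seq vertex).
Let b : vertex := (a.+1, y.+1).
Let t : vertex := (a, y.+1).
Let l : vertex := (a, y).
Let C := [:: b, t, l & r].
Hypothesis uC : uniq C.
Hypothesis cC : cycle adj C.
Hypothesis topleft : top_left a y.+1 C.
Hypothesis inC : forall v, v \in C -> (0 < v.1 < M)%N && (0 < v.2 < M)%N.

Lemma wind_top_left : wind C t = 1.
Proof.
rewrite /wind /= psum0; last 2 first.
- move=> u v ul vl _; rewrite /turn.
  have H w : w \in l :: rcons r b -> w.2 = y.+1 -> (a < w.1)%N.
    move=> wl w2; have : w != t by apply: contraTneq wl => ->; move: uC; rewrite /C /= !inE mem_rcons inE !negb_or [t == b]eq_sym => /and4P[/and3P[-> _ _] /andP[-> ->]].
    have /topleft[_ /(_ w2)] : w \in C by move: wl; rewrite !(inE, mem_rcons) => /or3P[] ->; rewrite ?orbT.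
    case: w w2 {wl} => w1 w2 /= ->; rewrite xpair_eqE eqxx andbT; lia.
  have Hu := H u ul; have Hv := H v vl.
  case: u v Hu Hv {ul vl H} => u1 u2 [v1 v2] /= Hu Hv.
  have [e|_] /= := eqVneq u2 y.+1; have [e'|_] /= := eqVneq v2 y.+1.
  all: rewrite ?andbF ?subrr //.
  + by have := Hu e; rewrite ltnNge => /negbTE ->; rewrite !andbF.
  + by have := Hu e; rewrite ltnNge => /negbTE ->; rewrite !andbF.
  + by have [->|] /= := eqVneq u1 v1 => //; have := Hv e'; rewrite ltnNge => /negbTE ->.
- by move: cC; rewrite /= => /and3P[].
rewrite /turn /= !eqxx leqnn /= eqSE; lia.
Qed.

(** The vertical strip above the top edge b t of C is removed from the part of
    the large square Q outside C. What remains is enclosed by a simple cycle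
    D, that follows Q from one side of the strip to the other, goes down to b,
    runs backwards along C to t, and goes up again. The Jordan theorem applies
    to D and to the boundary X of the strip, and the product of their
    holonomies is the holonomy of C backwards followed by that of Q, up to
    conjugacy of both. *)
Lemma keyhole : exists g T k1 k2,
  region phi (fun f => wind (rect 0 0 M M) f - wind C f) g T /\
  ((holc phi C)^-1 ^ k1 = g * (holc phi (rect 0 0 M M))^-1 ^ k2)%g.
Proof.
have /inC/andP[/= aM yM] : b \in C by rewrite inE eqxx.
have /inC/andP[/= /andP[a0 _] _] : t \in C by rewrite !inE eqxx orbT.
have [d eM] : exists d, (M = y.+1 + d.+1)%N by exists (M - y.+2)%N; lia.
pose tM : vertex := (a, M); pose bM : vertex := (a.+1, M).
pose Q := rect 0 0 M M; pose X := rect a y.+1 1 d.+1.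
have [A [A' eA]] := @hlt_split 0 M M a aM.
rewrite !add0n -/tM -/bM in eA.
pose P := vdn 0 0 M ++ hrt 0 0 M ++ vup M 0 M ++ A.
have eQ : Q = (P ++ [:: bM]) ++ tM :: A' by rewrite /Q /rect !add0n eA /P -!catA.
pose q := A' ++ P ++ [:: bM].
have rQ : rot (size (P ++ [:: bM])) Q = tM :: q by rewrite eQ rot_size_cat.
have cQ : cycle adj (tM :: q) by rewrite -rQ rot_cycle cycle_rect.
have uQ : uniq (tM :: q) by rewrite -rQ rot_uniq uniq_rect //; lia.
have mQ v : (v \in tM :: q) = (v \in Q) by rewrite -rQ mem_rot.
have lq u : last u q = bM by rewrite /q !last_cat.
clearbody q.
pose c := l :: rcons r b.
pose D := q ++ vdn a.+1 y.+1 d.+1 ++ rev (belast t c) ++ vup a y.+1 d.+1.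
have lc : last t c = b by rewrite /c /= last_rcons.
have ec : rev (belast t c) = rev [:: t, l & r] by rewrite /c /= belast_rcons.
have lD : last tM D = tM by rewrite /D !last_cat ec rev_cons last_rcons last_vup -eM.
have cD : cycle adj D.
  have pq : path adj tM q by move: cQ; rewrite [cycle _ _]rcons_path => /andP[].
  have ebM : bM = (a.+1, y.+1 + d.+1)%N by rewrite /bM eM.
  rewrite (cycle_path tM) lD cat_path pq lq ebM cat_path path_vdn last_vdn -/b.
  rewrite cat_path -[X in path _ X (rev _)]lc adj_rev_path; last first.
    by rewrite /c; move: cC => /= /andP[].
  by rewrite ec rev_cons last_rcons path_vup.
have uD : uniq D.
  have uq : uniq q by case/andP: uQ.
  have mq v : v \in q -> v != tM /\ v \in Q.
    move=> vq; split; last by rewrite -mQ inE vq orbT.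
    by apply: contraTneq vq => ->; case/andP: uQ.
  have mc v : v \in rev (belast t c) -> [/\ v \in C & v != b].
    rewrite ec mem_rev => vc; split; first by rewrite inE vc orbT.
    by apply: contraTneq vc => ->; case/andP: uC.
  have ucc : uniq (rev (belast t c)) by rewrite ec rev_uniq; case/andP: uC.
  apply: uniq_cat4; first by rewrite uniq_vdn uniq_vup.
  - move=> v; rewrite mem_vdn => h; apply/negP => /mq[_]; rewrite mem_rect.
    by case: v h => v1 v2 /=; lia.
  - move=> v /mc[/inC h _]; apply/negP => /mq[_]; rewrite mem_rect.
    by case: v h => v1 v2 /=; lia.
  - move=> v; rewrite mem_vup => h; apply/negP => /mq[vt]; rewrite mem_rect.
    by case: v h vt => v1 v2 /=; rewrite xpair_eqE; lia.
  - move=> v /mc[/topleft[h1 h2] vb]; rewrite mem_vdn; apply/negP.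
    by case: v h1 h2 vb => v1 v2 /=; rewrite xpair_eqE; lia.
  - move=> v; rewrite mem_vup mem_vdn; lia.
  - move=> v; rewrite mem_vup => h; apply/negP => /mc[/topleft[h1 _] _].
    by case: v h h1 => v1 v2 /=; lia.
have cX : cycle adj X by exact: cycle_rect.
have uX : uniq X by exact: uniq_rect.
have sX : (1 < size X)%N by rewrite /X /rect !size_cat /=; lia.
have sD : (1 < size D)%N by rewrite /D ec !size_cat /= size_rev /=; lia.
have wX f : wind X f = ((a <= f.1 < a + 1) && (y.+1 < f.2 <= M))%N%:Z.
  by rewrite wind_rect -eM.
pose pdn := vdn a y.+1 d.+1; pose pup := vup a.+1 y.+1 d.+1.
have eX : X = pdn ++ b :: (pup ++ [:: tM]).
  by rewrite /X /rect -/pdn !addn1 -/pup /hrt /= addn0 -eM.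
have eD : D = q ++ rev (belast b pup) ++ rev (belast t c) ++ rev (belast tM pdn).
  by rewrite /D /tM eM -rev_vdn -rev_vup.
have lup : last b pup = bM by rewrite last_vup /bM eM.
have ldn : last tM pdn = t by rewrite /tM eM last_vdn.
have lX : last tM X = tM by rewrite eX last_cat /= last_cat.
have eCw f : wind C f = turn f b t + psum (turn f) t c by [].
have eCg : holc phi C = (phi b t * hol phi t c)%g by [].
clearbody pdn pup; clear ec; clearbody c.
(* D runs backwards along C and the sides of the strip X, and forwards along Q except on top of X *)
have wD f : wind D f = wind Q f - wind C f - wind X f.
  have -> : wind Q f = psum (turn f) tM q + turn f bM tM.
    by rewrite -(wind_rot (size (P ++ [:: bM]))) rQ /wind /= psum_rcons lq.
  have -> : wind C f = turn f b t + psum (turn f) t c by exact: eCw.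
  rewrite /wind (csum_last _ tM) lD (csum_last _ tM X) lX eD eX !psum_cat /=.
  rewrite psum_cat /= lup ldn lq (last_back lup) (last_back lc).
  rewrite (psum_back (@turn_antisym f) lup) (psum_back (@turn_antisym f) lc).
  rewrite (psum_back (@turn_antisym f) ldn) [turn f t b]turn_antisym; ring.
have [S eS] : exists S, enclosed phi X S.
  apply: (enclosed_pos (f := tM)); last exact: jordan.
  by rewrite wX /=; move: yM; clear; lia.
have [T eT] : exists S, enclosed phi D S.
  apply: (enclosed_pos (f := (0, 1)%N)); last exact: jordan.
  rewrite wD wX wind_rect wind_left// (vedge_notin (v := (0, 1)%N) cC); [|by apply/negP => /inC|by left].
  by rewrite /=; move: a0 aM; clear; lia.
have [k1 hD] := holc_last tM D; have [k2 hX] := holc_last tM X.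
have [k3 hQ] := holc_rot phi (size (P ++ [:: bM])) Q.
rewrite lD in hD; rewrite lX in hX.
have eXg : hol phi tM X = (hol phi tM pdn * phi t b * hol phi b pup * phi bM tM)%g.
  by rewrite eX hol_cat /= hol_cat /= ldn lup mulg1 !mulgA.
have eDg : hol phi tM D = (hol phi tM q * (hol phi b pup)^-1 * (hol phi t c)^-1 * (hol phi tM pdn)^-1)%g.
  have hol_back u v s : last u s = v -> hol phi v (rev (belast u s)) = (hol phi u s)^-1%g.
    by move=> <-; exact: hol_rev.
  by rewrite eD !hol_cat lq (last_back lup) (last_back lc) !hol_back// !mulgA.
have eQg : holc phi (tM :: q) = (hol phi tM q * phi bM tM)%g.
  by rewrite /= hol_rcons lq.
have dDX f : wind D f = 0 \/ wind X f = 0.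
  have [|?] := boolP ((a <= f.1 < a + 1) && (y.+1 < f.2 <= M))%N; last first.
    by right; rewrite wX; apply/eqP; rewrite eqz_nat eqb0.
  move=> h; left; rewrite wD wX h wind_rect.
  have -> : wind C f = 0.
    apply: csum0 cC => u v uC' vC' _; rewrite /turn.
    have H w : w \in C -> (w.2 == f.2) = false.
      move=> /topleft[hw _]; apply/negbTE; rewrite neq_ltn (leq_ltn_trans hw)//.
      by case/andP: h => _ /andP[].
    by rewrite (H u uC') (H v vC') !andbF.
  have -> : ((0 <= f.1 < 0 + M) && (0 < f.2 <= 0 + M))%N.
    case/andP: h => /andP[_ h1] /andP[h2 h3].
    have f1 : (f.1 <= a)%N by move: h1; rewrite addn1 ltnS.
    by rewrite !add0n leq0n (leq_ltn_trans (leqW f1) aM) (leq_ltn_trans _ h2).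
  by rewrite subr0 subrr.
have := regionU (regionJ k1^-1%g eT) (regionJ k2^-1%g eS) dDX.
rewrite hD hX !conjgK => H.
exists (hol phi tM D * hol phi tM X)%g, (T ++ S).
exists (phi b t * (hol phi tM pdn)^-1 * (hol phi tM D)^-1)%g, k3; split.
  by apply: region_ext H _ => f; rewrite wD subrK.
rewrite [in RHS]conjVg -hQ rQ eQg -[(phi b t * (_ * _))%g]/(holc phi C) eCg eXg eDg !conjgE !invgM !invgK -!mulgA.
by rewrite !(mulKg, mulVKg) (phiV b t).
Qed.

End keyhole.

Section two_sides.
Context (G : groupType) (phi : vertex -> vertex -> G).
Hypothesis phiV : forall u v, (phi v u = (phi u v)^-1)%g.
Local Open Scope ring_scope.

(** The inside is given by [jordan] and the outside by [keyhole], after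
    choosing the orientation for which the top-left corner is turned
    anti-clockwise. *)
Theorem simple_cycle_sides M s : uniq s -> cycle adj s -> (2 < size s)%N ->
  (forall v, v \in s -> (0 < v.1 < M)%N && (0 < v.2 < M)%N) ->
  exists w h g S T, exists k k1 k2 : G,
  [/\ region phi w h S, region phi (fun f => wind (rect 0 0 M M) f - w f) g T,
      (h^-1 ^ k1 = g * (holc phi (rect 0 0 M M))^-1 ^ k2)%g &
      (h = holc phi s ^ k)%g \/ (h = (holc phi s)^-1 ^ k)%g].
Proof.
move=> us cs s3 sM; have [a [y [r [tl e]]]] := top_corner us cs s3.
set C := [:: _, _, _ & r] in tl e.
have [uC cC mC] : [/\ uniq C, cycle adj C & C =i s].
  case: e => -[i <-].
    by split; rewrite ?rot_uniq ?rot_cycle// => v; rewrite mem_rot.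
  split; rewrite ?rot_uniq ?rev_uniq ?rot_cycle//.
    by rewrite rev_cycle (eq_cycle (e' := adj)) // => ? ?; exact: adj_sym.
  by move=> v; rewrite mem_rot mem_rev.
have CM v : v \in C -> (0 < v.1 < M)%N && (0 < v.2 < M)%N.
  by rewrite mC; exact: sM.
have [g [T [k1 [k2 [gT hgT]]]]] := keyhole phiV uC cC tl CM.
have [S eS] : exists S, enclosed phi C S.
  apply: (enclosed_pos (f := (a, y.+1))); last exact: jordan.
  exact: wind_top_left.
have [k ek] : exists k : G, (holc phi C = holc phi s ^ k)%g \/ (holc phi C = (holc phi s)^-1 ^ k)%g.
  case: e => -[i <-].
    by have [k ->] := holc_rot phi i s; exists k; left.
  have [k ->] := holc_rot phi i (rev s); have [k' ->] := holc_rev phiV s.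
  by exists (k' * k)%g; right; rewrite conjgM.
by exists (wind C), (holc phi C), g, S, T, k, k1, k2; split.
Qed.

End two_sides.

(** * Loop erasure *)

Section loop_erasure.
Local Open Scope nat_scope.
Context (G : groupType) (phi : vertex -> vertex -> G).
Hypothesis phiV : forall u v, (phi v u = (phi u v)^-1)%g.
Hypothesis phi1 : forall u, phi u u = 1%g.
Variables (K E : nat) (v : nat -> vertex).

(** The indices are times on a circle of length K, close when they are at
    distance at most E. *)
Definition near_index i m := ((m <= i + E) && (i <= m + E)) || (K + m <= i + E) || (K + i <= m + E).

Hypothesis close : forall i j, i < j < K -> v i = v j -> near_index i j.
Hypothesis small : forall i t, i < K -> (forall m, m \in t -> m < K /\ near_index i m) ->
  last (v i) (map v t) = v i -> hol phi (v i) (map v t) = 1%g.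

Definition weak_adj u w := (u == w) || adj u w.

Lemma nuniq_split (s : seq nat) : uniq s -> ~~ uniq (map v s) ->
  exists A i B j D, s = A ++ i :: B ++ j :: D /\ v i = v j.
Proof.
elim: s => //= i s IHs /andP[_ us]; rewrite negb_and negbK => /orP[/mapP[j js e]|/(IHs us)].
  have [B [D ->]] := split_mem js.
  by exists [::], i, B, j, D.
by move=> [A [i' [B [j [D [-> e]]]]]]; exists (i :: A), i', B, j, D.
Qed.

Lemma weak_cycle_adj s : uniq s -> (1 < size s)%N -> cycle weak_adj s -> cycle adj s.
Proof.
have weak x t : uniq (x :: t) -> path weak_adj x t -> path adj x t.
  elim: t x => //= z t IHt x /andP[]; rewrite inE negb_or => /andP[xz _] ut.
  by rewrite {1}/weak_adj (negbTE xz) /= => /andP[-> /(IHt _ ut)].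
case: s => // x s; case/lastP: s => // s z us _ /=.
rewrite rcons_path last_rcons => /andP[/(weak _ _ us) p zx].
rewrite rcons_path p last_rcons; move: zx; rewrite /weak_adj => /orP[/eqP e|//].
by move: us; rewrite /= mem_rcons e mem_head.
Qed.

(** If s visits a vertex at two times i < j, these are close on the circle, so
    one of the two arcs between them consists of times close to its base
    point. It has trivial holonomy and can be erased; induction on the length. *)
Theorem loop_erasure s : sorted ltn s -> (forall m, m \in s -> m < K) ->
  cycle weak_adj (map v s) ->
  holc phi (map v s) = 1%g \/ exists C, [/\ uniq C, cycle adj C, 2 < size C,
    {subset C <= map v s} & exists k : G, holc phi C = (holc phi (map v s) ^ k)%g].
Proof.
have [n] := ubnP (size s); elim: n s => // n IHn s sn ss sK cs.
have [us|nus] := boolP (uniq (map v s)).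
  have [s1|s1] := leqP (size (map v s)) 1.
    by left; case: (map v s) s1 => [|u []]//= _; rewrite phi1 mulg1.
  have [s2|s2] := leqP (size (map v s)) 2.
    left; case: (map v s) s1 s2 => [|u [|w []]]//= _ _.
    by rewrite (phiV u w) mulg1 mulgV.
  right; exists (map v s); split => //; first exact: weak_cycle_adj (ltnW s2) cs.
  by exists 1%g; rewrite conjg1.
have [A [i [B [j [D [es vij]]]]]] := nuniq_split (sorted_uniq ltn_trans ltnn ss) nus.
have rs : rot (size A) s = i :: B ++ j :: D ++ A by rewrite es rot_size_cat /= -catA.
have sorts : [/\ i < j < K, forall m, m \in A -> m < i, forall m, m \in B -> i < m < j &
   forall m, m \in D -> j < m < K].
  have := ss; rewrite es (sorted_pairwise ltn_trans) pairwise_cat /= pairwise_cat /=.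
  rewrite allrel_consr allrel_catr allrel_consr all_cat /=.
  move=> /and3P[/and3P[/allP Ai _ _] _] /andP[/and3P[/allP iB ij /allP iD]].
  rewrite allrel_consr => /and3P[/andP[/allP Bj _] _ /andP[/allP jD _]].
  have jK : j < K by apply: sK; rewrite es mem_cat inE mem_cat mem_head !orbT.
  split=> [|m /Ai//|m mB|m mD]; rewrite ?ij ?jK//.
    by rewrite iB//= Bj.
  by rewrite (jD m mD) /=; apply: sK; rewrite es !(mem_cat, inE) mD !orbT.
have [/andP[ij jK] hA hB hD] := sorts.
have iK : i < K := ltn_trans ij jK.
have [kr ekr] := holc_rot phi (size A) (map v s).
rewrite -map_rot rs in ekr.
have cr : cycle weak_adj (map v (i :: B ++ j :: D ++ A)).
  by rewrite -rs map_rot rot_cycle.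
rewrite /= map_cat /= map_cat rcons_cat rcons_cons cat_path /= in cr.
have hr : holc phi (map v (i :: B ++ j :: D ++ A)) =
  (hol phi (v i) (map v (rcons B j)) * hol phi (v j) (map v (rcons (D ++ A) i)))%g.
  rewrite /= !map_rcons map_cat /= rcons_cat rcons_cons -cat_rcons.
  by rewrite hol_cat last_rcons.
have nij : near_index i j by apply: close => //; rewrite ij.
have sub s' : subseq s' s -> size s' < size s -> cycle weak_adj (map v s') ->
  (exists k : G, holc phi (map v s') = (holc phi (map v s) ^ k)%g) ->
  holc phi (map v s) = 1%g \/ exists C, [/\ uniq C, cycle adj C, 2 < size C,
    {subset C <= map v s} & exists k : G, holc phi C = (holc phi (map v s) ^ k)%g].
  move=> s's lt cs' [k ek].
  case: (IHn s'); rewrite ?(leq_trans lt)//; first by apply: subseq_sorted ss; first exact: ltn_trans.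
    by move=> m /(mem_subseq s's)/sK.
  - by move=> e1; left; apply: (@conjg_inj _ k); rewrite -ek e1 conj1g.
  - move=> [C [uC cC C2 sC [k' ek']]]; right; exists C; split => //.
      by move=> u /sC/mapP[m /(mem_subseq s's) ms ->]; exact: map_f.
    by exists (k * k')%g; rewrite ek' ek conjgM.
case/boolP: (j <= i + E) => [jiE|jiE].
  have h1 : hol phi (v i) (map v (rcons B j)) = 1%g.
    apply: small => //; last by rewrite map_rcons last_rcons.
    move=> m; rewrite mem_rcons inE => /orP[/eqP ->//|/hB/andP[h1 h2]].
    rewrite /near_index; split; first exact: ltn_trans jK.
    by apply/orP; left; apply/orP; left; apply/andP; split; lia.
  have er : rot (size A) (A ++ j :: D) = j :: D ++ A by rewrite rot_size_cat.
  apply: (sub (A ++ j :: D)).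
  - by rewrite es; apply: cat_subseq => //; exact: (suffix_subseq (i :: B)).
  - by rewrite es !size_cat /= size_cat /=; lia.
  - rewrite -(rot_cycle (size A)) -map_rot er /= map_cat.
    by move: cr => /and3P[_ _]; rewrite vij.
  - have [k ek] := holc_rot phi (size A) (map v (A ++ j :: D)).
    exists (kr * k^-1)%g; rewrite conjgM -ekr hr h1 mul1g -[LHS](conjgK k) -ek.
    by rewrite -map_rot er /= map_rcons map_cat vij.
have h2 : hol phi (v j) (map v (rcons (D ++ A) i)) = 1%g.
  apply: small => //; last by rewrite map_rcons last_rcons.
  have Eij : K + i <= j + E.
    by move: nij; rewrite /near_index; lia.
  move=> m; rewrite mem_rcons inE mem_cat => /or3P[/eqP ->|/hD/andP[d1 d2]|/hA d1].
  - by split => //; rewrite /near_index Eij !orbT.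
  - by split => //; rewrite /near_index; lia.
  - by split; [lia|rewrite /near_index; lia].
apply: (sub (i :: B)).
- rewrite es; apply: subseq_trans (suffix_subseq A _).
  exact: (prefix_subseq (i :: B)).
- by rewrite es !size_cat /= size_cat /=; lia.
- rewrite /= rcons_path; by move: cr => /and3P[-> h _]; rewrite {2}vij.
- exists kr; rewrite -ekr hr h2 mulg1 /= map_rcons vij//.
Qed.

End loop_erasure.

(** * Sines and angles *)

Section real_lemmas.
Context {R : realType}.
Implicit Types (f : R -> R) (x y v : R).

Lemma ivt f x y v : continuous f -> (f x <= v <= f y) ->
  exists2 z, Num.min x y <= z <= Num.max x y & f z = v.
Proof.
move=> cf /andP[xv vy].
have [xy|/ltW yx] := leP x y.
  have [|z zxy fz] := @IVT R f x y v xy (continuous_subspaceT cf).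
    by rewrite ge_min xv le_max vy orbT.
  by exists z => //; move: zxy; rewrite in_itv.
have [|z zxy fz] := @IVT R f y x v yx (continuous_subspaceT cf).
  by rewrite ge_min xv orbT le_max vy.
by exists z => //; move: zxy; rewrite in_itv.
Qed.

Lemma constant_sign f : continuous f -> (forall x, f x != 0) ->
  (forall x, 0 < f x) \/ (forall x, f x < 0).
Proof.
move=> cf f0.
have H x y : f x < 0 -> 0 < f y -> False.
  move=> fx fy; have [|z _ fz] := @ivt f x y 0 cf; first by rewrite !ltW.
  by have := f0 z; rewrite fz eqxx.
have [f00|f00] := ltP 0 (f 0); [left|right] => x.
  by have := f0 x; rewrite neq_lt => /orP[/H/(_ f00)|].
have f00' : f 0 < 0 by rewrite lt_neqAle f0.
by have := f0 x; rewrite neq_lt => /orP[//|/(H _ _ f00')].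
Qed.

Lemma sin_pi_int (m : int) : sin (pi * m%:~R) = 0 :> R.
Proof.
have H (n : nat) : sin (pi * n%:R) = 0 :> R.
  elim: n => [|n IHn]; first by rewrite mulr0 sin0.
  by rewrite -natr1 mulrDr mulr1 sinDpi IHn oppr0.
by case: m => n; rewrite ?NegzE -?pmulrn ?H// mulrNz mulrN sinN -pmulrn H oppr0.
Qed.

Lemma sin_lt0_2pi x : pi < x < 2 * pi -> sin x < 0.
Proof.
move=> h; rewrite -[x](subrK pi) sinDpi oppr_lt0; apply: sin_gt0_pi; lra.
Qed.

Lemma sin_eq0 x : sin x = 0 -> exists m : int, x = pi * m%:~R.
Proof.
move=> sx; have p0 := @pi_gt0 R.
pose m := Num.floor (x / pi); exists m.
have := floor_itv (x / pi); rewrite -/m => /andP[h1 h2].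
have h1' : m%:~R * pi <= x by rewrite -ler_pdivlMr.
have h2' : x < (m + 1)%:~R * pi by rewrite -ltr_pdivrMr.
have : sin (x - pi * m%:~R) = 0 by rewrite sinB sin_pi_int sx mul0r mulr0 subrr.
move: h1' h2'; rewrite intrD mulrDl mul1r [m%:~R * pi]mulrC le_eqVlt => /orP[/eqP//|h1' h2'] s0.
have : 0 < sin (x - pi * m%:~R) by apply: sin_gt0_pi; lra.
by rewrite s0 ltxx.
Qed.

Lemma angle_exists x y : x ^+ 2 + y ^+ 2 = 1 -> exists t, cos t = x /\ sin t = y.
Proof.
move=> xy; have x1 : -1 <= x <= 1.
  by rewrite -ler_norml -(@ler_sqr _ `|x| 1) ?nnegrE// expr1n real_normK ?num_real//; have := sqr_ge0 y; lra.
have e : Num.sqrt (1 - x ^+ 2) = `|y| by rewrite -xy addrAC subrr add0r sqrtr_sqr.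
have [y0|y0] := leP 0 y.
  by exists (acos x); rewrite acosK ?in_itv//= sin_acos// e ger0_norm.
by exists (- acos x); rewrite cosN sinN acosK ?in_itv//= sin_acos// e ltr0_norm// opprK.
Qed.

(** The hypothesis means that f takes its values in the multiples of 2 pi. *)
Lemma multiple_of_2pi_constant f : continuous f ->
  (forall x, sin (f x / 2) = 0) -> exists m : int, forall x, f x = 2 * pi * m%:~R.
Proof.
move=> cf sf; have [m em] := sin_eq0 (sf 0); exists m => x.
have e0 : f 0 = 2 * pi * m%:~R by lra.
apply/eqP; rewrite -e0 -[_ == _]negbK neq_lt; apply/negP.
have p0 := @pi_gt0 R.
have H u w : f u < f w -> (f u = f 0 \/ f w = f 0) -> False.
  move=> uw uw0.
  have [v [v1 v2 v3]] : exists v, [/\ f u <= v <= f w, v != f 0 & `|v - f 0| < 2 * pi].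
    case: uw0 => e; rewrite -e.
      exists (Num.min (f w) (f u + pi)); rewrite le_min ge_min lexx (ltW uw)/= lerDl pi_ge0.
      have h : f u < Num.min (f w) (f u + pi) by rewrite lt_min uw ltrDl p0.
      rewrite gt_eqF//; split => //; rewrite ger0_norm ?subr_ge0 ?(ltW h)//.
      have hm : Num.min (f w) (f u + pi) <= f u + pi by rewrite ge_min lexx orbT.
      lra.
    exists (Num.max (f u) (f w - pi)); rewrite ge_max le_max lexx (ltW uw)/= gerBl pi_ge0.
    have h : Num.max (f u) (f w - pi) < f w by rewrite gt_max uw ltrBlDr ltrDl p0.
    rewrite lt_eqF//; split => //; rewrite distrC ger0_norm ?subr_ge0 ?(ltW h)//.
    have hm : f w - pi <= Num.max (f u) (f w - pi) by rewrite le_max lexx orbT.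
    lra.
  have [z _ fz] := ivt cf v1.
  have := sf z; rewrite fz -[v](subrK (f 0)) mulrDl sinD sf mulr0 addr0 => /eqP.
  have c0 : cos (f 0 / 2) != 0.
    by rewrite -norm_sin_eq1 sf normr0 eq_sym oner_eq0.
  rewrite mulf_eq0 (negbTE c0) orbF => /eqP s0.
  have [v0|v0] := leP 0 (v - f 0).
    have : 0 < sin ((v - f 0) / 2).
      apply: sin_gt0_pi; move: v3; rewrite ger0_norm// => v3.
      have : 0 < v - f 0 by rewrite lt_neqAle v0 eq_sym subr_eq0 v2.
      lra.
    by rewrite s0 ltxx.
  have : 0 < sin (- ((v - f 0) / 2)).
    by apply: sin_gt0_pi; move: v3; rewrite ltr0_norm// => v3; lra.
  by rewrite sinN s0 oppr0 ltxx.
by move=> /orP[] h; [apply: H h _; right|apply: H h _; left].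
Qed.

End real_lemmas.

(** * Lifts of projective transformations to the line *)

Section lifts.
Context {R : realType}.
Implicit Types (f l : R -> R) (x y a b c d : R) (g : PSL2 R).

Notation S x := (sin (x / 2)).
Notation C x := (cos (x / 2)).

(** A lift with its scalar factor l taken positive, which determines the sign
    of the matrix. *)
Definition lifts a b c d f l := continuous f /\ forall x,
  [/\ 0 < l x, a * S x + b * C x = l x * S (f x)
    & c * S x + d * C x = l x * C (f x)].

Definition matrix_of g a b c d :=
  psl2_mx g = mx22 a b c d \/ psl2_mx g = - mx22 a b c d.

Lemma mx22_eta (M : 'M[R]_2) : M = mx22 (M 0 0) (M 0 1) (M 1 0) (M 1 1).
Proof.
apply/matrixP => i j; rewrite !mxE.
case: i => [[|[|//]] hi]; case: j => [[|[|//]] hj] /=; congr (M _ _); exact: val_inj.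
Qed.

Lemma mx22_dir a b c d x : mx22 a b c d *m direction x =
  \col_i (if i == 0 then a * S x + b * C x else c * S x + d * C x).
Proof.
apply/matrixP => i j; rewrite !mxE !big_ord_recl big_ord0 !mxE /= addr0.
by case: ifP.
Qed.

Lemma col2P (u v u' v' : R) : (\col_(i < 2) (if i == 0 then u else v)) =
  (\col_(i < 2) (if i == 0 then u' else v')) <-> u = u' /\ v = v'.
Proof.
split=> [e|[-> ->]//].
have := congr1 (fun M : 'cV_2 => M 0 0) e; have := congr1 (fun M : 'cV_2 => M 1 0) e.
by rewrite !mxE.
Qed.

Lemma S2C2 x : S x ^+ 2 + C x ^+ 2 = 1.
Proof. by rewrite addrC cos2Dsin2. Qed.

Lemma continuous_S f : continuous f -> continuous (fun x => S (f x)).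
Proof.
move=> cf x; apply: (@continuous_comp _ _ _ (fun x => f x / 2) sin).
  by apply: cvgM; [exact: cf|exact: cvg_cst].
exact: continuous_sin.
Qed.

Lemma continuous_C f : continuous f -> continuous (fun x => C (f x)).
Proof.
move=> cf x; apply: (@continuous_comp _ _ _ (fun x => f x / 2) cos).
  by apply: cvgM; [exact: cf|exact: cvg_cst].
exact: continuous_cos.
Qed.

(** The factor is continuous, and does not vanish since the matrix is
    invertible; so it has a constant sign, which is made positive by choosing
    the sign of the matrix. *)
Lemma lifts_exists g f : lies_over f g ->
  exists a b c d l, [/\ a * d - b * c = 1, matrix_of g a b c d & lifts a b c d f l].
Proof.
move=> [cf fg]; rewrite /matrix_of.
have : \det (psl2_mx g) = 1 by apply/eqP; exact: sl2_det.
move: fg; rewrite [psl2_mx g]mx22_eta det_mx22E.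
set a := psl2_mx g 0 0; set b := psl2_mx g 0 1; set c := psl2_mx g 1 0; set d := psl2_mx g 1 1.
move=> fg abcd.
pose l x := (a * S x + b * C x) * S (f x) + (c * S x + d * C x) * C (f x).
have lE x : a * S x + b * C x = l x * S (f x) /\ c * S x + d * C x = l x * C (f x).
  have [m] := fg x; rewrite mx22_dir /direction.
  rewrite (_ : m *: _ = \col_i (if i == 0 then m * S (f x) else m * C (f x))); last first.
    by apply/matrixP => i j; rewrite !mxE; case: ifP.
  move=> /col2P[e1 e2]; rewrite /l e1 e2.
  by split; rewrite -!mulrA -mulrDr -!expr2 S2C2 mulr1.
have l0 x : l x != 0.
  apply/eqP => l0; have [] := lE x; rewrite l0 !mul0r => e1 e2.
  have s0 : S x = 0.
    have <- : (a * d - b * c) * S x = S x by rewrite abcd mul1r.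
    by transitivity (d * (a * S x + b * C x) - b * (c * S x + d * C x)); [ring|rewrite e1 e2; ring].
  have c0 : C x = 0.
    have <- : (a * d - b * c) * C x = C x by rewrite abcd mul1r.
    by transitivity (a * (c * S x + d * C x) - c * (a * S x + b * C x)); [ring|rewrite e1 e2; ring].
  by have /eqP := S2C2 x; rewrite s0 c0 expr0n addr0 eq_sym oner_eq0.
have cl : continuous l.
  have cid : continuous (fun x : R => x) by move=> x; exact: cvg_id.
  have cS := continuous_S cid.
  have cC := continuous_C cid.
  have cSf := continuous_S cf; have cCf := continuous_C cf.
  by move=> x; rewrite /l; apply: cvgD; (apply: cvgM; [apply: cvgD; (apply: cvgM; [exact: cvg_cst|]);
    [exact: cS|exact: cC]|]); [exact: cSf|exact: cCf].
have [lp|ln] := constant_sign cl l0.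
  exists a, b, c, d, l; split => //; first by left.
  by split => // x; have [? ?] := lE x; split.
exists (- a), (- b), (- c), (- d), (fun x => - l x); split.
- by rewrite -abcd; ring.
- right; apply/matrixP => i j; rewrite !mxE.
  by do 2!case: ifP => _; rewrite opprK.
- split => // x; have [e1 e2] := lE x; rewrite oppr_gt0 ln !mulNr -e1 -e2.
  by split => //; ring.
Qed.

(** The determinant of the directions x and y is the sine of (x - y) / 2, and
    the matrix preserves determinants. *)
Lemma lifts_sin a b c d f l x y : a * d - b * c = 1 -> lifts a b c d f l ->
  l x * l y * sin ((f y - f x) / 2) = sin ((y - x) / 2).
Proof.
move=> abcd [_ fl]; have [_ x1 x2] := fl x; have [_ y1 y2] := fl y.
rewrite !mulrBl !sinB.
have <- : (a * d - b * c) * (S y * C x - C y * S x) = S y * C x - C y * S x.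
  by rewrite abcd mul1r.
transitivity ((l y * S (f y)) * (l x * C (f x)) - (l y * C (f y)) * (l x * S (f x))); first by ring.
by rewrite -x1 -x2 -y1 -y2; ring.
Qed.

(** By [lifts_sin] the sine of (f y - f x) / 2 stays positive as long as y - x
    is between 0 and 2 pi, so f y - f x, which starts from 0, cannot reach 0
    or 2 pi again. *)
Lemma lift_lt g f x y : lies_over f g -> 0 < y - x < 2 * pi -> 0 < f y - f x < 2 * pi.
Proof.
move=> fg xy; have [a [b [c [d [l [abcd _ fl]]]]]] := lifts_exists fg.
have p0 := @pi_gt0 R.
have sp z : x < z <= y -> 0 < sin ((f z - f x) / 2).
  move=> xz; have : 0 < sin ((z - x) / 2) by apply: sin_gt0_pi; lra.
  rewrite -(lifts_sin x z abcd fl) pmulr_rgt0//.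
  by have [_ fl'] := fl; have [? _ _] := fl' x; have [? _ _] := fl' z; rewrite mulr_gt0.
have cf : continuous f := fg.1.
have xy' : x < y by lra.
have nv v : sin (v / 2) <= 0 -> v != 0 -> f y - f x <= v <= 0 \/ 0 <= v <= f y - f x -> False.
  move=> sv v0 h; have cf' : continuous (fun z => f z - f x).
    by move=> z; apply: cvgB; [exact: cf|exact: cvg_cst].
  have [z [zxy fz]] : exists z, x <= z <= y /\ f z - f x = v.
    case: h => h.
      have [|z] := @ivt R (fun z => f z - f x) y x v cf'; first by rewrite subrr.
      by rewrite min_r ?max_l ?(ltW xy')// => ? ?; exists z.
    have [|z] := @ivt R (fun z => f z - f x) x y v cf'; first by rewrite subrr.
    by rewrite min_l ?max_r ?(ltW xy')// => ? ?; exists z.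
  have [e|ne] := eqVneq z x; first by move: v0; rewrite -fz e subrr eqxx.
  have : 0 < sin ((f z - f x) / 2) by apply: sp; rewrite lt_neqAle eq_sym ne.
  by rewrite fz ltNge sv.
have s2 : sin (2 * pi / 2) <= 0 :> R by rewrite mulrAC divff ?pnatr_eq0// mul1r sinpi.
have s2' : sin (- (2 * pi) / 2) <= 0 :> R by rewrite mulNr sinN mulrAC divff ?pnatr_eq0// mul1r sinpi oppr0.
have sy := sp y; apply/andP; split; rewrite ltNge; apply/negP => h.
  have [h1|h1] := leP (f y - f x) (- (2 * pi)).
    by apply: (nv (- (2 * pi))) => //; [lra|left; lra].
  have [h2|h2] := eqVneq (f y - f x) 0.
    have /sy : x < y <= y by rewrite xy' lexx.
    by rewrite h2 mul0r sin0 ltxx.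
  apply: (nv (f y - f x)) => //; last by left; lra.
  rewrite -[_ / 2]opprK sinN oppr_le0; apply: sin_ge0_pi; lra.
by apply: (nv (2 * pi)) => //; [lra|right; lra].
Qed.

(** By [lifts_sin] the increment of f over a full turn is a multiple of 2 pi,
    and by [lift_lt] it lies strictly between 0 and 4 pi. *)
Lemma lift_2pi g f x : lies_over f g -> f (x + 2 * pi) = f x + 2 * pi.
Proof.
move=> fg; have p0 := @pi_gt0 R.
have h1 : 0 < f (x + pi) - f x < 2 * pi by apply: lift_lt fg _; lra.
have h2 : 0 < f (x + 2 * pi) - f (x + pi) < 2 * pi by apply: lift_lt fg _; lra.
have [a [b [c [d [l [abcd _ fl]]]]]] := lifts_exists fg.
have := lifts_sin x (x + 2 * pi) abcd fl.
rewrite (_ : (x + 2 * pi - x) / 2 = pi); last by field.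
rewrite sinpi => /eqP; rewrite mulf_eq0 mulf_eq0.
have [_ fl'] := fl; have [/lt0r_neq0/negbTE -> _ _] := fl' x.
have [/lt0r_neq0/negbTE -> _ _] /= := fl' (x + 2 * pi) => /eqP s0.
have [h|h|h] := ltgtP ((f (x + 2 * pi) - f x) / 2) pi; last by lra.
  have : 0 < sin ((f (x + 2 * pi) - f x) / 2) by apply: sin_gt0_pi; lra.
  by rewrite s0 ltxx.
have : sin ((f (x + 2 * pi) - f x) / 2) < 0 by apply: sin_lt0_2pi; lra.
by rewrite s0 ltxx.
Qed.

Lemma lift_2pi_int g f x (m : int) : lies_over f g ->
  f (x + 2 * pi * m%:~R) = f x + 2 * pi * m%:~R.
Proof.
move=> fg; have H (n : nat) y : f (y + 2 * pi * n%:R) = f y + 2 * pi * n%:R.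
  elim: n y => [|n IHn] y; first by rewrite !mulr0 !addr0.
  rewrite (_ : y + 2 * pi * n.+1%:R = y + 2 * pi * n%:R + 2 * pi); last by ring.
  by rewrite (lift_2pi _ fg) IHn; ring.
case: m => n; first exact: H.
rewrite NegzE mulrNz mulrN -pmulrn.
by rewrite -[in RHS](subrK (2 * pi * n.+1%:R) x) H addrK.
Qed.

Lemma lift_mono g f x y : lies_over f g -> x < y -> f x < f y.
Proof.
move=> fg xy; have p0 := @pi_gt0 R.
pose m := Num.floor ((y - x) / (2 * pi)).
have := floor_itv ((y - x) / (2 * pi)); rewrite -/m => /andP[].
rewrite ler_pdivlMr ?mulr_gt0// ltr_pdivrMr ?mulr_gt0// intrD mulrDl mul1r => m1 m2.
have m0 : 0 <= (m%:~R : R).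
  by rewrite ler0z /m floor_ge0 divr_ge0 ?mulr_ge0 ?pi_ge0//; lra.
have m0' : 0 <= 2 * pi * m%:~R :> R by rewrite !mulr_ge0 ?pi_ge0.
have e := lift_2pi_int x m fg.
have [e1|ne] := eqVneq y (x + 2 * pi * m%:~R).
  by rewrite e1 e; move: xy; rewrite e1; lra.
have : 0 < y - (x + 2 * pi * m%:~R).
  by rewrite subr_gt0 lt_neqAle eq_sym ne/=; lra.
move=> h; have := @lift_lt g f (x + 2 * pi * m%:~R) y fg; rewrite e.
by move=> H; have := H ltac:(lra); lra.
Qed.

Lemma lift_monoW g f x y : lies_over f g -> x <= y -> f x <= f y.
Proof. by move=> fg; rewrite le_eqVlt => /orP[/eqP ->//|/(lift_mono fg)/ltW]. Qed.

End lifts.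

(** * Translation numbers *)

Section translation.
Context {R : realType}.
Implicit Types (f F : R -> R) (x y a b c d t : R) (g h k : PSL2 R).

Notation S x := (sin (x / 2)).
Notation C x := (cos (x / 2)).

Lemma translation_number_bounded f (T B : R) :
  (forall k : nat, `|iter k f 0 - k%:R * T| <= B) -> translation_number f = T.
Proof.
move=> fB; apply/cvg_lim => //; apply/cvgrPdist_le => e e0; near=> k.
have k0 : 0 < k%:R :> R by rewrite ltr0n; near: k; exact: nbhs_infty_gt.
have -> : T - iter k f 0 / k%:R = - (iter k f 0 - k%:R * T) / k%:R.
  by field; rewrite gt_eqF.
rewrite normrM normrN normfV (gtr0_norm k0) ler_pdivrMr//.
apply: le_trans (fB k) _; rewrite -ler_pdivrMl//.
by near: k; exact: nbhs_infty_ger.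
Unshelve. all: by end_near.
Qed.

Definition equivariant F := (forall x y, x < y -> F x < F y) /\
  forall x (m : int), F (x + 2 * pi * m%:~R) = F x + 2 * pi * m%:~R.

Lemma lift_equivariant f g : lies_over f g -> equivariant f.
Proof.
by move=> fg; split=> [x y|x m]; [exact: lift_mono fg|exact: lift_2pi_int fg].
Qed.

Lemma iter_equivariant f n : equivariant f -> equivariant (iter n f).
Proof.
move=> [f1 f2]; elim: n => [|n [h1 h2]]; first by split.
by split=> [x y xy|x m] /=; [apply/f1/h1|rewrite h2 f2].
Qed.

(** Translating y by a multiple of 2 pi brings it to the full turn that ends
    at x, where monotony gives the bound. *)
Lemma equivariant_osc F x y : equivariant F ->
  - (2 * pi) < (F x - x) - (F y - y) < 2 * pi.
Proof.
move=> [F1 F2]; have p0 := @pi_gt0 R.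
pose m := Num.floor ((x - y) / (2 * pi)).
have := floor_itv ((x - y) / (2 * pi)); rewrite -/m => /andP[].
rewrite ler_pdivlMr ?mulr_gt0// ltr_pdivrMr ?mulr_gt0// intrD mulrDl mul1r => m1 m2.
have e := F2 y m.
have h1 : F (y + 2 * pi * m%:~R) <= F x.
  by apply: (ltW_homo F1); lra.
have h2 : F x < F (y + 2 * pi * m%:~R + 2 * pi * 1%:~R) by apply: F1; rewrite mulr1z; lra.
move: h2; rewrite F2 mulr1z e => h2; rewrite e in h1.
by apply/andP; split; lra.
Qed.

Lemma direction_2pi x (m : int) :
  direction (x + 2 * pi * m%:~R) = cos (pi * m%:~R) *: direction x.
Proof.
apply/matrixP => i j; rewrite !mxE.
have -> : (x + 2 * pi * m%:~R) / 2 = x / 2 + pi * m%:~R by field.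
by rewrite sinD cosD sin_pi_int !mulr0 addr0 subr0; case: ifP => _; rewrite mulrC.
Qed.

Lemma cos_pi_int_sqr (m : int) : cos (pi * m%:~R) * cos (pi * m%:~R) = 1 :> R.
Proof. by rewrite -expr2 cos2sin2 sin_pi_int expr0n subr0. Qed.

Lemma lies_over_shift f g (m : int) : lies_over f g ->
  lies_over (fun x => f x + 2 * pi * m%:~R) g.
Proof.
move=> [cf fg]; split.
  by move=> x; apply: cvgD; [exact: cf|exact: cvg_cst].
move=> x; have [l e] := fg x; exists (l * cos (pi * m%:~R)).
by rewrite direction_2pi scalerA -mulrA cos_pi_int_sqr mulr1.
Qed.

Lemma psl2_mx_pi (A : SL2 R) : psl2_mx (\pi_(PSL2 R) A) = val A \/
  psl2_mx (\pi_(PSL2 R) A) = - val A.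
Proof. by have /psl2P := reprK (\pi_(PSL2 R) A). Qed.

Lemma psl2_mxM g h : psl2_mx (g * h)%g = psl2_mx g *m psl2_mx h \/
  psl2_mx (g * h)%g = - (psl2_mx g *m psl2_mx h).
Proof. exact: psl2_mx_pi. Qed.

Lemma lies_over_comp f f' g g' : lies_over f g -> lies_over f' g' ->
  lies_over (f \o f') (g * g')%g.
Proof.
move=> [cf fg] [cf' fg']; split.
  by move=> x; apply: continuous_comp; [exact: cf'|exact: cf].
move=> x; have [l' e'] := fg' x; have [l e] := fg (f' x).
case: (psl2_mxM g g') => ->; rewrite ?mulNmx -mulmxA e' -scalemxAr e scalerA.
  by exists (l' * l).
by exists (- (l' * l)); rewrite scaleNr.
Qed.

Lemma lies_over_mx (M : SL2 R) f : continuous f ->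
  (forall x, exists l, val M *m direction x = l *: direction (f x)) ->
  lies_over f (\pi_(PSL2 R) M).
Proof.
move=> cf fM; split => // x; have [l e] := fM x.
case: (psl2_mx_pi M) => ->; first by exists l.
by exists (- l); rewrite mulNmx e scaleNr.
Qed.

Lemma direction_col x : direction x = \col_i (if i == 0 then S x else C x).
Proof. by []. Qed.

Lemma scale_direction m x :
  m *: direction x = \col_i (if i == 0 then m * S x else m * C x).
Proof. by apply/matrixP => i j; rewrite !mxE; case: ifP. Qed.

Lemma lies_over_rotation t : lies_over (fun x => x + t) (rotation t).
Proof.
apply: lies_over_mx.
  by move=> x; apply: cvgD; [exact: cvg_id|exact: cvg_cst].
move=> x; exists 1; rewrite scale1r mx22_dir direction_col.
by apply/col2P; rewrite mulrDl sinD cosD; split; ring.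
Qed.

Lemma lies_over_unique f1 f2 g : lies_over f1 g -> lies_over f2 g ->
  exists m : int, forall x, f1 x = f2 x + 2 * pi * m%:~R.
Proof.
move=> fg1 fg2; have [a [b [c [d [l [abcd ge [cf fl]]]]]]] := lifts_exists fg1.
have [|x|m em] := @multiple_of_2pi_constant R (fun x => f1 x - f2 x).
- by move=> x; apply: cvgB; [exact: fg1.1|exact: fg2.1].
- have [l0 e1 e2] := fl x.
  have [l2 [e3 e4]] : exists l2, a * S x + b * C x = l2 * S (f2 x) /\ c * S x + d * C x = l2 * C (f2 x).
    have [l2] := fg2.2 x; case: ge => ->.
      by rewrite mx22_dir scale_direction => /col2P ?; exists l2.
    move=> /eqP; rewrite mulNmx eqr_oppLR -scaleNr => /eqP.
    by rewrite mx22_dir scale_direction => /col2P ?; exists (- l2).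
  apply/eqP; rewrite -(mulrI_eq0 _ (lregP (lt0r_neq0 l0))) mulrBl sinB; apply/eqP.
  transitivity ((l x * S (f1 x)) * C (f2 x) - (l x * C (f1 x)) * S (f2 x)); first by ring.
  by rewrite -e1 -e2 e3 e4; ring.
- by exists m => x; rewrite -(em x); ring.
Qed.

(** Polar decomposition: K is the product of a rotation of angle u and of a
    symmetric positive matrix (A, B; B, D). The latter turns each direction by
    less than a right angle, the angle being the arc tangent of the quotient
    of the determinant cr x by the scalar product dt x of the direction and
    its image, so it has an explicit lift; the rotation lifts to a
    translation. *)
Lemma lift_existence k : exists f, lies_over f k.
Proof.
elim/quotW: k => K; have := sl2_det K; rewrite -[val K]/(sl2_val K) => /eqP.
have eK := mx22_eta (val K); move: eK.
set a := val K 0 0; set b := val K 0 1; set c := val K 1 0; set d := val K 1 1.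
move=> eK; rewrite -[sl2_val K]/(val K) eK det_mx22E => abcd.
pose r := Num.sqrt ((a + d) ^+ 2 + (b - c) ^+ 2).
have r2 : r ^+ 2 = (a + d) ^+ 2 + (b - c) ^+ 2 by rewrite sqr_sqrtr// addr_ge0// sqr_ge0.
have r2' : (a + d) ^+ 2 + (b - c) ^+ 2 = a ^+ 2 + b ^+ 2 + c ^+ 2 + d ^+ 2 + 2.
  have -> : (2 : R) = 2 * (a * d - b * c) by rewrite abcd mulr1.
  by ring.
have r0 : 0 < r.
  rewrite sqrtr_gt0 r2'; have := sqr_ge0 a; have := sqr_ge0 b; have := sqr_ge0 c; have := sqr_ge0 d; lra.
have [u [cu su]] : exists u, cos u = (a + d) / r /\ sin u = (b - c) / r.
  by apply: angle_exists; rewrite !expr_div_n -mulrDl -r2 divff// expf_eq0/= gt_eqF.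
set p := cos u in cu; set q := sin u in su.
have pq : p ^+ 2 + q ^+ 2 = 1 by exact: cos2Dsin2.
pose A := p * a - q * c; pose B := p * b - q * d; pose D := q * b + p * d.
have BE : B = q * a + p * c.
  have : p * (b - c) = q * (a + d) by rewrite cu su; ring.
  by rewrite /B; lra.
have AD : A * D - B * B = 1.
  have <- : (p ^+ 2 + q ^+ 2) * (a * d - b * c) = 1 by rewrite pq abcd mulr1.
  by rewrite {1}BE /A /B /D; ring.
have trAD : A + D = r.
  have -> : A + D = p * (a + d) + q * (b - c) by rewrite /A /D; ring.
  rewrite cu su; apply: (mulfI (lt0r_neq0 r0)); rewrite mulrDr.
  by rewrite -[RHS]expr2 r2; field; rewrite gt_eqF.
have A0 : 0 < A.
  rewrite ltNge; apply/negP => A0.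
  have D0 : 0 < D by lra.
  have := mulr_le0_ge0 A0 (ltW D0); have := sqr_ge0 B; rewrite expr2; lra.
pose w1 x := A * S x + B * C x; pose w2 x := B * S x + D * C x.
pose dt x := w1 x * S x + w2 x * C x; pose cr x := w1 x * C x - w2 x * S x.
have dt0 x : 0 < dt x.
  have : A * dt x = (A * S x + B * C x) ^+ 2 + C x ^+ 2.
    have <- : (A * D - B * B) * C x ^+ 2 = C x ^+ 2 by rewrite AD mul1r.
    by rewrite /dt /w1 /w2; ring.
  move=> e; rewrite -(pmulr_rgt0 _ A0) e lt_neqAle addr_ge0 ?sqr_ge0// andbT eq_sym.
  rewrite paddr_eq0 ?sqr_ge0// !sqrf_eq0; apply/negP => /andP[/eqP h1 /eqP h2].
  move: h1; rewrite h2 mulr0 addr0 => /eqP; rewrite mulf_eq0 gt_eqF//= => /eqP h1.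
  by have /eqP := S2C2 x; rewrite h1 h2 expr0n addr0 eq_sym oner_eq0.
have cid : continuous (fun x : R => x) by move=> x; exact: cvg_id.
have cS := continuous_S cid; have cC := continuous_C cid.
have cw1 : continuous w1.
  by move=> x; apply: cvgD; (apply: cvgM; [exact: cvg_cst|]); [exact: cS|exact: cC].
have cw2 : continuous w2.
  by move=> x; apply: cvgD; (apply: cvgM; [exact: cvg_cst|]); [exact: cS|exact: cC].
exists (fun x => x + 2 * atan (cr x / dt x) + 2 * u); apply: lies_over_mx.
  move=> x; apply: cvgD; last exact: cvg_cst.
  apply: cvgD; first exact: cvg_id.
  apply: cvgM; first exact: cvg_cst.
  apply: (@continuous_comp _ _ _ (fun x => cr x / dt x) atan); last exact: continuous_atan.
  apply: cvgM.
    by apply: cvgB; apply: cvgM; [exact: cw1|exact: cC|exact: cw2|exact: cS].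
  apply: cvgV; first by rewrite gt_eqF.
  by apply: cvgD; apply: cvgM; [exact: cw1|exact: cS|exact: cw2|exact: cC].
move=> x; set th := atan _.
have cth : 0 < cos th by apply: cos_gt0_pihalf; rewrite atan_gtNpi2 atan_ltpi2.
have sth : sin th = cr x / dt x * cos th.
  have : tan th = cr x / dt x by rewrite atanK.
  by rewrite /tan => <-; rewrite divfK// gt_eqF.
exists (dt x / cos th); rewrite eK mx22_dir scale_direction; apply/col2P.
have -> : (x + 2 * th + 2 * u) / 2 = x / 2 + th + u by field.
have dx := lt0r_neq0 (dt0 x); have tx := lt0r_neq0 cth.
have e1 : S x * dt x + C x * cr x = w1 x.
  have <- : w1 x * (S x ^+ 2 + C x ^+ 2) = w1 x by rewrite S2C2 mulr1.
  by rewrite /dt /cr; ring.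
have e2 : C x * dt x - S x * cr x = w2 x.
  have <- : w2 x * (S x ^+ 2 + C x ^+ 2) = w2 x by rewrite S2C2 mulr1.
  by rewrite /dt /cr; ring.
have f1 : dt x / cos th * sin (x / 2 + th) = w1 x.
  by rewrite sinD sth -e1; field; rewrite dx tx.
have f2 : dt x / cos th * cos (x / 2 + th) = w2 x.
  by rewrite cosD sth -e2; field; rewrite dx tx.
rewrite sinD [cos (_ + u)]cosD -/p -/q.
have g1 : dt x / cos th * (sin (x / 2 + th) * p + cos (x / 2 + th) * q) = w1 x * p + w2 x * q.
  by rewrite -f1 -f2; ring.
have g2 : dt x / cos th * (cos (x / 2 + th) * p - sin (x / 2 + th) * q) = w2 x * p - w1 x * q.
  by rewrite -f1 -f2; ring.
have hS : B * S x = (q * a + p * c) * S x by rewrite BE.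
rewrite g1 g2 /w1 /w2 hS; split.
  have <- : (p ^+ 2 + q ^+ 2) * (a * S x + b * C x) = a * S x + b * C x by rewrite pq mul1r.
  by rewrite /A /B /D; ring.
have <- : (p ^+ 2 + q ^+ 2) * (c * S x + d * C x) = c * S x + d * C x by rewrite pq mul1r.
by rewrite /A /B /D; ring.
Qed.

End translation.

(** * Displacement of hyperbolic, elliptic and parabolic elements *)

Section conjugacy_types.
Context {R : realType}.
Implicit Types (f F : R -> R) (x y a b c d t : R) (g h k : PSL2 R).

Notation S x := (sin (x / 2)).
Notation C x := (cos (x / 2)).

Lemma mx22_tr a b c d : \tr (mx22 a b c d) = a + d :> R.
Proof. by rewrite /mxtrace !big_ord_recl big_ord0 !mxE /= addr0. Qed.

Lemma matrix_of_tr g a b c d : matrix_of g a b c d -> `|\tr (psl2_mx g)| = `|a + d|.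
Proof. by case=> ->; rewrite ?raddfN ?normrN /= mx22_tr. Qed.

(** The determinant of the image of a direction and of this direction; its
    zeros are the fixed directions. *)
Definition displacement_form a b c d x :=
  b * C x ^+ 2 + (a - d) * (S x * C x) - c * S x ^+ 2.

Lemma lifts_displacement a b c d f l x : lifts a b c d f l ->
  l x * sin ((f x - x) / 2) = displacement_form a b c d x.
Proof.
move=> [_ /(_ x)[_ e1 e2]]; rewrite mulrBl sinB.
transitivity ((l x * S (f x)) * C x - (l x * C (f x)) * S x); first by ring.
by rewrite -e1 -e2 /displacement_form; ring.
Qed.

Lemma displacement_formE a b c d x : displacement_form a b c d x =
  (b - c) / 2 + (b + c) / 2 * cos x + (a - d) / 2 * sin x.
Proof.
have e : x = x / 2 + x / 2 by field.
have -> : cos x = C x ^+ 2 - S x ^+ 2 by rewrite {1}e cosD -!expr2.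
have -> : sin x = 2 * (S x * C x) by rewrite {1}e sinD; ring.
have <- : (C x ^+ 2 + S x ^+ 2) * ((b - c) / 2) = (b - c) / 2 by rewrite cos2Dsin2 mul1r.
by rewrite /displacement_form; field.
Qed.

(** The form is a sinusoid of mean (b - c) / 2 and amplitude r / 2, with r ^ 2
    = (b - c) ^ 2 + (a + d) ^ 2 - 4. *)
Lemma displacement_form_signs a b c d : a * d - b * c = 1 -> 2 <= `|a + d| ->
  exists x y, [/\ 0 <= displacement_form a b c d x, displacement_form a b c d y <= 0 &
  2 < `|a + d| -> 0 < displacement_form a b c d x /\ displacement_form a b c d y < 0].
Proof.
move=> abcd tr.
pose r := Num.sqrt ((b + c) ^+ 2 + (a - d) ^+ 2).
have r2 : r ^+ 2 = (b + c) ^+ 2 + (a - d) ^+ 2 by rewrite sqr_sqrtr// addr_ge0// sqr_ge0.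
have r0 : 0 <= r by exact: sqrtr_ge0.
have e : r ^+ 2 = (a + d) ^+ 2 - 4 + (b - c) ^+ 2.
  have -> : (4 : R) = 4 * (a * d - b * c) by rewrite abcd mulr1.
  by rewrite r2; ring.
have tr2 : `|a + d| ^+ 2 = (a + d) ^+ 2 by rewrite real_normK ?num_real.
have bcr : `|b - c| <= r.
  rewrite -ler_sqr ?nnegrE// real_normK ?num_real// e lerDr subr_ge0 -tr2.
  by rewrite (_ : 4 = 2 ^+ 2) ?ler_sqr ?nnegrE//; ring.
have bcr' : 2 < `|a + d| -> `|b - c| < r.
  move=> tr'; rewrite -ltr_sqr ?nnegrE// real_normK ?num_real// e ltrDr subr_gt0 -tr2.
  by rewrite (_ : 4 = 2 ^+ 2) ?ltr_sqr ?nnegrE//; ring.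
have [u [cu su]] : exists u, r * cos u = b + c /\ r * sin u = a - d.
  have [r00|r00] := eqVneq r 0.
    exists 0; rewrite r00 !mul0r; move: r2; rewrite r00 expr0n => /esym/eqP.
    by rewrite paddr_eq0 ?sqr_ge0// !sqrf_eq0 => /andP[/eqP -> /eqP ->].
  have [|u [cu su]] := @angle_exists R ((b + c) / r) ((a - d) / r).
    by rewrite !expr_div_n -mulrDl -r2 divff// expf_eq0.
  by exists u; rewrite cu su ![r * _]mulrC !divfK.
have fu : displacement_form a b c d u = (b - c) / 2 + r / 2.
  rewrite displacement_formE -cu -su.
  have -> : r / 2 = (cos u ^+ 2 + sin u ^+ 2) * (r / 2) by rewrite cos2Dsin2 mul1r.
  by field.
have fv : displacement_form a b c d (u + pi) = (b - c) / 2 - r / 2.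
  rewrite displacement_formE cosDpi sinDpi -cu -su.
  have -> : r / 2 = (cos u ^+ 2 + sin u ^+ 2) * (r / 2) by rewrite cos2Dsin2 mul1r.
  by field.
exists u, (u + pi); rewrite fu fv.
move: bcr; rewrite ler_norml => /andP[h1 h2]; split; [lra|lra|].
by move=> /bcr'; rewrite ltr_norml => /andP[h3 h4]; split; lra.
Qed.

Lemma continuous_displacement a b c d : continuous (displacement_form a b c d).
Proof.
have cid : continuous (fun x : R => x) by move=> x; exact: cvg_id.
have cS := continuous_S cid; have cC := continuous_C cid.
have -> : displacement_form a b c d = fun x =>
    b * (C x * C x) + (a - d) * (S x * C x) - c * (S x * S x).
  by apply/funext => x; rewrite /displacement_form !expr2.
move=> x; apply: cvgB; first apply: cvgD.
- by apply: cvgM; [exact: cvg_cst|apply: cvgM; exact: cC].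
- by apply: cvgM; [exact: cvg_cst|apply: cvgM; [exact: cS|exact: cC]].
- by apply: cvgM; [exact: cvg_cst|apply: cvgM; exact: cS].
Qed.

Lemma lift_fixes_direction f g : lies_over f g -> 2 <= `|\tr (psl2_mx g)| ->
  exists x0 (m : int), f x0 = x0 + 2 * pi * m%:~R.
Proof.
move=> fg; have [a [b [c [d [l [abcd ge fl]]]]]] := lifts_exists fg.
rewrite (matrix_of_tr ge) => tr.
have [x [y [x0 y0 _]]] := displacement_form_signs abcd tr.
have [|z _ z0] := @ivt R _ y x 0 (@continuous_displacement a b c d).
  by rewrite x0 y0.
have /eqP := lifts_displacement z fl; rewrite z0 mulf_eq0.
have [/lt0r_neq0/negbTE -> _ _ /=] := fl.2 z => /eqP/sin_eq0[m e].
by exists z, m; lra.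
Qed.

Lemma normalized_lift f g x0 (m : int) : lies_over f g -> f x0 = x0 + 2 * pi * m%:~R ->
  exists2 f0, lies_over f0 g & f0 x0 = x0 /\ forall x, f x = f0 x + 2 * pi * m%:~R.
Proof.
move=> fg e; exists (fun x => f x + 2 * pi * (- m)%:~R).
  exact: lies_over_shift.
by rewrite e mulrNz; split=> [|x]; ring.
Qed.

(** After subtraction of a multiple of 2 pi the lift has a fixed point, hence
    moves every point by less than a full turn; its displacement then has the
    sign of the displacement form, which takes both signs. *)
Lemma hyperbolic_displacement f g : lies_over f g -> hyperbolic g ->
  exists m : int, (exists x, x + 2 * pi * m%:~R < f x) /\
                  (exists x, f x < x + 2 * pi * m%:~R).
Proof.
move=> fg hg; have [x0 [m e]] := lift_fixes_direction fg (ltW hg).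
have [f0 fg0 [f00 ff0]] := normalized_lift fg e; exists m.
have [a [b [c [d [l [abcd ge fl]]]]]] := lifts_exists fg0.
have tr : 2 < `|a + d| by rewrite -(matrix_of_tr ge).
have [x [y [_ _ /(_ tr)[qx qy]]]] := displacement_form_signs abcd (ltW tr).
have osc z := equivariant_osc z x0 (lift_equivariant fg0).
split; [exists x|exists y]; rewrite ff0.
  rewrite ltrD2r ltNge; apply/negP => h.
  move: qx; rewrite -(lifts_displacement x fl) pmulr_rgt0; last by have [] := fl.2 x.
  rewrite ltNge -oppr_ge0 -sinN; case/negP; apply: sin_ge0_pi.
  by have := osc x; rewrite f00; lra.
rewrite ltrD2r ltNge; apply/negP => h.
move: qy; rewrite -(lifts_displacement y fl) pmulr_rlt0; last by have [] := fl.2 y.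
rewrite ltNge; case/negP; apply: sin_ge0_pi.
by have := osc y; rewrite f00; lra.
Qed.

Lemma turnS_int (m : int) : 2 * pi * (m + 1)%:~R = 2 * pi * m%:~R + 2 * pi :> R.
Proof. by rewrite intrD; ring. Qed.

Lemma translation_number_fixed f g x0 (m : int) : lies_over f g ->
  f x0 = x0 + 2 * pi * m%:~R ->
  translation_number f = 2 * pi * m%:~R /\ forall x, f x <= x + 2 * pi * (m + 1)%:~R.
Proof.
move=> fg e; have fe := lift_equivariant fg; split; last first.
  by move=> x; have := equivariant_osc x x0 fe; rewrite e turnS_int; lra.
apply: (@translation_number_bounded _ _ _ (2 * pi)) => k.
have ek : iter k f x0 = x0 + 2 * pi * (m * k%:Z)%:~R.
  elim: k => [|k IHk]; first by rewrite mulr0 mulr0 addr0.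
  by rewrite iterS IHk fe.2 e !intrM -!pmulrn; ring.
have := equivariant_osc 0 x0 (iter_equivariant k fe).
rewrite ek subr0 intrM => /andP[h1 h2]; rewrite ler_norml.
have e2 : (k%:Z)%:~R = k%:R :> R by [].
by apply/andP; split; move: h1 h2; rewrite e2; lra.
Qed.

(** A lift psi of the conjugating element satisfies psi (f x) = psi x + t + 2
    pi m. *)
Lemma translation_number_elliptic f g t : lies_over f g -> 0 < t < 2 * pi ->
  conjugate g (rotation t) -> exists m : int, translation_number f = t + 2 * pi * m%:~R /\
    forall x, f x <= x + 2 * pi * (m + 1)%:~R.
Proof.
move=> fg t0 [k gk]; have [psi pk] := lift_existence k.
have h1 : lies_over (psi \o f) (rotation t * k)%g.
  have -> : (rotation t * k = k * g)%g by rewrite gk conjgE mulVKg.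
  exact: lies_over_comp.
have h2 : lies_over (fun x => psi x + t) (rotation t * k)%g.
  exact: (lies_over_comp (lies_over_rotation t) pk).
have [m em] := lies_over_unique h1 h2; exists m.
have pe := lift_equivariant pk; split; last first.
  move=> x; rewrite leNgt; apply/negP => /pe.1.
  rewrite pe.2 [psi (f x)]em turnS_int.
  rewrite ltNge; case/negP; lra.
apply: (@translation_number_bounded _ _ _ (2 * pi)) => j.
have ej : psi (iter j f 0) = psi 0 + j%:R * (t + 2 * pi * m%:~R).
  elim: j => [|j IHj]; first by rewrite mul0r addr0.
  by rewrite iterS [psi _]em IHj -natr1; ring.
have := equivariant_osc (iter j f 0) 0 pe; rewrite ej => /andP[h3 h4].
by rewrite ler_norml; apply/andP; split; lra.
Qed.

Lemma conjugate_of_matrix g a b c d p q r s (M : SL2 R) : matrix_of g a b c d ->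
  p * s - q * r = 1 -> mx22 p q r s *m mx22 a b c d = val M *m mx22 p q r s ->
  conjugate g (\pi_(PSL2 R) M).
Proof.
move=> ge dK eK.
have dK' : \det (mx22 p q r s) == 1 by rewrite det_mx22E dK.
pose K : PSL2 R := \pi_(PSL2 R) (Sl2 dK').
exists K; rewrite conjgE; apply: (mulgI K); rewrite mulVKg.
have eg : g = \pi_(PSL2 R) (repr g) by rewrite reprK.
rewrite eg -[LHS]/(psl2_mul _ _) -[RHS]/(psl2_mul _ _) !psl2_mulE; apply/psl2P => /=.
rewrite -[sl2_val (repr g)]/(psl2_mx g).
by case: ge => ->; [left|right]; rewrite ?mulmxN eK.
Qed.

Lemma mx22M a b c d a' b' c' d' : mx22 a b c d *m mx22 a' b' c' d' =
  mx22 (a * a' + b * c') (a * b' + b * d') (c * a' + d * c') (c * b' + d * d') :> 'M[R]_2.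
Proof.
apply/matrixP => i j; rewrite !mxE !big_ord_recl big_ord0 !mxE /= addr0.
by case: (i == 0); case: (j == 0).
Qed.

Lemma matrix_ofN g a b c d : matrix_of g a b c d -> matrix_of g (- a) (- b) (- c) (- d).
Proof.
have e : mx22 (- a) (- b) (- c) (- d) = - mx22 a b c d.
  by apply/matrixP => i j; rewrite !mxE; do 2!case: ifP.
by case=> ge; rewrite /matrix_of e ?opprK; [right|left].
Qed.

(** The matrix (p, 0; p e / s, p b / s) sends the fixed point of g to i. The
    sign of the matrix of g is chosen so that b > 0, as p ^ 2 = s / b
    requires. *)
Lemma elliptic_rotation g : elliptic g ->
  exists t, 0 < t < 2 * pi /\ conjugate g (rotation t).
Proof.
move=> eg.
have [a [b [c [d [abcd b0 ge]]]]] : exists a b c d,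
    [/\ a * d - b * c = 1, 0 < b & matrix_of g a b c d].
  have [a [b [c [d ge]]]] : exists a b c d, psl2_mx g = mx22 a b c d.
    by do 4!eexists; exact: mx22_eta.
  have := sl2_det (repr g); rewrite -[sl2_val _]/(psl2_mx g) ge det_mx22E => /eqP abcd.
  move: eg; rewrite /elliptic ge mx22_tr => tr.
  have b0 : b != 0.
    apply/eqP => b0; move: tr; apply/negP; rewrite -leNgt.
    rewrite -ler_sqr ?nnegrE// real_normK ?num_real//.
    have -> : (2 : R) ^+ 2 = 4 * (a * d - b * c) by rewrite abcd; ring.
    by rewrite b0 -subr_ge0 (_ : _ - _ = (a - d) ^+ 2) ?sqr_ge0//; ring.
  have ge' : matrix_of g a b c d by left.
  have [b1|b1] := ltP 0 b; first by exists a, b, c, d.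
  exists (- a), (- b), (- c), (- d); split.
  - by rewrite !mulrNN.
  - by rewrite oppr_gt0 lt_neqAle b0.
  - exact: matrix_ofN.
have tr : `|a + d| < 2 by rewrite -(matrix_of_tr ge).
have [t1 t2] : -1 < (a + d) / 2 /\ (a + d) / 2 < 1.
  by move: tr; rewrite ltr_norml => /andP[? ?]; split; lra.
have t12 : -1 <= (a + d) / 2 <= 1 by rewrite !ltW.
pose u := acos ((a + d) / 2).
have u0 : 0 < u < pi by rewrite acos_gt0 ?acos_ltpi ?(ltW t1) ?(ltW t2)// ?t1 ?t2.
have cu : cos u = (a + d) / 2 by rewrite acosK// in_itv.
pose s := sin u; have s0 : 0 < s by exact: sin_gt0_pi.
have s2 : s ^+ 2 = 1 - ((a + d) / 2) ^+ 2 by rewrite /s sin2cos2 cu.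
exists (2 * u); split; first by lra.
pose p := Num.sqrt (s / b).
have p2 : p ^+ 2 = s / b by rewrite sqr_sqrtr// ltW// divr_gt0.
pose e := (a - d) / 2.
have u2 : 2 * u / 2 = u by rewrite mulrAC divff ?pnatr_eq0// mul1r.
have e2 : e ^+ 2 + b * c = - s ^+ 2.
  by rewrite s2 /e (_ : b * c = a * d - 1); [field|lra].
have sn := lt0r_neq0 s0; have bn := lt0r_neq0 b0.
apply: (@conjugate_of_matrix _ a b c d p 0 (p * e / s) (p * b / s)) => //.
  rewrite mul0r subr0; transitivity (p ^+ 2 * b / s); first by ring.
  by rewrite p2 divfK// divff.
rewrite [val _]/= u2 !mx22M -/s cu; congr mx22.
- by rewrite /e; field.
- by field.
- have -> : p * e / s * a + p * b / s * c = p * (e ^+ 2 + b * c + e * ((a + d) / 2)) / s.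
    by rewrite /e; field.
  by rewrite e2; field.
- by rewrite /e; field.
Qed.

(** For a matrix of trace 2 the displacement form is a perfect square up to
    sign, and the assumption says that it takes a positive value; a vector at
    which its value is 1 provides the conjugating matrix. *)
Lemma parabolic_shift g a b c d : a * d - b * c = 1 -> a + d = 2 ->
  matrix_of g a b c d -> 0 < b \/ c < 0 -> positive_parabolic g.
Proof.
move=> abcd tr ge bc.
have da : d = 2 - a by rewrite -tr; ring.
pose e := a - 1.
have e2 : e ^+ 2 = - (b * c).
  rewrite /e (_ : b * c = a * d - 1); last by lra.
  by rewrite da; ring.
have [p [q pq]] : exists p q, b * p ^+ 2 - 2 * e * p * q - c * q ^+ 2 = 1.
  have [b0|b0] := ltP 0 b.
    exists (Num.sqrt b)^-1, 0; rewrite exprVn sqr_sqrtr ?ltW//.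
    by rewrite expr0n !mulr0 !subr0 divff// gt_eqF.
  have c0 : c < 0 by case: bc => //; rewrite ltNge b0.
  exists 0, (Num.sqrt (- c))^-1; rewrite exprVn sqr_sqrtr ?oppr_ge0 ?ltW//.
  rewrite expr0n !mulr0 mul0r subr0 sub0r.
  by rewrite invrN mulrN opprK divff// lt_eqF.
have a1 : a = 1 + e by rewrite /e; ring.
have d1 : d = 1 - e by rewrite da /e; ring.
apply: (@conjugate_of_matrix _ a b c d p q (p * e + q * c) (p * b - q * e)) => //.
  by apply: etrans _ pq; ring.
rewrite [val _]/= !mx22M a1 d1; congr mx22.
- by ring.
- by ring.
- have : p * (e ^+ 2 + b * c) = 0 by rewrite e2 addNr mulr0.
  by move=> h; transitivity (p * e + q * c + p * (e ^+ 2 + b * c)); [ring|rewrite h; ring].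
- have : q * (e ^+ 2 + b * c) = 0 by rewrite e2 addNr mulr0.
  by move=> h; transitivity (p * b - q * e + q * (e ^+ 2 + b * c)); [ring|rewrite h; ring].
Qed.

Lemma positive_parabolic_tr g : positive_parabolic g -> `|\tr (psl2_mx g)| = 2.
Proof.
move=> [k ->]; rewrite conjgE.
have nrm M N : M = N \/ M = - N -> `|\tr (M : 'M[R]_2)| = `|\tr N|.
  by case=> ->; rewrite ?raddfN ?normrN /=.
rewrite (nrm _ _ (psl2_mxM _ _)) mxtrace_mulC -(nrm _ _ (psl2_mxM _ _)).
rewrite -mulgA mulgV mulg1 (nrm _ _ (psl2_mx_pi _)) [val _]/= mx22_tr.
by rewrite ger0_norm// addr_ge0.
Qed.

(** A hyperbolic or positive parabolic element has a fixed direction,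
    displaced by 2 pi m, and an elliptic element has translation number t + 2
    pi m; as displacements differ by less than 2 pi, A = m + 1. In the
    remaining cases theta is 2 pi and A = m has to be reached: the lift that
    has a fixed point moves no point forward, because the displacement form
    takes no positive value, the element being no positive parabolic. *)
Theorem peripheral_displacement f g : lies_over f g -> exists A : int,
  2 * pi * A%:~R = 2 * pi + translation_number f - theta g /\
  forall x, f x <= x + 2 * pi * A%:~R.
Proof.
move=> fg; rewrite /theta; case: asboolP => [hp|nhp].
  have tr : 2 <= `|\tr (psl2_mx g)|.
    by case: hp => [/ltW//|/positive_parabolic_tr ->].
  have [x0 [m e]] := lift_fixes_direction fg tr.
  have [T fx] := translation_number_fixed fg e.
  by exists (m + 1); split => //; rewrite T turnS_int; ring.
case: ifPn => [eg|neg].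
  have [ta cg] : (0 < rotation_angle g < 2 * pi) /\ conjugate g (rotation (rotation_angle g)).
    rewrite /rotation_angle; apply: (@xgetPex _ 0 [set t | 0 < t < 2 * pi /\ conjugate g (rotation t)]).
    exact: elliptic_rotation.
  have [m [T fx]] := translation_number_elliptic fg ta cg.
  by exists (m + 1); split => //; rewrite T turnS_int; ring.
have nh : ~ hyperbolic g by move=> h; apply: nhp; left.
have np : ~ positive_parabolic g by move=> h; apply: nhp; right.
have tr : `|\tr (psl2_mx g)| = 2.
  apply/eqP; rewrite eq_le; apply/andP; split.
    by rewrite leNgt; apply/negP.
  by rewrite leNgt.
have [|x0 [m e]] := lift_fixes_direction fg; first by rewrite tr.
have [T _] := translation_number_fixed fg e.
exists m; rewrite T; split; first by ring.
have [f0 fg0 [f00 ff0]] := normalized_lift fg e.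
have [a [b [c [d [l [abcd ge fl]]]]]] := lifts_exists fg0.
(* the fixed direction is an eigenvector for the eigenvalue l x0 > 0, which excludes the trace -2 *)
have tr2 : a + d = 2.
  have := matrix_of_tr ge; rewrite tr => /esym/eqP; rewrite eqr_norml => /andP[/orP[/eqP//|/eqP h] _].
  exfalso; have [l0 e1 e2] := fl.2 x0; rewrite f00 in e1 e2.
  have k1 : ((a - l x0) * (d - l x0) - b * c) * S x0 = 0.
    transitivity ((d - l x0) * (a * S x0 + b * C x0 - l x0 * S x0) - b * (c * S x0 + d * C x0 - l x0 * C x0)).
      by ring.
    by rewrite e1 e2; ring.
  have k2 : ((a - l x0) * (d - l x0) - b * c) * C x0 = 0.
    transitivity ((a - l x0) * (c * S x0 + d * C x0 - l x0 * C x0) - c * (a * S x0 + b * C x0 - l x0 * S x0)).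
      by ring.
    by rewrite e1 e2; ring.
  have : (a - l x0) * (d - l x0) - b * c = 0.
    rewrite -[LHS]mulr1 -(S2C2 x0) mulrDr !expr2 !mulrA k1 k2; ring.
  have -> : (a - l x0) * (d - l x0) - b * c = a * d - b * c - (a + d) * l x0 + l x0 ^+ 2 by ring.
  by rewrite abcd h => h'; have := sqr_ge0 (l x0); lra.
have bc : b <= 0 /\ 0 <= c.
  by split; rewrite leNgt; apply/negP => h; apply: np; apply: parabolic_shift abcd tr2 ge _; [left|right].
move=> x; rewrite ff0 lerD2r leNgt; apply/negP => h.
have osc := equivariant_osc x x0 (lift_equivariant fg0).
have : 0 < displacement_form a b c d x.
  rewrite -(lifts_displacement x fl) mulr_gt0//; first by have [] := fl.2 x.
  by apply: sin_gt0_pi; move: osc; rewrite f00; lra.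
case: bc => b0 c0; rewrite ltNge; case/negP.
have da : d = 2 - a by rewrite -tr2; ring.
have e2 : (a - 1) ^+ 2 = - b * c.
  rewrite mulNr (_ : b * c = a * d - 1); last by lra.
  by rewrite da; ring.
rewrite /displacement_form da (_ : a - (2 - a) = 2 * (a - 1)); last by ring.
have [b1|b1] := eqVneq b 0.
  have : (a - 1) ^+ 2 = 0 by rewrite e2 b1 oppr0 mul0r.
  move/eqP; rewrite sqrf_eq0 => /eqP ->; rewrite b1 mulr0 !mul0r add0r sub0r oppr_le0.
  by rewrite mulr_ge0// sqr_ge0.
have bn : b < 0 by rewrite lt_neqAle b1.
rewrite -(ler_nM2l bn) mulr0.
have -> : b * (b * C x ^+ 2 + 2 * (a - 1) * (S x * C x) - c * S x ^+ 2) =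
  (b * C x + (a - 1) * S x) ^+ 2 - ((a - 1) ^+ 2 + b * c) * S x ^+ 2 by ring.
by rewrite e2 mulNr addNr mul0r subr0 sqr_ge0.
Qed.

End conjugacy_types.

(** * Homotopies of paths *)

Section path_homotopy.
Context {R : realType} {X : topologicalType}.
Implicit Types (f g h : R -> X) (x y z : X) (H : R * R -> X).

Definition is_path f := {within unit_itv, continuous f}.
Definition square : set (R * R) := unit_itv `*` unit_itv.
Definition path_homotopic y z f g :=
  homotopic_through [set h | h 0 = y /\ h 1 = z] f g.

Lemma unit0 : unit_itv (0 : R). Proof. by rewrite unit_itvE lexx ler01. Qed.
Lemma unit1 : unit_itv (1 : R). Proof. by rewrite unit_itvE lexx ler01. Qed.

Lemma convex_comb_unit (s u v : R) : unit_itv s -> unit_itv u -> unit_itv v ->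
  unit_itv ((1 - s) * u + s * v).
Proof.
rewrite !unit_itvE => /andP[s0 s1] /andP[u0 u1] /andP[v0 v1].
have s0' : 0 <= 1 - s by rewrite subr_ge0.
have h1 := mulr_ge0 s0' u0; have h2 := mulr_ge0 s0 v0.
have h3 : (1 - s) * u <= (1 - s) * 1 by rewrite ler_wpM2l.
have h4 : s * v <= s * 1 by rewrite ler_wpM2l.
by apply/andP; split; lra.
Qed.

(** The two paths of the square are joined by the straight homotopy. *)
Lemma homotopic_in_square H (a1 a2 b1 b2 : R -> R) f g :
  {within square, continuous H} ->
  continuous a1 -> continuous a2 -> continuous b1 -> continuous b2 ->
  (forall t, unit_itv t -> [/\ unit_itv (a1 t), unit_itv (a2 t), unit_itv (b1 t) & unit_itv (b2 t)]) ->
  [/\ a1 0 = b1 0, a2 0 = b2 0, a1 1 = b1 1 & a2 1 = b2 1] ->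
  (forall t, unit_itv t -> f t = H (a1 t, a2 t) /\ g t = H (b1 t, b2 t)) ->
  path_homotopic (f 0) (f 1) f g.
Proof.
move=> cH ca1 ca2 cb1 cb2 I [e1 e2 e3 e4] fg.
pose P := fun st : R * R => ((1 - st.1) * a1 st.2 + st.1 * b1 st.2,
  (1 - st.1) * a2 st.2 + st.1 * b2 st.2).
have cP (u v : R -> R) : continuous u -> continuous v ->
    continuous (fun st : R * R => (1 - st.1) * u st.2 + st.1 * v st.2).
  move=> cu cv st; apply: cvgD; apply: cvgM.
  - by apply: cvgB; [exact: cvg_cst|exact: cvg_fst].
  - by apply: (@continuous_comp _ _ _ snd u); [exact: cvg_snd|exact: cu].
  - exact: cvg_fst.
  - by apply: (@continuous_comp _ _ _ snd v); [exact: cvg_snd|exact: cv].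
exists (H \o P); split.
- apply: within_comp cH.
    apply: continuous_subspaceT => st.
    by apply: (@cvg_pair _ _ _ (nbhs st) (nbhs _) (nbhs _)); apply: cP.
  move=> [s t] [/= Is It]; have [? ? ? ?] := I t It.
  by split; apply: convex_comb_unit.
- move=> t It; have [-> ->] := fg t It.
  by rewrite /P /= !subr0 !subrr !mul0r !mul1r !addr0 !add0r.
- move=> s Is; have [-> _] := fg 0 unit0; have [-> _] := fg 1 unit1.
  by rewrite /= /P /= -e1 -e2 -e3 -e4 -!mulrDl !subrK !mul1r.
Qed.

Lemma homotopic_reparam h (a b : R -> R) f g : is_path h ->
  continuous a -> continuous b ->
  (forall t, unit_itv t -> unit_itv (a t) /\ unit_itv (b t)) ->
  a 0 = b 0 -> a 1 = b 1 ->
  (forall t, unit_itv t -> f t = h (a t) /\ g t = h (b t)) ->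
  path_homotopic (f 0) (f 1) f g.
Proof.
move=> ch ca cb I e0 e1 fg.
have c0 : continuous (fun _ : R => 0 : R) by move=> ?; exact: cvg_cst.
apply: (@homotopic_in_square (h \o fst) a (fun=> 0) b (fun=> 0)) => //.
- apply: (@within_comp _ _ _ _ _ fst h) ch.
    by apply: continuous_subspaceT => ?; exact: cvg_fst.
  by move=> [s t] [].
- by move=> t /I[? ?]; split => //; exact: unit0.
Qed.

Lemma path_reparam h (a : R -> R) : is_path h -> continuous a ->
  (forall t, unit_itv t -> unit_itv (a t)) -> is_path (h \o a).
Proof.
by move=> ch ca I; apply: within_comp ch => //; exact: continuous_subspaceT.
Qed.

Lemma path_ext f g : is_path f -> (forall t, unit_itv t -> f t = g t) -> is_path g.
Proof.
move=> cf fg; apply: subspace_eq_continuous cf => t /set_mem It.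
by rewrite /from_subspace fg.
Qed.

Lemma path_homotopic_ext f g : is_path f -> (forall t, unit_itv t -> f t = g t) ->
  path_homotopic (f 0) (f 1) f g.
Proof.
move=> cf fg; have cid : continuous (fun t : R => t) by move=> ?; exact: cvg_id.
by apply: (@homotopic_reparam f id id) => // t It; split => //; rewrite fg.
Qed.

Lemma path_homotopic_concat x y z f f' g g' :
  path_homotopic x y f f' -> path_homotopic y z g g' ->
  path_homotopic x z (concat f g) (concat f' g').
Proof.
move=> [H [cH Hf HP]] [K [cK Kg KP]].
pose L := fun st : R * R => concat (fun t => H (st.1, t)) (fun t => K (st.1, t)) st.2.
have half : (1 <= 2^-1 :> R) = false by apply/negbTE; rewrite -ltNge; lra.
exists L; split.
- apply: (@within_paste _ _ [set st : R * R | st.2 <= 2^-1] [set st | 2^-1 <= st.2] _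
    (H \o (fun st => (st.1, 2 * st.2 + 0))) (K \o (fun st => (st.1, 2 * st.2 + -1)))).
  + exact: closed_snd_le.
  + exact: closed_snd_ge.
  + by move=> [s t] _ /=; case: (leP t 2^-1) => ?; [left|right; exact: ltW].
  + apply: within_comp cH.
      by apply: continuous_subspaceT; exact: continuous_snd_affine.
    by move=> [s t] [/= ? []] /=; rewrite !unit_itvE => ? ?; split => /=; lra.
  + apply: within_comp cK.
      by apply: continuous_subspaceT; exact: continuous_snd_affine.
    by move=> [s t] [/= ? []] /=; rewrite !unit_itvE => ? ?; split => /=; lra.
  + exact: closed_square.
  + by move=> [s t] /= t2 _; rewrite /L /concat /= t2 addr0.
  + move=> [s t] /= t2 [/= Is _]; rewrite /L /concat /=; case: ifPn => // t2'.
    have -> : t = 2^-1 by apply/le_anti/andP.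
    by rewrite divff ?pnatr_eq0// subrr (HP s Is).2 (KP s Is).1.
- move=> t; rewrite unit_itvE => It; rewrite /L /concat /=; case: (leP t 2^-1) => ?.
    by apply: Hf; rewrite unit_itvE; lra.
  by apply: Kg; rewrite unit_itvE; lra.
- move=> s Is; rewrite /= /L /concat /= mulr0 invr_ge0 ler0n half (HP s Is).1.
  by rewrite (_ : 2 * 1 - 1 = 1) ?(KP s Is).2//; ring.
Qed.

Lemma concat0 f g : concat f g 0 = f 0.
Proof. by rewrite /concat invr_ge0 ler0n mulr0. Qed.

Lemma concat1 f g : concat f g 1 = g 1.
Proof.
rewrite /concat ifF; last by apply/negbTE; rewrite -ltNge; lra.
by congr g; ring.
Qed.

Lemma reverse0 f : reverse f 0 = f 1. Proof. by rewrite /reverse subr0. Qed.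
Lemma reverse1 f : reverse f 1 = f 0. Proof. by rewrite /reverse subrr. Qed.

Lemma continuous_maxf (phi psi : R -> R) : continuous phi -> continuous psi ->
  continuous (fun t => Num.max (phi t) (psi t)).
Proof. by move=> c1 c2 t; apply: (@continuous_max _ _ phi psi); [exact: c1|exact: c2]. Qed.

Lemma continuous_minf (phi psi : R -> R) : continuous phi -> continuous psi ->
  continuous (fun t => Num.min (phi t) (psi t)).
Proof. by move=> c1 c2 t; apply: (@continuous_min _ _ phi psi); [exact: c1|exact: c2]. Qed.

Lemma continuous_min_affine (a b c d : R) :
  continuous (fun t : R => Num.min (a * t + b) (c * t + d)).
Proof. by apply: continuous_minf; exact: continuous_affine. Qed.

Lemma path_homotopicA f g h : is_path f -> is_path g -> is_path h ->
  f 1 = g 0 -> g 1 = h 0 ->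
  path_homotopic (f 0) (h 1) (concat (concat f g) h) (concat f (concat g h)).
Proof.
move=> cf cg ch fg gh.
have cF : is_path (concat f (concat g h)).
  by apply: continuous_concat; rewrite ?concat0//; exact: continuous_concat.
pose phi t : R := Num.min (Num.min (2 * t + 0) (1 * t + 4^-1)) (2^-1 * t + 2^-1).
have cphi : continuous phi.
  by apply: continuous_minf; [exact: continuous_min_affine|exact: continuous_affine].
have phi1 t : t <= 4^-1 -> phi t = 2 * t.
  by move=> ?; rewrite /phi min_l addr0 ?min_l//; lra.
have phi2 t : 4^-1 <= t <= 2^-1 -> phi t = t + 4^-1.
  by move=> ?; rewrite /phi mul1r [Num.min (_ + _) (_ + _)]min_r ?min_l//; lra.
have phi3 t : 2^-1 <= t -> phi t = (t + 1) / 2.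
  by move=> ?; rewrite /phi [Num.min (2 * _ + _) _]min_r ?min_r//; lra.
have := @homotopic_reparam (concat f (concat g h)) phi id
  (concat (concat f g) h) (concat f (concat g h)) cF cphi.
rewrite !concat0 !concat1; apply.
- by move=> ?; exact: cvg_id.
- move=> t It; split => //; move: It; rewrite !unit_itvE => It.
  have [t1|t1] := leP t 4^-1; first by rewrite phi1//; lra.
  have [t2|t2] := leP t 2^-1; first by rewrite phi2; lra.
  by rewrite phi3; lra.
- by rewrite phi1; lra.
- by rewrite phi3; lra.
- move=> t; rewrite unit_itvE => It; split => //.
  rewrite {1 2}/concat [in RHS]/concat.
  have [t1|t1] := leP t 4^-1.
    rewrite phi1// !ifT; [by []|lra..].
  have [t2|t2] := leP t 2^-1.
    rewrite phi2; last by lra.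
    rewrite ifF; last by apply/negbTE; rewrite -ltNge; lra.
    rewrite ifF; last by apply/negbTE; rewrite -ltNge; lra.
    by rewrite ifT; [congr g; field|lra].
  rewrite phi3; last by lra.
  rewrite ifF; last by apply/negbTE; rewrite -ltNge; lra.
  rewrite ifF; last by apply/negbTE; rewrite -ltNge; lra.
  by congr h; field.
Qed.

Lemma path_homotopic_reverse f : is_path f ->
  path_homotopic (f 0) (f 0) (concat f (reverse f)) (fun=> f 0).
Proof.
move=> cf.
have := @homotopic_reparam f (fun t => Num.min (2 * t + 0) (- 2 * t + 2)) (fun=> 0)
  (concat f (reverse f)) (fun=> f 0) cf.
rewrite concat0 concat1 reverse1; apply.
- exact: continuous_min_affine.
- by move=> ?; exact: cvg_cst.
- move=> t; rewrite !unit_itvE => It; split; last by rewrite lexx ler01.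
  by rewrite le_min ge_min; apply/andP; split; [apply/andP; split; lra|have [?|?] := leP t 2^-1; apply/orP; [left|right]; lra].
- by rewrite min_l; lra.
- by rewrite min_r; lra.
- move=> t _; split => //; rewrite /concat; have [t2|t2] := leP t 2^-1.
    by rewrite min_l ?addr0//; lra.
  by rewrite min_r /reverse; [congr f; ring|lra].
Qed.

Lemma path_homotopic_trans y z f g h : path_homotopic y z f g ->
  path_homotopic y z g h -> path_homotopic y z f h.
Proof. exact: homotopic_through_trans. Qed.

Lemma path_homotopic_sym y z f g : path_homotopic y z f g -> path_homotopic y z g f.
Proof. exact: homotopic_through_sym. Qed.

Lemma path_homotopic_refl f : is_path f -> path_homotopic (f 0) (f 1) f f.
Proof. by move=> cf; exact: homotopic_through_refl. Qed.

End path_homotopy.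

(** * Classes of paths in the fundamental group *)

Section holonomy.
Context {R : realType} {X : topologicalType} (x : X).
Implicit Types (f g h : R -> X) (y z : X) (k : pi1 R x).

Definition joined y z := exists f : R -> X, [/\ is_path f, f 0 = y & f 1 = z].

Lemma joined_trans y z w : joined y z -> joined z w -> joined y w.
Proof.
move=> [f [cf f0 f1]] [g [cg g0 g1]]; exists (concat f g).
by rewrite concat0 concat1; split => //; apply: continuous_concat => //; rewrite f1.
Qed.

Lemma joined_sym y z : joined y z -> joined z y.
Proof.
move=> [f [cf f0 f1]]; exists (reverse f); rewrite reverse0 reverse1.
by split => //; exact: continuous_reverse.
Qed.

(** A chosen path to y from the base point. *)
Definition tail y : R -> X :=
  xget (fun=> x) [set f : R -> X | [/\ is_path f, f 0 = x & f 1 = y]].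

Lemma tailP y : joined x y -> [/\ is_path (tail y), tail y 0 = x & tail y 1 = y].
Proof. by move=> [f fP]; exact: (@xgetPex _ (fun=> x) [set f : R -> X | [/\ is_path f, f 0 = x & f 1 = y]] (ex_intro _ f fP)). Qed.

Definition is_loop f := [/\ is_path f, f 0 = x & f 1 = x].

Definition loop_of f : loop R x :=
  if pselect (is_loop f) is left p then
    let: And3 c e0 e1 := p in Loop c e0 e1
  else @loop_cst R X x.

Lemma loop_ofE f : is_loop f -> loop_of f = f :> (R -> X).
Proof. by rewrite /loop_of; case: pselect => //; case. Qed.

Definition class_of f : pi1 R x := \pi_(pi1 R x) (loop_of f).

Lemma class_of_homotopic f g : is_loop f -> is_loop g ->
  path_homotopic x x f g -> class_of f = class_of g.
Proof. by move=> lf lg fg; apply/pi1P; rewrite !loop_ofE. Qed.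

Lemma is_loop_concat f g : is_loop f -> is_loop g -> is_loop (concat f g).
Proof.
move=> [cf f0 f1] [cg g0 g1]; split; rewrite ?concat0 ?concat1//.
by apply: continuous_concat => //; rewrite f1.
Qed.

Lemma class_of_concat f g : is_loop f -> is_loop g ->
  class_of (concat f g) = (class_of f * class_of g)%g.
Proof.
move=> lf lg; rewrite -[RHS]/(pi1_mul _ _) pi1_mulE; apply/pi1P.
rewrite loop_concatE !loop_ofE//; last exact: is_loop_concat.
have [c e0 e1] := is_loop_concat lf lg.
by have := path_homotopic_refl c; rewrite e0 e1.
Qed.

Lemma class_of_loop (a : loop R x) : class_of a = \pi_(pi1 R x) a.
Proof.
have la : is_loop a by split; [exact: loop_continuous|exact: loop_0|exact: loop_1].
apply/pi1P; rewrite loop_ofE//; have [c e0 e1] := la.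
by have := path_homotopic_refl c; rewrite e0 e1.
Qed.

(** Any path has a class, obtained by closing it up with the chosen paths from
    the base point to its ends. Classes are then multiplicative along
    concatenations, and for a closed path the choices matter only up to
    conjugacy. A path outside of the path component of the base point has
    class 1. *)
Definition path_class f : pi1 R x :=
  if pselect (joined x (f 0)) then
    class_of (concat (tail (f 0)) (concat f (reverse (tail (f 1)))))
  else 1%g.

Lemma path_joined f : is_path f -> joined (f 0) (f 1).
Proof. by move=> cf; exists f. Qed.

Lemma is_loop_tails f : is_path f -> joined x (f 0) ->
  is_loop (concat (tail (f 0)) (concat f (reverse (tail (f 1))))).
Proof.
move=> cf j0; have j1 := joined_trans j0 (path_joined cf).
have [c0 e0 e0'] := tailP j0; have [c1 e1 e1'] := tailP j1.
rewrite /is_loop concat0 !concat1 reverse1; split => //.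
apply: continuous_concat; rewrite ?concat0//.
by apply: continuous_concat; rewrite ?reverse0//; exact: continuous_reverse.
Qed.

Lemma path_class_homotopic f g : is_path f -> is_path g ->
  path_homotopic (f 0) (f 1) f g -> path_class f = path_class g.
Proof.
move=> cf cg fg.
have [e0 e1] : g 0 = f 0 /\ g 1 = f 1.
  have [H [_ Hfg HP]] := fg; have [_ <-] := Hfg 0 unit0; have [_ <-] := Hfg 1 unit1.
  exact: HP unit1.
rewrite /path_class e0 e1; case: pselect => // j0.
have lf := is_loop_tails cf j0.
have lg : is_loop (concat (tail (f 0)) (concat g (reverse (tail (f 1))))).
  by have := is_loop_tails cg; rewrite e0 e1; apply.
apply: class_of_homotopic => //.
have j1 := joined_trans j0 (path_joined cf).
have [c0 e0' e0''] := tailP j0; have [c1 e1' e1''] := tailP j1.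
have hr := path_homotopic_refl (continuous_reverse c1).
rewrite reverse0 reverse1 e1' e1'' in hr.
have ht := path_homotopic_refl c0; rewrite e0' e0'' in ht.
exact: path_homotopic_concat ht (path_homotopic_concat fg hr).
Qed.

Lemma path_class_ext f g : is_path f -> (forall t, unit_itv t -> f t = g t) ->
  path_class f = path_class g.
Proof.
move=> cf fg; apply: path_class_homotopic => //; first exact: path_ext fg.
exact: path_homotopic_ext.
Qed.

Lemma path_class_concat f g : is_path f -> is_path g -> f 1 = g 0 ->
  path_class (concat f g) = (path_class f * path_class g)%g.
Proof.
move=> cf cg fg; have cfg := continuous_concat fg cf cg.
have jj : joined x (f 0) <-> joined x (g 0).
  rewrite -fg; split=> j; first exact: joined_trans j (path_joined cf).
  exact: joined_trans j (joined_sym (path_joined cf)).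
rewrite /path_class concat0 concat1; case: pselect => j0; last first.
  by case: pselect => [/jj//|?]; rewrite mulg1.
case: pselect => jg /=; last by case: jg; exact: jj.1.
have j1 := joined_trans jg (path_joined cg).
have lf := is_loop_tails cf j0; have lg := is_loop_tails cg jg.
have lfg : is_loop (concat (tail (f 0)) (concat (concat f g) (reverse (tail (g 1))))).
  by have := is_loop_tails cfg; rewrite concat0 concat1; apply.
rewrite -class_of_concat//; apply: class_of_homotopic => //; first exact: is_loop_concat.
rewrite fg; have [c0 e00 e01] := tailP j0; have [cm em0 em1] := tailP jg; have [c1 e10 e11] := tailP j1.
set A := tail (f 0) in c0 e00 e01 *; set B := tail (g 0) in cm em0 em1 *; set D := tail (g 1) in c1 e10 e11 *.
have crB := continuous_reverse cm; have crD := continuous_reverse c1.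
have cfB : is_path (concat f (reverse B)) by apply: continuous_concat; rewrite ?reverse0 ?em1.
have cgD : is_path (concat g (reverse D)) by apply: continuous_concat; rewrite ?reverse0 ?e11.
have cBgD : is_path (concat B (concat g (reverse D))) by apply: continuous_concat; rewrite ?concat0.
have rf h y : is_path h -> h 1 = y -> path_homotopic (h 0) y h h.
  by move=> ch <-; exact: path_homotopic_refl.
apply: path_homotopic_sym.
(* A (f B^-1) . B (g D^-1) ~ A ((f B^-1) (B (g D^-1))) *)
apply: (@path_homotopic_trans _ _ _ _ _ (concat A (concat (concat f (reverse B)) (concat B (concat g (reverse D)))))).
  have := path_homotopicA c0 cfB cBgD.
  by rewrite !concat0 !concat1 !reverse1 e00 e01 e10 em0; apply.
(* it suffices to treat the factor after A *)
have hA := rf _ _ c0 e01; rewrite e00 in hA.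
apply: path_homotopic_concat hA _.
apply: (@path_homotopic_trans _ _ _ _ _ (concat f (concat (reverse B) (concat B (concat g (reverse D)))))).
  have := path_homotopicA cf crB cBgD.
  by rewrite !concat0 !concat1 !reverse0 !reverse1 em0 em1 e10; apply.
apply: (@path_homotopic_trans _ _ _ _ _ (concat f (concat g (reverse D)))); last first.
  apply: path_homotopic_sym; have := path_homotopicA cf cg crD.
  by rewrite !reverse0 reverse1 e11 e10; apply.
have hf := rf _ _ cf fg.
apply: path_homotopic_concat hf _.
apply: (@path_homotopic_trans _ _ _ _ _ (concat (concat (reverse B) B) (concat g (reverse D)))).
  apply: path_homotopic_sym; have := path_homotopicA crB cm cgD.
  by rewrite !concat0 !concat1 !reverse0 !reverse1 em1 e10; apply.
have hgD := rf _ _ cgD erefl; rewrite concat0 concat1 reverse1 e10 in hgD.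
apply: (@path_homotopic_trans _ _ _ _ _ (concat (fun=> g 0) (concat g (reverse D)))).
  apply: path_homotopic_concat hgD.
  have := path_homotopic_reverse crB; rewrite reverse0 em1.
  have -> : reverse (reverse B) = B.
    by apply/funext => t; rewrite /reverse; congr B; ring.
  by [].
have := @homotopic_reparam _ _ (concat g (reverse D)) (fun t => Num.max (0 * t + 0) (2 * t + -1)) id
  (concat (fun=> g 0) (concat g (reverse D))) (concat g (reverse D)) cgD.
rewrite !concat0 !concat1 reverse1 e10; apply.
- by apply: continuous_maxf; exact: continuous_affine.
- by move=> ?; exact: cvg_id.
- move=> t It; split => //; move: It; rewrite !unit_itvE => It.
  by rewrite mul0r addr0 ge_max le_max lexx ler01 /=; lra.
- by rewrite max_l; lra.
- by rewrite max_r; lra.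
- move=> t It; split => //; rewrite mul0r addr0 {1}/concat; have [t2|t2] := leP t 2^-1.
    by rewrite max_l ?concat0//; lra.
  by rewrite max_r//; lra.
Qed.

Lemma is_path_cst y : is_path (fun _ : R => y).
Proof. by apply: continuous_subspaceT; exact: cst_continuous. Qed.

Lemma path_class_cst y : path_class (fun=> y) = 1%g.
Proof.
have c := @is_path_cst y; have := path_class_concat c c erefl.
have -> : concat (fun _ : R => y) (fun=> y) = fun=> y.
  by apply/funext => t; rewrite /concat; case: ifP.
by move=> e; apply: (mulgI (path_class (fun=> y))); rewrite -e mulg1.
Qed.

Lemma path_class_reverse f : is_path f -> path_class (reverse f) = (path_class f)^-1%g.
Proof.
move=> cf; have cr := continuous_reverse cf.
have e : f 1 = reverse f 0 by rewrite reverse0.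
apply/esym/mulg1_eq; rewrite -path_class_concat//.
rewrite -(path_class_cst (f 0)); apply: path_class_homotopic.
- exact: continuous_concat.
- exact: is_path_cst.
- by rewrite concat0 concat1 reverse1; exact: path_homotopic_reverse.
Qed.

(** The two ways along the boundary of a square are homotopic. *)
Lemma path_class_square (H : R * R -> X) : {within square, continuous H} ->
  (path_class (fun t => H (0, t)) * path_class (fun s => H (s, 1%R)) =
   path_class (fun s => H (s, 0)) * path_class (fun t => H (1%R, t)))%g.
Proof.
move=> cH.
have cid : continuous (fun x : R => x) by move=> ?; exact: cvg_id.
have cc (c : R) : continuous (fun _ : R => c) by move=> ?; exact: cvg_cst.
have pathH (a b : R -> R) : continuous a -> continuous b ->
    (forall t, unit_itv t -> unit_itv (a t) /\ unit_itv (b t)) ->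
    is_path (fun t => H (a t, b t)).
  move=> ca cb I; apply: (@within_comp _ _ _ _ _ (fun t => (a t, b t)) H) cH; last exact: I.
  apply: continuous_subspaceT => t.
  by apply: (@cvg_pair _ _ _ (nbhs t) (nbhs _) (nbhs _)); [exact: ca|exact: cb].
have p1 : is_path (fun t => H (0, t)) by apply: pathH => // t It; split => //; exact: unit0.
have p2 : is_path (fun s => H (s, 1)) by apply: pathH => // t It; split => //; exact: unit1.
have p3 : is_path (fun s => H (s, 0)) by apply: pathH => // t It; split => //; exact: unit0.
have p4 : is_path (fun t => H (1, t)) by apply: pathH => // t It; split => //; exact: unit1.
rewrite -!path_class_concat//; apply: path_class_homotopic; [exact: continuous_concat..|].
have c1 : continuous (fun t : R => Num.max (0 * t + 0) (2 * t + -1)).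
  by apply: continuous_maxf; exact: continuous_affine.
have c2 : continuous (fun t : R => Num.min (2 * t + 0) (0 * t + 1)).
  by apply: continuous_minf; exact: continuous_affine.
have mx t : unit_itv t -> unit_itv (Num.max (0 * t + 0) (2 * t + -1)).
  by rewrite !unit_itvE => It; rewrite mul0r addr0 ge_max le_max lexx ler01 /=; lra.
have mn t : unit_itv t -> unit_itv (Num.min (2 * t + 0) (0 * t + 1)).
  by rewrite !unit_itvE => It; rewrite mul0r add0r le_min ge_min lexx orbT ler01 !andbT; lra.
apply: (homotopic_in_square cH c1 c2 c2 c1).
- by move=> t It; split; [exact: mx|exact: mn|exact: mn|exact: mx].
- have M0 : Num.max (0 * 0 + 0) (2 * 0 + -1) = 0 :> R by rewrite max_l; [ring|lra].
  have M1 : Num.max (0 * 1 + 0) (2 * 1 + -1) = 1 :> R by rewrite max_r; [ring|lra].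
  have m0 : Num.min (2 * 0 + 0) (0 * 0 + 1) = 0 :> R by rewrite min_l; [ring|lra].
  have m1 : Num.min (2 * 1 + 0) (0 * 1 + 1) = 1 :> R by rewrite min_r; [ring|lra].
  by rewrite M0 M1 m0 m1.
- move=> t It; rewrite /concat !mul0r addr0 add0r; have [t2|t2] := leP t 2^-1.
    by rewrite max_l ?min_l ?addr0//; lra.
  by rewrite max_r ?min_r//; lra.
Qed.

(** The conjugating element is the class of the path of the base point during
    the homotopy. *)
Lemma path_class_free f g : is_path f -> is_path g -> freely_homotopic f g ->
  exists k, path_class f = (path_class g ^ k)%g.
Proof.
move=> cf cg [H [cH Hfg HP]]; have := path_class_square cH.
have -> : path_class (fun t => H (0, t)) = path_class f.
  by apply/esym/path_class_ext => // t It; have [->] := Hfg t It.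
have -> : path_class (fun t => H (1, t)) = path_class g.
  by apply/esym/path_class_ext => // t It; have [_ ->] := Hfg t It.
set k := path_class (fun s => H (s, 0)).
have -> : path_class (fun s => H (s, 1)) = k.
  apply: path_class_ext => [|t It]; last by have := HP t It.
  apply: (@within_comp _ _ _ _ _ (fun t : R => (t, 1 : R)) H) cH.
    apply: continuous_subspaceT => t.
    by apply: (@cvg_pair _ _ _ (nbhs t) (nbhs _) (nbhs _)); [exact: cvg_id|exact: cvg_cst].
  by move=> t It; split => //; exact: unit1.
move=> e; exists k^-1%g; rewrite conjgE invgK mulgA -e mulgK//.
Qed.

Lemma path_class_loop (a : loop R x) : exists k, path_class a = ((\pi_(pi1 R x) a) ^ k)%g.
Proof.
have la : is_loop a by split; [exact: loop_continuous|exact: loop_0|exact: loop_1].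
have [ca a0 a1] := la.
have jx : joined x x by exists (fun=> x); split => //; exact: is_path_cst.
have [ct t0 t1] := tailP jx.
exists ((class_of (tail x))^-1)%g.
rewrite /path_class a0 a1; case: pselect => //= _.
have lt : is_loop (tail x) by [].
have lr : is_loop (reverse (tail x)).
  by split; rewrite ?reverse0 ?reverse1//; exact: continuous_reverse.
have lar := is_loop_concat la lr.
rewrite class_of_concat// class_of_concat// class_of_loop conjgE invgK; congr (_ * (_ * _))%g.
apply/esym/mulg1_eq; rewrite -class_of_concat//.
rewrite (_ : 1%g = class_of (fun=> x)); last first.
  by apply/pi1P; rewrite loop_ofE; [exact: (path_homotopic_refl (@is_path_cst x))|split => //; exact: is_path_cst].
apply: class_of_homotopic; [exact: is_loop_concat|by split => //; exact: is_path_cst|].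
by have := path_homotopic_reverse ct; rewrite t0.
Qed.

Lemma represented_path_class k f : is_path f -> represented_by k f ->
  exists l, k = (path_class f ^ l)%g.
Proof.
move=> cf [a -> af]; have [l1 e1] := path_class_loop a.
have [l2 e2] := path_class_free (loop_continuous (l := a)) cf af.
by exists (l2 * l1^-1)%g; rewrite conjgM -e2 e1 conjgK.
Qed.

(** The part of f between the times s and u, run backwards if u < s. *)
Definition subpath f s u : R -> X := fun t => f ((1 - t) * s + t * u).

Lemma subpath_path f s u : is_path f -> unit_itv s -> unit_itv u -> is_path (subpath f s u).
Proof.
move=> cf Is Iu; apply: (path_reparam (a := fun t => (1 - t) * s + t * u)) => //.
  move=> t; apply: cvgD; apply: cvgM; [|exact: cvg_cst|exact: cvg_id|exact: cvg_cst].
  by apply: cvgB; [exact: cvg_cst|exact: cvg_id].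
by move=> t It; exact: convex_comb_unit.
Qed.

Lemma path_class_subpath f s u v : is_path f -> unit_itv s -> unit_itv u -> unit_itv v ->
  (path_class (subpath f s u) * path_class (subpath f u v))%g = path_class (subpath f s v).
Proof.
move=> cf Is Iu Iv.
have p1 := subpath_path cf Is Iu; have p2 := subpath_path cf Iu Iv.
have p3 := subpath_path cf Is Iv.
have e : subpath f s u 1 = subpath f u v 0 by rewrite /subpath; congr f; ring.
rewrite -path_class_concat//; apply: path_class_homotopic => //; first exact: continuous_concat.
pose a t : R := s + (u - s) * Num.min (2 * t + 0) (0 * t + 1) + (v - u) * Num.max (0 * t + 0) (2 * t + -1).
have ca : continuous a.
  move=> t; apply: cvgD; first apply: cvgD; first exact: cvg_cst.
    apply: cvgM; first exact: cvg_cst.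
    by apply: (@continuous_minf _ (fun t => 2 * t + 0)); exact: continuous_affine.
  apply: cvgM; first exact: cvg_cst.
  by apply: (@continuous_maxf _ (fun t => 0 * t + 0)); exact: continuous_affine.
have a1 t : t <= 2^-1 -> a t = (1 - 2 * t) * s + (2 * t) * u.
  by move=> t2; rewrite /a !mul0r min_l ?max_l; [ring|lra|lra].
have a2 t : 2^-1 <= t -> a t = (1 - (2 * t - 1)) * u + (2 * t - 1) * v.
  by move=> t2; rewrite /a !mul0r min_r ?max_r; [ring|lra|lra].
apply: (@homotopic_reparam _ _ f a (fun t => (1 - t) * s + t * v)) => //.
- move=> t; apply: cvgD; apply: cvgM; [|exact: cvg_cst|exact: cvg_id|exact: cvg_cst].
  by apply: cvgB; [exact: cvg_cst|exact: cvg_id].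
- move=> t It; split; last exact: convex_comb_unit.
  move: It; rewrite unit_itvE => It; have [t2|/ltW t2] := leP t 2^-1.
    by rewrite a1//; apply: convex_comb_unit => //; rewrite unit_itvE; lra.
  by rewrite a2//; apply: convex_comb_unit => //; rewrite unit_itvE; lra.
- by rewrite a1; [ring|lra].
- by rewrite a2; [ring|lra].
- move=> t It; split => //; rewrite /concat; have [t2|/ltW t2] := leP t 2^-1.
    by rewrite /subpath a1.
  by rewrite /subpath a2.
Qed.

End holonomy.

(** * Stereographic projection *)

Section dot_product.
Context {R : realType}.
Implicit Types (u v w : 'rV[R]_3) (a b : R).

Lemma dotE u v : u *m v^T = (dot u v)%:M.
Proof. by rewrite [LHS]mx11_scalar. Qed.

Lemma dotC u v : dot u v = dot v u.
Proof. by rewrite /dot -[u *m v^T]trmxK mxE trmx_mul trmxK. Qed.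

Lemma dotDl u v w : dot (u + v) w = dot u w + dot v w.
Proof. by rewrite /dot mulmxDl mxE. Qed.

Lemma dotZl a u v : dot (a *: u) v = a * dot u v.
Proof. by rewrite /dot -scalemxAl mxE. Qed.

Lemma dotDr u v w : dot w (u + v) = dot w u + dot w v.
Proof. by rewrite dotC dotDl !(dotC w). Qed.

Lemma dotZr a u v : dot v (a *: u) = a * dot v u.
Proof. by rewrite dotC dotZl dotC. Qed.

Lemma continuous_dotl v : continuous (fun u : 'rV[R]_3 => dot u v).
Proof.
have -> : (fun u : 'rV[R]_3 => dot u v) =
    (fun u => u 0 0 * v 0 0 + u 0 1 * v 0 1 + u 0 2%:R * v 0 2%:R).
  apply/funext => u; rewrite /dot mxE !big_ord_recl big_ord0 !mxE addr0 addrA.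
  by congr (_ + _ * _ + _ * _); congr (_ _ _); exact: val_inj.
have c (i : 'I_3) (u : 'rV[R]_3) : w 0 i * v 0 i @[w --> nbhs u] --> u 0 i * v 0 i.
  have h : w 0 i @[w --> nbhs u] --> u 0 i := @coord_continuous _ _ _ 0 i u.
  exact: (cvgM h (cvg_cst _)).
by move=> u; exact: (cvgD (cvgD (c _ u) (c _ u)) (c _ u)).
Qed.

Lemma frame_complete u v e : dot u u = 1 -> dot v v = 1 -> dot e e = 1 ->
  dot u v = 0 -> dot u e = 0 -> dot v e = 0 ->
  forall w, w = dot w u *: u + dot w v *: v + dot w e *: e.
Proof.
move=> uu vv ee uv ue ve w.
pose M : 'M[R]_(1 + (1 + 1)) := col_mx u (col_mx v e).
have MM : M *m M^T = 1%:M.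
  rewrite /M !tr_col_mx mul_col_row mul_mx_row mul_col_mx mul_col_row !dotE uu vv ee uv ue ve.
  rewrite (dotC v u) (dotC e u) (dotC e v) uv ue ve.
  rewrite [RHS]scalar_mx_block; congr block_mx.
  - by rewrite !raddf0 row_mx0.
  - by rewrite !raddf0 col_mx0.
  - by rewrite [RHS]scalar_mx_block !raddf0.
have {}MM : M^T *m M = 1%:M by exact: mulmx1C.
rewrite -[LHS]mulmx1 -MM /M !tr_col_mx !mul_row_col !mulmxDr !mulmxA !dotE.
by rewrite !mul_scalar_mx addrA.
Qed.

End dot_product.

Section stereographic.
Context {R : realType} {n : nat} (p : 'I_n -> 'rV[R]_3).
Hypotheses (p_sphere : forall i, dot (p i) (p i) = 1) (p_inj : injective p).
Variables (x : punctured_sphere p) (i0 : 'I_n) (A B : 'rV[R]_3).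
Let e := p i0.
Hypotheses (AA : dot A A = 1) (BB : dot B B = 1) (AB : dot A B = 0)
  (Ae : dot A e = 0) (Be : dot B e = 0).

Let ee : dot e e = 1 := p_sphere i0.
Let eA : dot e A = 0. Proof. by rewrite dotC. Qed.
Let eB : dot e B = 0. Proof. by rewrite dotC. Qed.
Let BA : dot B A = 0. Proof. by rewrite dotC. Qed.

(** Projection from the puncture p i0 to the plane spanned by A and B. *)
Definition stereo (w : 'rV[R]_3) : R * R :=
  (dot w A / (1 - dot w e), dot w B / (1 - dot w e)).

Definition stereo_inv (z : R * R) : 'rV[R]_3 :=
  let N := 1 + z.1 ^+ 2 + z.2 ^+ 2 in
  (2 * z.1 / N) *: A + (2 * z.2 / N) *: B + ((N - 2) / N) *: e.

Let complete := frame_complete AA BB ee AB Ae Be.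

Lemma dot_coord w w' : dot w w' =
  dot w A * dot w' A + dot w B * dot w' B + dot w e * dot w' e.
Proof. by rewrite {1}(complete w') !dotDr !dotZr; ring. Qed.

Lemma sphere_coord w : dot w w = 1 ->
  dot w A ^+ 2 + dot w B ^+ 2 + dot w e ^+ 2 = 1.
Proof. by move=> ww; rewrite -[RHS]ww (dot_coord w w) !expr2. Qed.

Lemma sphere_pole w : dot w w = 1 -> w != e -> dot w e < 1.
Proof.
move=> ww we; rewrite ltNge; apply/negP => h.
have s := sphere_coord ww; have hA := sqr_ge0 (dot w A); have hB := sqr_ge0 (dot w B).
have e1 : 1 <= dot w e ^+ 2 by rewrite -[1](expr1n _ 2) ler_sqr ?nnegrE ?ler01// (le_trans ler01 h).
have /eqP : dot w A ^+ 2 = 0 by lra.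
have /eqP : dot w B ^+ 2 = 0 by lra.
rewrite !sqrf_eq0 => /eqP b0 /eqP a0.
have c1 : dot w e = 1.
  have : (dot w e - 1) * (dot w e + 1) = 0.
    by rewrite (_ : _ * _ = dot w e ^+ 2 - 1); [lra|ring].
  by move/eqP; rewrite mulf_eq0 => /orP[] /eqP; lra.
by case/eqP: we; rewrite (complete w) a0 b0 c1 !scale0r !add0r scale1r.
Qed.

Let N_gt0 (z : R * R) : 0 < 1 + z.1 ^+ 2 + z.2 ^+ 2.
Proof. by have := sqr_ge0 z.1; have := sqr_ge0 z.2; lra. Qed.

Lemma stereo_inv_dot z : let N := 1 + z.1 ^+ 2 + z.2 ^+ 2 in
  [/\ dot (stereo_inv z) A = 2 * z.1 / N, dot (stereo_inv z) B = 2 * z.2 / N,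
  dot (stereo_inv z) e = (N - 2) / N & dot (stereo_inv z) (stereo_inv z) = 1].
Proof.
move=> N; have N0 := lt0r_neq0 (N_gt0 z); rewrite -/N in N0.
have h1 : dot (stereo_inv z) A = 2 * z.1 / N.
  by rewrite /stereo_inv !dotDl !dotZl AA BA eA !mulr0 !addr0 mulr1.
have h2 : dot (stereo_inv z) B = 2 * z.2 / N.
  by rewrite /stereo_inv !dotDl !dotZl AB BB eB !mulr0 !addr0 add0r mulr1.
have h3 : dot (stereo_inv z) e = (N - 2) / N.
  by rewrite /stereo_inv !dotDl !dotZl Ae Be ee !mulr0 !add0r mulr1.
split => //; rewrite dot_coord h1 h2 h3; rewrite /N in N0 *; field.
exact: N0.
Qed.

Lemma stereo_invK z : stereo (stereo_inv z) = z.
Proof.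
have [h1 h2 h3 _] := stereo_inv_dot z; have N0 := lt0r_neq0 (N_gt0 z).
rewrite /stereo h1 h2 h3; case: z N0 {h1 h2 h3} => z1 z2 /= N0.
have E (c : R) : 2 * c / (1 + z1 ^+ 2 + z2 ^+ 2) /
    (1 - (1 + z1 ^+ 2 + z2 ^+ 2 - 2) / (1 + z1 ^+ 2 + z2 ^+ 2)) = c.
  have -> : 1 - (1 + z1 ^+ 2 + z2 ^+ 2 - 2) / (1 + z1 ^+ 2 + z2 ^+ 2) =
     2 / (1 + z1 ^+ 2 + z2 ^+ 2) by field.
  by field; rewrite N0.
by rewrite !E.
Qed.

Lemma stereoK w : dot w w = 1 -> w != e -> stereo_inv (stereo w) = w.
Proof.
move=> ww we; have c1 := sphere_pole ww we; have s := sphere_coord ww.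
rewrite [RHS]complete /stereo_inv /stereo /=.
set a := dot w A in s *; set b := dot w B in s *; set c := dot w e in s c1 *.
have c0 : 1 - c != 0 by rewrite subr_eq0 gt_eqF.
have NE : 1 + (a / (1 - c)) ^+ 2 + (b / (1 - c)) ^+ 2 = 2 / (1 - c).
  have h : a ^+ 2 + b ^+ 2 = (1 - c) * (1 + c) by rewrite (_ : (1 - c) * (1 + c) = 1 - c ^+ 2); [lra|ring].
  transitivity (1 + (a ^+ 2 + b ^+ 2) / (1 - c) ^+ 2); first by field.
  by rewrite h; field.
rewrite NE; congr (_ *: _ + _ *: _ + _ *: _); by field; rewrite c0 ?andbT ?pnatr_eq0.
Qed.

Definition planar_puncture z := exists2 k, k != i0 & z = stereo (p k).

(** The inverse of the projection, with an arbitrary value at the images of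
    the punctures. *)
Definition to_sphere z : punctured_sphere p :=
  xget x [set y : punctured_sphere p | set_val y = stereo_inv z].

Lemma to_sphere_val z : ~ planar_puncture z -> set_val (to_sphere z) = stereo_inv z.
Proof.
move=> nz; have [h1 h2 h3 ww] := stereo_inv_dot z.
have inX : punctured_sphere p (stereo_inv z).
  split => // k; apply/eqP => ek.
  have [k0|k0] := eqVneq k i0.
    move: h3; rewrite ek k0 -/e ee => /esym/eqP.
    have N0 := N_gt0 z; rewrite -subr_eq0.
    rewrite (_ : _ - 1 = - 2 / (1 + z.1 ^+ 2 + z.2 ^+ 2)).
      by apply/negP; rewrite mulf_neq0 ?invr_eq0 ?oppr_eq0 ?pnatr_eq0 ?(gt_eqF N0).
    by field; rewrite gt_eqF.
  by apply: nz; exists k => //; rewrite -ek stereo_invK.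
have := @xgetPex _ x [set y : punctured_sphere p | set_val y = stereo_inv z].
by apply; exists (SigSub (mem_set inX)).
Qed.

Lemma set_val_in (y : punctured_sphere p) : dot (set_val y) (set_val y) = 1 /\
  forall i, set_val y != p i.
Proof. by have [] := set_valP y. Qed.

Lemma stereo_avoids (w : 'rV[R]_3) : punctured_sphere p w -> ~ planar_puncture (stereo w).
Proof.
move=> [ww wp] [k k0 ek].
have pk : p k != e by rewrite (inj_eq p_inj).
have := congr1 stereo_inv ek; rewrite !stereoK//; last exact: wp.
by move=> h; have := wp k; rewrite h eqxx.
Qed.

Lemma to_sphereK (y : punctured_sphere p) : to_sphere (stereo (set_val y)) = y.
Proof.
have [yy yp] := set_val_in y; apply: val_inj.
rewrite -[LHS]/(set_val _) to_sphere_val; last exact: stereo_avoids.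
by rewrite stereoK//; exact: yp.
Qed.

Lemma continuous_stereo : continuous (fun y : punctured_sphere p => stereo (set_val y)).
Proof.
have cd v : continuous (fun y : punctured_sphere p => dot (set_val y) v).
  move=> y; apply: (@continuous_comp _ _ _ (@set_val _ _) (fun w : 'rV[R]_3 => dot w v)).
    exact: initial_continuous.
  exact: continuous_dotl.
move=> y; have [yy yp] := set_val_in y.
have y0 : 1 - dot (set_val y) e != 0.
  by rewrite subr_eq0 gt_eqF//; apply: sphere_pole => //; exact: yp.
apply: (@cvg_pair _ _ _ (nbhs y) (nbhs _) (nbhs _)); apply: cvgM.
- exact: cd.
- by apply: cvgV => //; apply: cvgB; [exact: cvg_cst|exact: cd].
- exact: cd.
- by apply: cvgV => //; apply: cvgB; [exact: cvg_cst|exact: cd].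
Qed.

Lemma continuous_to_sphere (Y : topologicalType) (D : set Y) (F : Y -> R * R) :
  {within D, continuous F} -> (forall y, D y -> ~ planar_puncture (F y)) ->
  {within D, continuous (to_sphere \o F)}.
Proof.
move=> cF DF.
have c1 : {within D, continuous (fun y => stereo_inv (F y))}.
  move=> y; rewrite /stereo_inv; set z := F y.
  have N0 := N_gt0 z.
  have cF1 : (fun y => (F y).1) @ nbhs (y : subspace D) --> z.1.
    by apply: (@continuous_comp (subspace D) _ _ F fst); [exact: cF|exact: cvg_fst].
  have cF2 : (fun y => (F y).2) @ nbhs (y : subspace D) --> z.2.
    by apply: (@continuous_comp (subspace D) _ _ F snd); [exact: cF|exact: cvg_snd].
  have cN : (fun y => 1 + (F y).1 ^+ 2 + (F y).2 ^+ 2) @ nbhs (y : subspace D) --> 1 + z.1 ^+ 2 + z.2 ^+ 2.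
    apply: cvgD; first apply: cvgD; first exact: cvg_cst.
      by rewrite expr2; apply: cvgM.
    by rewrite expr2; apply: cvgM.
  have cNV : (fun y => (1 + (F y).1 ^+ 2 + (F y).2 ^+ 2)^-1) @ nbhs (y : subspace D) --> (1 + z.1 ^+ 2 + z.2 ^+ 2)^-1.
    by apply: cvgV => //; rewrite gt_eqF.
  apply: cvgD; first apply: cvgD.
  - by apply: cvgZr_tmp; apply: cvgM => //; apply: cvgM => //; exact: cvg_cst.
  - by apply: cvgZr_tmp; apply: cvgM => //; apply: cvgM => //; exact: cvg_cst.
  - by apply: cvgZr_tmp; apply: cvgM => //; apply: cvgB => //; exact: cvg_cst.
have c2 : {within D, continuous (set_val \o (to_sphere \o F))}.
  apply: subspace_eq_continuous c1 => y /set_mem Dy.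
  by rewrite /from_subspace /= to_sphere_val//; exact: DF.
exact: (@continuous_comp_initial _ (subspace D) _ _ _ c2).
Qed.

End stereographic.

(** * Paths in the punctured plane *)

Section planar.
Context {R : realType} {X : topologicalType} (x : X).
(** A map emb from the plane to X that is meaningful off Q only. *)
Variables (Q : set (R * R)) (emb : R * R -> X).
Hypothesis emb_continuous : forall (Y : topologicalType) (D : set Y) (F : Y -> R * R),
  {within D, continuous F} -> (forall y, D y -> ~ Q (F y)) ->
  {within D, continuous (emb \o F)}.
Implicit Types (F G : R -> R * R) (y z w : R * R) (s t : R) (D : set (R * R)).

Definition comb s y z : R * R := ((1 - s) * y.1 + s * z.1, (1 - s) * y.2 + s * z.2).
Definition seg y z : R -> R * R := fun t => comb t y z.

Definition planar_path F := is_path F /\ forall t, unit_itv t -> ~ Q (F t).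

Definition planar_class F : pi1 R x := path_class x (emb \o F).

Lemma comb0 y z : comb 0 y z = y.
Proof. by rewrite /comb subr0 !mul1r !mul0r !addr0; case: y. Qed.
Lemma comb1 y z : comb 1 y z = z.
Proof. by rewrite /comb subrr !mul1r !mul0r !add0r; case: z. Qed.
Lemma combb s y : comb s y y = y.
Proof. by rewrite /comb -!mulrDl subrK !mul1r; case: y. Qed.

Lemma within_comb (Y : topologicalType) (E : set Y) (S : Y -> R) (F G : Y -> R * R) :
  {within E, continuous S} -> {within E, continuous F} -> {within E, continuous G} ->
  {within E, continuous (fun v : Y => comb (S v) (F v) (G v))}.
Proof.
move=> cS cF cG v.
have c1 (H : Y -> R * R) : {within E, continuous H} ->
    (fun v : Y => (H v).1) @ nbhs (v : subspace E) --> (H v).1.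
  by move=> cH; apply: (@continuous_comp (subspace E) _ _ H fst); [exact: cH|exact: cvg_fst].
have c2 (H : Y -> R * R) : {within E, continuous H} ->
    (fun v : Y => (H v).2) @ nbhs (v : subspace E) --> (H v).2.
  by move=> cH; apply: (@continuous_comp (subspace E) _ _ H snd); [exact: cH|exact: cvg_snd].
have cS1 : (fun v : Y => 1 - S v) @ nbhs (v : subspace E) --> 1 - S v.
  by apply: cvgB; [exact: cvg_cst|exact: cS].
apply: (@cvg_pair _ _ _ (nbhs (v : subspace E)) (nbhs _) (nbhs _)).
  by apply: cvgD; apply: cvgM; [exact: cS1|exact: c1|exact: cS|exact: c1].
by apply: cvgD; apply: cvgM; [exact: cS1|exact: c2|exact: cS|exact: c2].
Qed.

Lemma planar_path_emb F : planar_path F -> is_path (emb \o F).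
Proof. by case=> cF nF; exact: emb_continuous. Qed.

Lemma within_id (E : set R) : {within E, continuous (fun t : R => t)}.
Proof. by apply: continuous_subspaceT => ?; exact: cvg_id. Qed.

Lemma within_cst (Y Z : topologicalType) (E : set Y) (z : Z) : {within E, continuous (fun _ : Y => z)}.
Proof. by apply: continuous_subspaceT; exact: cst_continuous. Qed.

Lemma is_path_seg y z : is_path (seg y z).
Proof. by apply: within_comb; [exact: within_id|exact: within_cst|exact: within_cst]. Qed.

Lemma planar_path_concat F G : planar_path F -> planar_path G -> F 1 = G 0 ->
  planar_path (concat F G).
Proof.
move=> [cF nF] [cG nG] FG; split; first exact: continuous_concat.
move=> t; rewrite unit_itvE => It; rewrite /concat; case: leP => t2.
  by apply: nF; rewrite unit_itvE; lra.
by apply: nG; rewrite unit_itvE; lra.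
Qed.

Lemma planar_class_concat F G : planar_path F -> planar_path G -> F 1 = G 0 ->
  planar_class (concat F G) = (planar_class F * planar_class G)%g.
Proof.
move=> pF pG FG; rewrite /planar_class.
have -> : emb \o concat F G = concat (emb \o F) (emb \o G).
  by apply/funext => t; rewrite /= /concat; case: ifP.
by apply: path_class_concat; [exact: planar_path_emb..|rewrite /= FG].
Qed.

Lemma straight_square F G : is_path F -> is_path G ->
  (forall s t, unit_itv s -> unit_itv t -> ~ Q (comb s (F t) (G t))) ->
  {within square, continuous (fun st : R * R => emb (comb st.1 (F st.2) (G st.2)))}.
Proof.
move=> cF cG nQ; apply: emb_continuous; last by move=> [s t] [? ?]; exact: nQ.
apply: within_comb.
- by apply: continuous_subspaceT => ?; exact: cvg_fst.
- apply: (@within_comp _ _ _ _ _ snd F) cF; last by move=> [? ?] [].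
  by apply: continuous_subspaceT => ?; exact: cvg_snd.
- apply: (@within_comp _ _ _ _ _ snd G) cG; last by move=> [? ?] [].
  by apply: continuous_subspaceT => ?; exact: cvg_snd.
Qed.

Lemma straight_avoid F G : 
  (forall s t, unit_itv s -> unit_itv t -> ~ Q (comb s (F t) (G t))) ->
  forall t, unit_itv t -> ~ Q (F t) /\ ~ Q (G t).
Proof.
move=> nQ t It; split.
  by have := nQ 0 t unit0 It; rewrite comb0.
by have := nQ 1 t unit1 It; rewrite comb1.
Qed.

Lemma planar_class_straight F G : is_path F -> is_path G ->
  (forall s t, unit_itv s -> unit_itv t -> ~ Q (comb s (F t) (G t))) ->
  F 0 = G 0 -> F 1 = G 1 -> planar_class F = planar_class G.
Proof.
move=> cF cG nQ e0 e1; have av := straight_avoid nQ.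
apply: path_class_homotopic.
- by apply: planar_path_emb; split => // t /av[].
- by apply: planar_path_emb; split => // t /av[].
- exists (fun st : R * R => emb (comb st.1 (F st.2) (G st.2))); split.
  + exact: straight_square.
  + by move=> t It; rewrite /= comb0 comb1.
  + by move=> s Is; rewrite /= e0 e1 !combb.
Qed.

Lemma planar_class_free_straight F G : is_path F -> is_path G ->
  (forall s t, unit_itv s -> unit_itv t -> ~ Q (comb s (F t) (G t))) ->
  F 0 = F 1 -> G 0 = G 1 -> exists k, planar_class F = (planar_class G ^ k)%g.
Proof.
move=> cF cG nQ e0 e1; have av := straight_avoid nQ.
apply: path_class_free.
- by apply: planar_path_emb; split => // t /av[].
- by apply: planar_path_emb; split => // t /av[].
- exists (fun st : R * R => emb (comb st.1 (F st.2) (G st.2))); split.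
  + exact: straight_square.
  + by move=> t It; rewrite /= comb0 comb1.
  + by move=> s Is; rewrite /= e0 e1.
Qed.

(** The value 1 for the segments that meet Q makes [seg_class] antisymmetric
    everywhere, as holonomies require. *)
Definition seg_class y z : pi1 R x :=
  if pselect (forall t, unit_itv t -> ~ Q (seg y z t)) then planar_class (seg y z)
  else 1%g.

Lemma reverse_seg y z : reverse (seg y z) = seg z y.
Proof.
apply/funext => t; rewrite /reverse /seg /comb; congr (_, _); ring.
Qed.

Lemma seg_classV y z : seg_class z y = (seg_class y z)^-1%g.
Proof.
rewrite /seg_class; case: pselect => h; case: pselect => h'.
- rewrite /= -path_class_reverse; last by apply: planar_path_emb; split => //; exact: is_path_seg.
  by rewrite /planar_class -(reverse_seg y z).
- case: h' => t It; rewrite -reverse_seg; apply: h.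
  by move: It; rewrite !unit_itvE => ?; lra.
- case: h => t It; rewrite -reverse_seg; apply: h'.
  by move: It; rewrite !unit_itvE => ?; lra.
- by rewrite invg1.
Qed.

Lemma seg_class1 y : seg_class y y = 1%g.
Proof.
rewrite /seg_class; case: pselect => //= _.
rewrite /planar_class -[RHS](path_class_cst x (emb y)); congr path_class.
by apply/funext => t; rewrite /= /seg combb.
Qed.

Definition convex_free D := (forall y z t, D y -> D z -> unit_itv t -> D (comb t y z)) /\
  forall z, D z -> ~ Q z.

Lemma planar_class_convex D F : convex_free D -> is_path F ->
  (forall t, unit_itv t -> D (F t)) -> planar_class F = seg_class (F 0) (F 1).
Proof.
move=> [cD fD] cF DF.
have D0 := DF 0 unit0; have D1 := DF 1 unit1.
rewrite /seg_class; case: pselect => [h|[]]; last by move=> t It; apply/fD/cD.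
apply: planar_class_straight => //; first exact: is_path_seg.
- by move=> s t Is It; apply/fD/cD => //; [exact: DF|exact: cD].
- by rewrite /seg comb0.
- by rewrite /seg comb1.
Qed.

Lemma seg_class_triangle D y z w : convex_free D -> D y -> D z -> D w ->
  (seg_class y z * seg_class z w)%g = seg_class y w.
Proof.
move=> fD Dy Dz Dw; have [cD nD] := fD.
have p1 : planar_path (seg y z) by split; [exact: is_path_seg|move=> t It; apply/nD/cD].
have p2 : planar_path (seg z w) by split; [exact: is_path_seg|move=> t It; apply/nD/cD].
have e : seg y z 1 = seg z w 0 by rewrite /seg comb0 comb1.
have := planar_class_convex fD (planar_path_concat p1 p2 e).1.
rewrite concat0 concat1 planar_class_concat// /seg comb0 comb1 -/(seg y z) -/(seg z w).
rewrite (planar_class_convex fD (@is_path_seg y z)); last by move=> t It; exact: cD.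
rewrite (planar_class_convex fD (@is_path_seg z w)); last by move=> t It; exact: cD.
rewrite /seg !comb0 !comb1; apply.
move=> t; rewrite unit_itvE => It; rewrite /concat; case: leP => t2.
  by apply: cD => //; rewrite unit_itvE; lra.
by apply: cD => //; rewrite unit_itvE; lra.
Qed.

Definition box (x0 x1 y0 y1 : R) : set (R * R) :=
  [set z | (x0 <= z.1 <= x1) && (y0 <= z.2 <= y1)].

Lemma comb_bounds s (a b u v : R) : unit_itv s -> a <= u <= b -> a <= v <= b ->
  a <= (1 - s) * u + s * v <= b.
Proof.
rewrite unit_itvE => /andP[s0 s1] /andP[u0 u1] /andP[v0 v1].
have s0' : 0 <= 1 - s by rewrite subr_ge0.
have h1 := ler_wpM2l s0' u0; have h2 := ler_wpM2l s0' u1.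
have h3 := ler_wpM2l s0 v0; have h4 := ler_wpM2l s0 v1.
by apply/andP; split; lra.
Qed.

Lemma box_convex (x0 x1 y0 y1 : R) y z t : box x0 x1 y0 y1 y -> box x0 x1 y0 y1 z ->
  unit_itv t -> box x0 x1 y0 y1 (comb t y z).
Proof.
by move=> /andP[h1 h2] /andP[h3 h4] It; rewrite /box /= !comb_bounds.
Qed.

Lemma box_free (x0 x1 y0 y1 : R) : (forall z, box x0 x1 y0 y1 z -> ~ Q z) ->
  convex_free (box x0 x1 y0 y1).
Proof. by move=> h; split => // y z t; exact: box_convex. Qed.

Section lattice_holonomy.
Variable pos : vertex -> R * R.
Definition lattice_class (u v : vertex) := seg_class (pos u) (pos v).

Lemma lattice_classV u v : lattice_class v u = (lattice_class u v)^-1%g.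
Proof. exact: seg_classV. Qed.

Lemma hol_convex D (u : vertex) (s : seq vertex) : convex_free D -> (forall v, v \in u :: s -> D (pos v)) ->
  hol lattice_class u s = seg_class (pos u) (pos (last u s)).
Proof.
move=> fD; elim: s u => [|v s IHs] u Ds /=; first by rewrite seg_class1.
have Dv (w : vertex) : w \in v :: s -> D (pos w) by move=> ws; apply: Ds; rewrite in_cons ws orbT.
rewrite IHs//; apply: (seg_class_triangle fD); [apply: Ds|apply: Dv|apply: Dv].
- exact: mem_head.
- exact: mem_head.
- exact: mem_last.
Qed.

End lattice_holonomy.

Definition quad (c1 c2 c3 c4 : R * R) :=
  concat (concat (seg c1 c2) (seg c2 c3)) (concat (seg c3 c4) (seg c4 c1)).

Lemma quadE c1 c2 c3 c4 t : unit_itv t ->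
  [\/ 0 <= t <= 4^-1 /\ quad c1 c2 c3 c4 t = seg c1 c2 (4 * t),
      4^-1 <= t <= 2^-1 /\ quad c1 c2 c3 c4 t = seg c2 c3 (4 * t - 1),
      2^-1 <= t <= 3 / 4 /\ quad c1 c2 c3 c4 t = seg c3 c4 (4 * t - 2) |
      3 / 4 <= t <= 1 /\ quad c1 c2 c3 c4 t = seg c4 c1 (4 * t - 3)].
Proof.
rewrite unit_itvE /quad {1 4 7 10}/concat => It; case: (leP t 2^-1) => t2.
  case: (leP (2 * t) 2^-1) => t4.
    constructor 1; split; first by lra.
    by rewrite /concat t4; congr seg; ring.
  constructor 2; split; first by lra.
  by rewrite /concat leNgt t4 /=; congr seg; ring.
case: (leP (2 * t - 1) 2^-1) => t4.
  constructor 3; split; first by lra.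
  by rewrite /concat t4; congr seg; ring.
constructor 4; split; first by lra.
by rewrite /concat leNgt t4 /=; congr seg; ring.
Qed.

Lemma is_path_quad c1 c2 c3 c4 : is_path (quad c1 c2 c3 c4).
Proof.
have s0 y z : seg y z 0 = y by rewrite /seg comb0.
have s1 y z : seg y z 1 = z by rewrite /seg comb1.
apply: continuous_concat; rewrite ?concat0 ?concat1 ?s0 ?s1//;
  by apply: continuous_concat; rewrite ?s0 ?s1//; exact: is_path_seg.
Qed.

Lemma planar_class_quad c1 c2 c3 c4 :
  (forall t, unit_itv t -> ~ Q (quad c1 c2 c3 c4 t)) ->
  planar_class (quad c1 c2 c3 c4) =
  (seg_class c1 c2 * seg_class c2 c3 * (seg_class c3 c4 * seg_class c4 c1))%g.
Proof.
move=> nQ.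
have s0 y z : seg y z 0 = y by rewrite /seg comb0.
have s1 y z : seg y z 1 = z by rewrite /seg comb1.
have sP y z : (forall t, unit_itv t -> ~ Q (seg y z t)) ->
    planar_path (seg y z) /\ planar_class (seg y z) = seg_class y z.
  move=> h; split; first by split => //; exact: is_path_seg.
  by rewrite /seg_class; case: pselect.
have [p1 e1] : planar_path (seg c1 c2) /\ planar_class (seg c1 c2) = seg_class c1 c2.
  apply: sP => t; rewrite unit_itvE => It; have := nQ (t / 4).
  rewrite unit_itvE /quad /concat ifT; last by lra.
  by rewrite ifT; [rewrite (_ : 2 * (2 * (t / 4)) = t); [apply; lra|field]|lra].
have [p2 e2] : planar_path (seg c2 c3) /\ planar_class (seg c2 c3) = seg_class c2 c3.
  apply: sP => t; rewrite unit_itvE => It.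
  have [->|t0] := eqVneq t 0; first by rewrite s0 -(s1 c1 c2); apply: p1.2 unit1.
  have tp : 0 < t by rewrite lt_neqAle eq_sym t0; lra.
  have := nQ ((t + 1) / 4); rewrite unit_itvE /quad /concat ifT; last by lra.
  rewrite ifF; last by apply/negbTE; rewrite -ltNge; lra.
  by rewrite (_ : 2 * (2 * ((t + 1) / 4)) - 1 = t); [apply; lra|field].
have [p3 e3] : planar_path (seg c3 c4) /\ planar_class (seg c3 c4) = seg_class c3 c4.
  apply: sP => t; rewrite unit_itvE => It.
  have [->|t0] := eqVneq t 0; first by rewrite s0 -(s1 c2 c3); apply: p2.2 unit1.
  have tp : 0 < t by rewrite lt_neqAle eq_sym t0; lra.
  have := nQ ((t + 2) / 4); rewrite unit_itvE /quad /concat ifF; last by apply/negbTE; rewrite -ltNge; lra.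
  rewrite ifT; last by lra.
  by rewrite (_ : 2 * (2 * ((t + 2) / 4) - 1) = t); [apply; lra|field].
have [p4 e4] : planar_path (seg c4 c1) /\ planar_class (seg c4 c1) = seg_class c4 c1.
  apply: sP => t; rewrite unit_itvE => It.
  have [->|t0] := eqVneq t 0; first by rewrite s0 -(s1 c3 c4); apply: p3.2 unit1.
  have tp : 0 < t by rewrite lt_neqAle eq_sym t0; lra.
  have := nQ ((t + 3) / 4); rewrite unit_itvE /quad /concat ifF; last by apply/negbTE; rewrite -ltNge; lra.
  rewrite ifF; last by apply/negbTE; rewrite -ltNge; lra.
  by rewrite (_ : 2 * (2 * ((t + 3) / 4) - 1) - 1 = t); [apply; lra|field].
rewrite /quad !planar_class_concat ?e1 ?e2 ?e3 ?e4 ?concat0 ?concat1 ?s0 ?s1//.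
- by apply: planar_path_concat; rewrite ?s0 ?s1.
- by apply: planar_path_concat; rewrite ?s0 ?s1.
Qed.

Definition circ (o : R * R) (rho a : R) : R -> R * R := fun t =>
  (o.1 + rho * cos (2 * pi * t + a), o.2 + rho * sin (2 * pi * t + a)).

Lemma is_path_circ o rho a : is_path (circ o rho a).
Proof.
apply: continuous_subspaceT => t.
have c : {for t, continuous (fun t : R => 2 * pi * t + a)} by exact: continuous_affine.
apply: (@cvg_pair _ _ _ (nbhs t) (nbhs _) (nbhs _)); apply: cvgD; [exact: cvg_cst| |exact: cvg_cst|];
  (apply: cvgM; first exact: cvg_cst).
  by apply: (@continuous_comp _ _ _ (fun t : R => 2 * pi * t + a) cos); [exact: c|exact: continuous_cos].
by apply: (@continuous_comp _ _ _ (fun t : R => 2 * pi * t + a) sin); [exact: c|exact: continuous_sin].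
Qed.

Lemma circ_closed o rho a : circ o rho a 0 = circ o rho a 1.
Proof.
rewrite /circ mulr0 add0r (_ : 2 * pi * 1 + a = a + pi *+ 2); last by ring.
by rewrite cosD2pi sinD2pi.
Qed.

Lemma sin_quarter t : pi / 4 <= t <= 3 * pi / 4 -> sin (pi / 4) <= sin t :> R.
Proof.
move=> h; have p0 := @pi_gt0 R.
have H u : pi / 4 <= u <= pi / 2 -> sin (pi / 4) <= sin u :> R.
  move=> hu; have [->//|ne] := eqVneq u (pi / 4); apply: ltW.
  by rewrite ltr_sin ?in_itv/=; [rewrite lt_neqAle eq_sym ne; lra|lra|lra].
have [t2|t2] := leP t (pi / 2); first by apply: H; lra.
have -> : sin t = sin (pi - t) by rewrite sinB sinpi cospi mul0r sub0r mulN1r opprK.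
by apply: H; lra.
Qed.

Lemma sin_pi4_gt0 : 0 < sin (pi / 4) :> R.
Proof. by apply: sin_gt0_pi; have := @pi_gt0 R; lra. Qed.

(** Both curves start at the upper right and run anti-clockwise. Quarter by
    quarter, the side of the rectangle and the arc of the circle lie in a
    common half-plane at distance at least m from the centre o, hence so does
    the straight homotopy between them. *)
Lemma quad_circ (x0 x1 y0 y1 : R) (o : R * R) rho m : 0 < m -> m <= rho * sin (pi / 4) ->
  m <= x1 - o.1 -> m <= o.1 - x0 -> m <= y1 - o.2 -> m <= o.2 - y0 ->
  (forall z, Q z -> (`|z.1 - o.1| < m /\ `|z.2 - o.2| < m) \/
     (~ box x0 x1 y0 y1 z /\ [/\ rho <= x1 - o.1, rho <= o.1 - x0, rho <= y1 - o.2 & rho <= o.2 - y0])) ->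
  (forall t, unit_itv t -> ~ Q (quad (x1, y1) (x0, y1) (x0, y0) (x1, y0) t)) /\
  exists k, planar_class (quad (x1, y1) (x0, y1) (x0, y0) (x1, y0)) =
            (planar_class (circ o rho (pi / 4)) ^ k)%g.
Proof.
move=> m0 mr hx1 hx0 hy1 hy0 hQ; have p0 := @pi_gt0 R.
have r0 : 0 < rho by have := sin_pi4_gt0; move: (lt_le_trans m0 mr); rewrite pmulr_lgt0 ?sin_pi4_gt0.
set qd := quad _ _ _ _.
have far s t : unit_itv s -> unit_itv t -> let z := comb s (qd t) (circ o rho (pi / 4) t) in
    [\/ o.2 + m <= z.2, z.1 <= o.1 - m, z.2 <= o.2 - m | o.1 + m <= z.1].
  move=> Is It z.
  have up (a b c : R) : c <= a -> c <= b -> c <= (1 - s) * a + s * b.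
    move=> ca cb; have /andP[//] : c <= (1 - s) * a + s * b <= Num.max a b.
    by apply: comb_bounds => //; rewrite ?ca ?cb le_max lexx ?orbT.
  have dn (a b c : R) : a <= c -> b <= c -> (1 - s) * a + s * b <= c.
    move=> ca cb; have /andP[//] : Num.min a b <= (1 - s) * a + s * b <= c.
    by apply: comb_bounds => //; rewrite ?ca ?cb ge_min lexx ?orbT.
  have sq u : pi / 4 <= u <= 3 * pi / 4 -> m <= rho * sin u.
    by move=> /sin_quarter h; apply: le_trans mr _; rewrite ler_wpM2l// ltW.
  rewrite /z /comb /=.
  case: (quadE (x1, y1) (x0, y1) (x0, y0) (x1, y0) It) => -[ht e]; rewrite -/qd in e; rewrite e /seg /comb /=.
  - constructor 1; apply: up; first by lra.
    rewrite lerD2l; apply: sq.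
    have h1 : 2 * pi * 0 <= 2 * pi * t by rewrite ler_wpM2l//; lra.
    have h2 : 2 * pi * t <= 2 * pi * 4^-1 by rewrite ler_wpM2l//; lra.
    by apply/andP; split; lra.
  - constructor 2; apply: dn; first by lra.
    rewrite lerD2l (_ : _ + pi / 4 = (2 * pi * t - pi / 4) + pi / 2); last by field.
    rewrite cosDpihalf mulrN lerN2; apply: sq.
    have h1 : 2 * pi * 4^-1 <= 2 * pi * t by rewrite ler_wpM2l//; lra.
    have h2 : 2 * pi * t <= 2 * pi * 2^-1 by rewrite ler_wpM2l//; lra.
    by apply/andP; split; lra.
  - constructor 3; apply: dn; first by lra.
    rewrite lerD2l (_ : _ + pi / 4 = (2 * pi * t - 3 * pi / 4) + pi); last by field.
    rewrite sinDpi mulrN lerN2; apply: sq.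
    have h1 : 2 * pi * 2^-1 <= 2 * pi * t by rewrite ler_wpM2l//; lra.
    have h2 : 2 * pi * t <= 2 * pi * (3 / 4) by rewrite ler_wpM2l//; lra.
    by apply/andP; split; lra.
  - constructor 4; apply: up; first by lra.
    rewrite lerD2l (_ : _ + pi / 4 = (2 * pi * t - 5 * pi / 4) + pi / 2 + pi); last by field.
    rewrite cosDpi cosDpihalf opprK; apply: sq.
    have h1 : 2 * pi * (3 / 4) <= 2 * pi * t by rewrite ler_wpM2l//; lra.
    have h2 : 2 * pi * t <= 2 * pi * 1 by rewrite ler_wpM2l//; lra.
    by apply/andP; split; lra.
have qbox t : unit_itv t -> box x0 x1 y0 y1 (qd t).
  move=> It.
  have b1 : box x0 x1 y0 y1 (x1, y1) by rewrite /box /=; lra.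
  have b2 : box x0 x1 y0 y1 (x0, y1) by rewrite /box /=; lra.
  have b3 : box x0 x1 y0 y1 (x0, y0) by rewrite /box /=; lra.
  have b4 : box x0 x1 y0 y1 (x1, y0) by rewrite /box /=; lra.
  by case: (quadE (x1, y1) (x0, y1) (x0, y0) (x1, y0) It) => -[ht e]; rewrite -/qd in e;
    rewrite e; apply: box_convex => //; rewrite unit_itvE; lra.
have nQ s t : unit_itv s -> unit_itv t -> ~ Q (comb s (qd t) (circ o rho (pi / 4) t)).
  move=> Is It /hQ[[z1 z2]|[nb [f1 f2 f3 f4]]].
    move: z1 z2; rewrite !ltr_norml => /andP[z1 z2] /andP[z3 z4].
    by case: (far s t Is It); lra.
  apply: nb; apply: box_convex => //; first exact: qbox.
  have cb (c : R) : -1 <= c <= 1 -> - rho <= rho * c <= rho.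
    move=> /andP[c1 c2]; have := ler_wpM2l (ltW r0) c1; have := ler_wpM2l (ltW r0) c2.
    by rewrite mulrN1 mulr1 => -> ->.
  have := cb (cos (2 * pi * t + pi / 4)); rewrite cos_geN1 cos_le1 => /(_ isT)/andP[h1 h2].
  have := cb (sin (2 * pi * t + pi / 4)); rewrite sin_geN1 sin_le1 => /(_ isT)/andP[h3 h4].
  by rewrite /box /circ /=; lra.
split; first by move=> t /(straight_avoid nQ)[].
apply: planar_class_free_straight nQ _ _.
- exact: is_path_quad.
- exact: is_path_circ.
- by rewrite /qd /quad concat0 !concat1 concat0 /seg comb0 comb1.
- exact: circ_closed.
Qed.

Lemma circ_rotate o rho a b :
  (forall z, Q z -> (z.1 - o.1) ^+ 2 + (z.2 - o.2) ^+ 2 != rho ^+ 2) ->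
  exists k, planar_class (circ o rho a) = (planar_class (circ o rho b) ^ k)%g.
Proof.
move=> hQ.
have nQ c t : ~ Q (circ o rho c t).
  move=> /hQ/negP; apply; rewrite /circ /= ![_ + _ - _]addrC !addrA !addNr !add0r.
  by rewrite !exprMn -mulrDr cos2Dsin2 mulr1.
apply: path_class_free.
- by apply: planar_path_emb; split => //; exact: is_path_circ.
- by apply: planar_path_emb; split => //; exact: is_path_circ.
exists (fun st : R * R => emb (circ o rho ((1 - st.1) * a + st.1 * b) st.2)); split.
- apply: emb_continuous => //; apply: continuous_subspaceT => st.
  have c : {for st, continuous (fun st : R * R => 2 * pi * st.2 + ((1 - st.1) * a + st.1 * b))}.
    apply: cvgD; first by apply: cvgM; [exact: cvg_cst|exact: cvg_snd].
    apply: cvgD; apply: cvgM; [|exact: cvg_cst|exact: cvg_fst|exact: cvg_cst].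
    by apply: cvgB; [exact: cvg_cst|exact: cvg_fst].
  apply: (@cvg_pair _ _ _ (nbhs st) (nbhs _) (nbhs _)); apply: cvgD; [exact: cvg_cst| |exact: cvg_cst|];
    (apply: cvgM; first exact: cvg_cst).
    by apply: (@continuous_comp _ _ _ (fun st : R * R => 2 * pi * st.2 + ((1 - st.1) * a + st.1 * b)) cos); [exact: c|exact: continuous_cos].
  by apply: (@continuous_comp _ _ _ (fun st : R * R => 2 * pi * st.2 + ((1 - st.1) * a + st.1 * b)) sin); [exact: c|exact: continuous_sin].
- by move=> t _; rewrite /= !subr0 !subrr !mul0r !mul1r !addr0 !add0r.
- by move=> s _ /=; rewrite circ_closed.
Qed.

End planar.

(** * Circles around the punctures *)

Section det3.
Context {R : realType}.
Implicit Types (u v w : 'rV[R]_3).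

Lemma det3E (M : 'M[R]_3) : \det M =
  M 0 0 * (M 1 1 * M 2%:R 2%:R - M 1 2%:R * M 2%:R 1)
  - M 0 1 * (M 1 0 * M 2%:R 2%:R - M 1 2%:R * M 2%:R 0)
  + M 0 2%:R * (M 1 0 * M 2%:R 1 - M 1 1 * M 2%:R 0).
Proof.
have det2 (N : 'M[R]_2) : \det N = N 0 0 * N 1 1 - N 0 1 * N 1 0.
  rewrite (expand_det_row _ 0) !big_ord_recl big_ord0 /cofactor !det_mx11 !mxE /=.
  rewrite (_ : lift 0 0 = 1); last exact: val_inj.
  by rewrite (_ : lift 1 0 = 0) ?expr0 ?expr1; [ring|exact: val_inj].
rewrite (expand_det_row _ 0) !big_ord_recl big_ord0 /cofactor !det2 !mxE /=.
rewrite addr0 !expr0 !expr1 -signr_odd /= expr0.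
have e0 : lift (0 : 'I_3) (0 : 'I_2) = 1 by exact: val_inj.
have e1 : lift (0 : 'I_3) (1 : 'I_2) = 2%:R by exact: val_inj.
have e2 : lift (1 : 'I_3) (0 : 'I_2) = 0 by exact: val_inj.
have e3 : lift (1 : 'I_3) (1 : 'I_2) = 2%:R by exact: val_inj.
have e4 : lift (2%:R : 'I_3) (0 : 'I_2) = 0 by exact: val_inj.
have e5 : lift (2%:R : 'I_3) (1 : 'I_2) = 1 by exact: val_inj.
have e6 : lift (0 : 'I_3) (lift (0 : 'I_2) 0) = 2%:R by exact: val_inj.
rewrite !e6 !e0 ?e1 !e2 !e3 !e4 !e5; ring.
Qed.

(** The product of the first matrix by the transpose of the second has
    determinant 1 and the scalar products for entries. *)
Lemma det_frame u v w u0 v0 w0 : \det (col_mx u (col_mx v w) : 'M[R]_3) = 1 ->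
  \det (col_mx u0 (col_mx v0 w0) : 'M[R]_3) = 1 ->
  dot u u0 * (dot v v0 * dot w w0 - dot v w0 * dot w v0)
  - dot u v0 * (dot v u0 * dot w w0 - dot v w0 * dot w u0)
  + dot u w0 * (dot v u0 * dot w v0 - dot v v0 * dot w u0) = 1.
Proof.
move=> d d0.
have : \det ((col_mx u (col_mx v w) : 'M[R]_3) *m (col_mx u0 (col_mx v0 w0) : 'M[R]_3)^T)%R = 1.
  by rewrite det_mulmx det_tr d d0 mulr1.
rewrite det3E => <-.
have e (M N : 'M[R]_3) i j : (M *m N^T) i j = dot (row i M) (row j N).
  by rewrite /dot !mxE; apply: eq_bigr => k _; rewrite !mxE.
have r0 (a b c : 'rV[R]_3) : row 0 (col_mx a (col_mx b c) : 'M[R]_(1 + (1 + 1), 3)) = a.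
  transitivity (row (lshift 2 0) (col_mx a (col_mx b c))); last by rewrite rowKu row_id.
  by congr row; exact: val_inj.
have r1 (a b c : 'rV[R]_3) : row 1 (col_mx a (col_mx b c) : 'M[R]_(1 + (1 + 1), 3)) = b.
  transitivity (row (rshift 1 (lshift 1 0)) (col_mx a (col_mx b c))).
    by congr row; exact: val_inj.
  by rewrite rowKd rowKu row_id.
have r2 (a b c : 'rV[R]_3) : row 2%:R (col_mx a (col_mx b c) : 'M[R]_(1 + (1 + 1), 3)) = c.
  transitivity (row (rshift 1 (rshift 1 0)) (col_mx a (col_mx b c))).
    by congr row; exact: val_inj.
  by rewrite rowKd rowKd row_id.
by rewrite !e !r0 !r1 !r2.
Qed.
End det3.

Section conformality.
Context {R : realType}.

(** The square of the distance between c and the cross product n of a and b is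
    1 - 2 + 1. *)
Lemma cross_product (a1 a2 a3 b1 b2 b3 c1 c2 c3 : R) :
  a1 ^+ 2 + a2 ^+ 2 + a3 ^+ 2 = 1 -> b1 ^+ 2 + b2 ^+ 2 + b3 ^+ 2 = 1 ->
  c1 ^+ 2 + c2 ^+ 2 + c3 ^+ 2 = 1 -> a1 * b1 + a2 * b2 + a3 * b3 = 0 ->
  (a2 * b3 - a3 * b2) * c1 + (a3 * b1 - a1 * b3) * c2 + (a1 * b2 - a2 * b1) * c3 = 1 ->
  [/\ c1 = a2 * b3 - a3 * b2, c2 = a3 * b1 - a1 * b3 & c3 = a1 * b2 - a2 * b1].
Proof.
move=> aa bb cc ab abc.
set n1 := a2 * b3 - a3 * b2 in abc *; set n2 := a3 * b1 - a1 * b3 in abc *.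
set n3 := a1 * b2 - a2 * b1 in abc *.
have nn : n1 ^+ 2 + n2 ^+ 2 + n3 ^+ 2 = 1.
  transitivity ((a1 ^+ 2 + a2 ^+ 2 + a3 ^+ 2) * (b1 ^+ 2 + b2 ^+ 2 + b3 ^+ 2)
    - (a1 * b1 + a2 * b2 + a3 * b3) ^+ 2); first by rewrite /n1 /n2 /n3; ring.
  by rewrite aa bb ab; ring.
have : (c1 - n1) ^+ 2 + (c2 - n2) ^+ 2 + (c3 - n3) ^+ 2 = 0.
  transitivity ((c1 ^+ 2 + c2 ^+ 2 + c3 ^+ 2) + (n1 ^+ 2 + n2 ^+ 2 + n3 ^+ 2)
    - 2 * (n1 * c1 + n2 * c2 + n3 * c3)); first by ring.
  by rewrite cc nn abc; ring.
have := sqr_ge0 (c1 - n1); have := sqr_ge0 (c2 - n2); have := sqr_ge0 (c3 - n3).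
move=> h3 h2 h1 h.
have e (y : R) : y ^+ 2 = 0 -> y = 0 by move/eqP; rewrite sqrf_eq0 => /eqP.
by split; apply/eqP; rewrite -subr_eq0; apply/eqP/e; lra.
Qed.

(** Stereographic projection is conformal and preserves the orientation. The
    coordinates 1, 2, 3 are taken in the frame B, A, e, where e is the pole.
    The differential of the projection at p sends a tangent vector w to the
    vector of coordinates w2 (1 - p3) + p2 w3 and w1 (1 - p3) + p1 w3 along A
    and B, up to a positive factor; the lemma says that it maps the frame (u,
    v) to a direct orthogonal frame of vectors of length 1 - p3. *)
Lemma conformal_angle (u1 u2 u3 v1 v2 v3 p1 p2 p3 : R) :
  u1 ^+ 2 + u2 ^+ 2 + u3 ^+ 2 = 1 -> v1 ^+ 2 + v2 ^+ 2 + v3 ^+ 2 = 1 ->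
  p1 ^+ 2 + p2 ^+ 2 + p3 ^+ 2 = 1 -> u1 * v1 + u2 * v2 + u3 * v3 = 0 ->
  u1 * p1 + u2 * p2 + u3 * p3 = 0 -> v1 * p1 + v2 * p2 + v3 * p3 = 0 -> p3 != 1 ->
  (u2 * v3 - u3 * v2) * p1 + (u3 * v1 - u1 * v3) * p2 + (u1 * v2 - u2 * v1) * p3 = 1 ->
  exists a, forall t,
    (cos t * u2 + sin t * v2) * (1 - p3) + p2 * (cos t * u3 + sin t * v3) = (1 - p3) * cos (t + a) /\
    (cos t * u1 + sin t * v1) * (1 - p3) + p1 * (cos t * u3 + sin t * v3) = (1 - p3) * sin (t + a).
Proof.
move=> uu vv pp uv up vp p31 det.
have l0 : 1 - p3 != 0 by rewrite subr_eq0 eq_sym.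
have [_ v2E v1E] : [/\ v3 = p1 * u2 - p2 * u1, v2 = p3 * u1 - p1 * u3 & v1 = p2 * u3 - p3 * u2].
  have [||-> -> ->//] := @cross_product p1 p2 p3 u1 u2 u3 v1 v2 v3 pp uu vv.
  - by rewrite -[RHS]up; ring.
  - by rewrite -[RHS]det; ring.
pose x := (u2 * (1 - p3) + p2 * u3); pose y := (u1 * (1 - p3) + p1 * u3).
have [_ u2E u1E] : [/\ u3 = v1 * p2 - v2 * p1, u2 = v3 * p1 - v1 * p3 & u1 = v2 * p3 - v3 * p2].
  have [|-> -> ->//] := @cross_product v1 v2 v3 p1 p2 p3 u1 u2 u3 vv pp uu vp.
  by rewrite -[RHS]det; ring.
have vx : v2 * (1 - p3) + p2 * v3 = - y.
  have -> : v2 * (1 - p3) + p2 * v3 = v2 - (v2 * p3 - v3 * p2) by ring.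
  by rewrite -u1E v2E /y; ring.
have vy : v1 * (1 - p3) + p1 * v3 = x.
  have -> : v1 * (1 - p3) + p1 * v3 = v1 + (v3 * p1 - v1 * p3) by ring.
  by rewrite -u2E v1E /x; ring.
have xy : x ^+ 2 + y ^+ 2 = (1 - p3) ^+ 2.
  transitivity ((1 - p3) ^+ 2 * (u1 ^+ 2 + u2 ^+ 2) + 2 * (1 - p3) * u3 * (u1 * p1 + u2 * p2)
     + u3 ^+ 2 * (p1 ^+ 2 + p2 ^+ 2)); first by rewrite /x /y; ring.
  have -> : u1 ^+ 2 + u2 ^+ 2 = 1 - u3 ^+ 2 by rewrite -uu; ring.
  have -> : u1 * p1 + u2 * p2 = - u3 * p3 by rewrite -[RHS]addr0 -up; ring.
  have -> : p1 ^+ 2 + p2 ^+ 2 = 1 - p3 ^+ 2 by rewrite -pp; ring.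
  ring.
have [a [ca sa]] : exists a, cos a = x / (1 - p3) /\ sin a = y / (1 - p3).
  apply: angle_exists; rewrite !expr_div_n -mulrDl xy divff// expf_neq0//.
exists a => t; rewrite cosD sinD ca sa; split.
- transitivity (cos t * x + sin t * (v2 * (1 - p3) + p2 * v3)); first by rewrite /x; ring.
  by rewrite vx; field.
- transitivity (cos t * y + sin t * (v1 * (1 - p3) + p1 * v3)); first by rewrite /y; ring.
  by rewrite vy; field.
Qed.

Lemma small_angle (eps r : R) : 0 < eps -> 0 < r ->
  exists y : R, [/\ 0 < y, y < r, 0 < sin y, sin y < eps & 2^-1 < cos y].
Proof.
move=> e0 r0.
have h1 : \forall y \near nbhs (0 : R), sin y < eps.
  by apply: cvgr_lt; [exact: continuous_sin|rewrite sin0].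
have h2 : \forall y \near nbhs (0 : R), 2^-1 < cos y.
  by apply: cvgr_gt; [exact: continuous_cos|rewrite cos0; lra].
have [d /= d0 hd] := (@nbhs_ballP R R 0 _).1 (filterI h1 h2).
have p0 := @pi_gt0 R.
pose y := Num.min (d / 2) (Num.min (r / 2) (pi / 2)).
have y0 : 0 < y by rewrite !lt_min !divr_gt0.
have yd : y <= d / 2 by rewrite ge_min lexx.
have yr : y <= r / 2 by rewrite !ge_min lexx orbT.
have yp : y <= pi / 2 by rewrite !ge_min lexx !orbT.
have [|s1 c1] := hd y; first by rewrite /ball /= sub0r normrN gtr0_norm//; lra.
by exists y; split => //; [lra|apply: sin_gt0_pi; lra].
Qed.
End conformality.

Section circle_radius.
Context {R : realType} {X : topologicalType} (x : X).
Variables (Q : set (R * R)) (emb : R * R -> X).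
Hypothesis emb_continuous : forall (Y : topologicalType) (D : set Y) (F : Y -> R * R),
  {within D, continuous F} -> (forall y, D y -> ~ Q (F y)) ->
  {within D, continuous (emb \o F)}.

Lemma circ_radius (o : R * R) (r1 r2 a : R) : 0 <= r1 <= r2 ->
  (forall z, Q z -> (z.1 - o.1) ^+ 2 + (z.2 - o.2) ^+ 2 < r1 ^+ 2 \/
     r2 ^+ 2 < (z.1 - o.1) ^+ 2 + (z.2 - o.2) ^+ 2) ->
  exists k, planar_class x emb (circ o r1 a) = (planar_class x emb (circ o r2 a) ^ k)%g.
Proof.
move=> /andP[r10 r12] hQ.
apply: (planar_class_free_straight x emb_continuous); [exact: is_path_circ|exact: is_path_circ| |exact: circ_closed..].
move=> s t Is It /hQ; rewrite /comb /circ /=.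
set C := cos _; set S := sin _.
have -> : (1 - s) * (o.1 + r1 * C) + s * (o.1 + r2 * C) - o.1 = ((1 - s) * r1 + s * r2) * C by ring.
have -> : (1 - s) * (o.2 + r1 * S) + s * (o.2 + r2 * S) - o.2 = ((1 - s) * r1 + s * r2) * S by ring.
rewrite !exprMn -mulrDr cos2Dsin2 mulr1.
have /andP[h1 h2] : r1 <= (1 - s) * r1 + s * r2 <= r2 by apply: comb_bounds => //; rewrite ?lexx ?r12.
have h0 := le_trans r10 h1; have h3 := le_trans r10 r12.
by rewrite !ltr_sqr ?nnegrE// !ltNge h1 h2 /=; case.
Qed.
End circle_radius.

Lemma finite_positive_bound (R : realType) (I : eqType) (s : seq I) (g : I -> R) :
  (forall i, i \in s -> 0 < g i) -> exists2 d, 0 < d & forall i, i \in s -> d <= g i.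
Proof.
elim: s => [_|i s IHs h]; first by exists 1.
have [j js|d d0 hd] := IHs; first by apply: h; rewrite in_cons js orbT.
exists (Num.min d (g i)); first by rewrite lt_min d0 h// mem_head.
move=> j; rewrite in_cons => /predU1P[->|js]; first by rewrite ge_min lexx orbT.
by rewrite ge_min hd.
Qed.

(** For s = sin (r / 2) and c = cos (r / 2) one has 2 s ^ 2 = 1 - cos r and 2
    s c = sin r. *)
Lemma small_estimates (R : realType) (l s c : R) : 0 < s -> s <= 1 -> s < l / 12 -> l <= 2 -> 2^-1 < c -> c <= 1 ->
  [/\ 0 <= 2 * s ^+ 2 <= 2 * s, 2 * (2 * s ^+ 2) < 2 * s * c * l, 2 * s * c * l <= 4 * s
    & 0 <= 2 * s * c <= 2 * s].
Proof.
move=> s0 s1 sl l2 c2 c1; have l0 : 0 < l by lra.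
have ss : s ^+ 2 <= s by rewrite expr2 ler_piMl// ltW.
have sc0 : 0 <= s * c by rewrite mulr_ge0; lra.
have sc1 : s * c <= s by rewrite ler_piMr// ltW.
have cl : l / 2 < c * l by rewrite mulrC ltr_pM2r.
have cl2 : c * l <= l by rewrite ler_piMl// ltW.
have h1 : s * (c * l) <= s * 2 by rewrite ler_pM2l//; lra.
have h2 : s * (2 * s) < s * (c * l) by rewrite ltr_pM2l//; lra.
rewrite expr2 in ss *.
have e1 : 2 * s * c * l = 2 * (s * (c * l)) by ring.
have e2 : 2 * s * c = 2 * (s * c) by ring.
rewrite e1 e2; have := mulr_ge0 (ltW s0) (ltW s0).
by split; [apply/andP; split| | |apply/andP; split]; lra.
Qed.

Section circles.
Context {R : realType} {n : nat} (p : 'I_n -> 'rV[R]_3).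
Hypotheses (p_sphere : forall i, dot (p i) (p i) = 1) (p_inj : injective p).
Variables (x : punctured_sphere p) (i0 : 'I_n) (A B : 'rV[R]_3).
Let e := p i0.
Hypotheses (AA : dot A A = 1) (BB : dot B B = 1) (AB : dot A B = 0)
  (Ae : dot A e = 0) (Be : dot B e = 0).
Hypothesis direct : \det (col_mx B (col_mx A e) : 'M[R]_3) = 1.

Let ee : dot e e = 1 := p_sphere i0.
Let Q := planar_puncture p i0 A B.
Let St := stereo p i0 A B.
Let emb := to_sphere x i0 A B.
Let emb_continuous := @continuous_to_sphere _ _ p p_sphere x i0 A B AA BB AB Ae Be.
Local Notation cls := (planar_class x emb).

Lemma stereo_norm w : dot w w = 1 -> w != e ->
  (St w).1 ^+ 2 + (St w).2 ^+ 2 = (1 + dot w e) / (1 - dot w e).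
Proof.
move=> ww we; have c1 : dot w e < 1 := sphere_pole p_sphere AA BB AB Ae Be ww we.
have s : dot w A ^+ 2 + dot w B ^+ 2 + dot w e ^+ 2 = 1 := sphere_coord p_sphere AA BB AB Ae Be ww.
rewrite /St /stereo /= !expr_div_n -mulrDl -/e.
have -> : dot w A ^+ 2 + dot w B ^+ 2 = (1 + dot w e) * (1 - dot w e).
  by rewrite (_ : _ * _ = 1 - dot w e ^+ 2); [lra|ring].
by field; rewrite subr_eq0 gt_eqF.
Qed.

(** The direct frame of the circle around the pole is (B, A, e): the image of
    the circle is a round circle around 0, run clockwise, and all the other
    punctures are inside. *)
Lemma class_at_infinity (f : R -> punctured_sphere p) r : 0 < r < pi ->
  (forall j, j != i0 -> dot (p j) e < cos r) ->
  (forall t, unit_itv t -> set_val (f t) = cos r *: e +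
        sin r *: (cos (2 * pi * t) *: B + sin (2 * pi * t) *: A)) ->
  is_path f /\ exists rho0 : R, 0 < rho0 /\ (forall z, Q z -> z.1 ^+ 2 + z.2 ^+ 2 < rho0 ^+ 2) /\
    forall rho, rho0 <= rho -> exists k, path_class x f = ((cls (circ (0, 0) rho (pi / 4)))^-1 ^ k)%g.
Proof.
move=> /andP[r0 rpi] far fE.
have s0 : 0 < sin r by apply: sin_gt0_pi; rewrite r0.
have c1 : cos r < 1.
  have := cos2Dsin2 r; have : 0 < sin r ^+ 2 by rewrite exprn_gt0.
  by have [//|h] := ltP (cos r) 1; have := mulr_ege1 h h; rewrite expr2; lra.
pose rho0 := sin r / (1 - cos r).
have rho0_gt0 : 0 < rho0 by rewrite divr_gt0// subr_gt0.
have c1n : 1 - cos r != 0 by rewrite subr_eq0 gt_eqF.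
have rho0E : rho0 ^+ 2 = (1 + cos r) / (1 - cos r).
  rewrite /rho0 expr_div_n sin2cos2 (_ : 1 - cos r ^+ 2 = (1 + cos r) * (1 - cos r)); last by ring.
  by field.
have Qin z : Q z -> z.1 ^+ 2 + z.2 ^+ 2 < rho0 ^+ 2.
  move=> [k k0 ->]; rewrite -[stereo _ _ _ _ _]/(St (p k)) stereo_norm ?(inj_eq p_inj)// rho0E.
  have h := far k k0; have k1 : dot (p k) e < 1 by exact: lt_trans h c1.
  rewrite ltr_pdivrMr ?subr_gt0// mulrAC ltr_pdivlMr ?subr_gt0//.
  suff : 0 < (1 + cos r) * (1 - dot (p k) e) - (1 + dot (p k) e) * (1 - cos r) by lra.
  by rewrite (_ : _ - _ = 2 * (cos r - dot (p k) e)); [lra|ring].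
have stE t : unit_itv t -> St (set_val (f t)) = reverse (circ (0, 0) rho0 (pi / 2)) t.
  move=> It; rewrite fE// /St /stereo /reverse /circ /= !add0r.
  have -> : 2 * pi * (1 - t) + pi / 2 = pi / 2 - (2 * pi * t) + pi *+ 2 by rewrite mulr2n; field.
  rewrite cosD2pi sinD2pi cosB sinB cos_pihalf sin_pihalf !(mul0r, mul1r, add0r, subr0).
  rewrite -/e !(dotDl, dotZl) AA BB ee (dotC e A) (dotC e B) (dotC B A) AB Ae Be.
  by rewrite !(mulr0, mulr1, add0r, addr0) /rho0; congr (_, _); field.
have fK t : unit_itv t -> f t = (emb \o reverse (circ (0, 0) rho0 (pi / 2))) t.
  move=> It; rewrite -[RHS]/(emb (reverse _ t)) -stE//.
  exact/esym/to_sphereK.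
have nQ t : ~ Q (circ (0, 0) rho0 (pi / 2) t).
  by move/Qin; rewrite /circ /= !add0r !exprMn -mulrDr cos2Dsin2 mulr1 ltxx.
have pc : is_path (emb \o circ (0, 0) rho0 (pi / 2)).
  by apply: emb_continuous => [|t _]; [exact: is_path_circ|exact: nQ].
have pr : is_path (emb \o reverse (circ (0, 0) rho0 (pi / 2))).
  exact: (continuous_reverse pc).
have pf : is_path f by apply: (@path_ext _ _ _ f pr) => t It; rewrite fK.
split => //; exists rho0; split => //; split => // rho hrho.
have -> : path_class x f = (cls (circ (0, 0) rho0 (pi / 2)))^-1%g.
  rewrite -(path_class_reverse x pc); apply: (path_class_ext x pf) => t It.
  exact: fK.
have [|k1 ->] := @circ_rotate _ _ x Q emb emb_continuous (0, 0) rho0 (pi / 2) (pi / 4).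
  by move=> z /Qin; rewrite !subr0 => h; rewrite lt_eqF.
have [||k2 ->] := @circ_radius _ _ x Q emb emb_continuous (0, 0) rho0 rho (pi / 4).
- by rewrite (ltW rho0_gt0).
- by move=> z /Qin h; rewrite !subr0; left.
by exists (k2 * k1)%g; rewrite conjgM conjVg conjVg.
Qed.

Lemma within_stereo (Y : topologicalType) (D : set Y) (G : Y -> 'rV[R]_3) :
  {within D, continuous G} -> (forall y, D y -> punctured_sphere p (G y)) ->
  {within D, continuous (St \o G)}.
Proof.
move=> cG DG; apply/subspace_continuousP => y Dy.
have [yy yp] := DG y Dy.
have y0 : 1 - dot (G y) e != 0.
  by rewrite subr_eq0 gt_eqF//; apply: (sphere_pole p_sphere AA BB AB Ae Be) => //; exact: yp.
have cd v : dot (G z) v @[z --> within D (nbhs y)] --> dot (G y) v.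
  have /subspace_continuousP/(_ y Dy) h := cG.
  exact: (cvg_comp _ (fun w : 'rV[R]_3 => dot w v) h (@continuous_dotl R v _)).
apply: (@cvg_pair _ _ _ (within D (nbhs y)) (nbhs _) (nbhs _)); apply: cvgM.
- exact: cd.
- by apply: cvgV => //; apply: cvgB; [exact: cvg_cst|exact: cd].
- exact: cd.
- by apply: cvgV => //; apply: cvgB; [exact: cvg_cst|exact: cd].
Qed.

Lemma stereo_inj j k : j != i0 -> k != i0 -> St (p j) = St (p k) -> j = k.
Proof.
have SK i : i != i0 -> stereo_inv p i0 A B (St (p i)) = p i.
  by move=> ii; apply: (stereoK p_sphere AA BB AB Ae Be); rewrite ?(inj_eq p_inj).
by move=> j0 k0 ek; apply: p_inj; rewrite -(SK j)// ek SK.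
Qed.

Section one_puncture.
Variables (j : 'I_n) (u v : 'rV[R]_3).
Let P := p j.
Hypotheses (j0 : j != i0) (uu : dot u u = 1) (vv : dot v v = 1) (uv : dot u v = 0)
  (uP : dot u P = 0) (vP : dot v P = 0).

Definition spherical_circle r t := cos r *: P + sin r *: (cos (2 * pi * t) *: u + sin (2 * pi * t) *: v).
Local Notation W := spherical_circle.

Lemma spherical_circle_dot r t : dot (W r t) P = cos r /\ dot (W r t) (W r t) = 1.
Proof.
have WP : dot (W r t) P = cos r.
  by rewrite /W !(dotDl, dotZl) p_sphere uP vP !mulr0 !addr0 mulr0 mulr1 addr0.
have Wu : dot (W r t) u = sin r * cos (2 * pi * t).
  by rewrite /W !(dotDl, dotZl) (dotC P u) (dotC v u) uu uv uP !mulr0 mulr1 addr0 add0r.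
have Wv : dot (W r t) v = sin r * sin (2 * pi * t).
  by rewrite /W !(dotDl, dotZl) (dotC P v) vv uv vP !mulr0 mulr1 !add0r.
split => //; rewrite [X in dot _ X]/W !(dotDr, dotZr) WP Wu Wv.
rewrite (_ : _ + _ = cos r ^+ 2 + sin r ^+ 2 * (cos (2 * pi * t) ^+ 2 + sin (2 * pi * t) ^+ 2)); last by ring.
by rewrite cos2Dsin2 mulr1 cos2Dsin2.
Qed.

Lemma spherical_circle_in r r' t : 0 < r' <= r -> r < pi ->
  (forall k, k != j -> dot (p k) P < cos r) -> punctured_sphere p (W r' t).
Proof.
move=> /andP[r'0 r'r] rpi far; have [WP WW] := spherical_circle_dot r' t.
split => // k; apply/eqP => ek; have [kj|kj] := eqVneq k j.
  have p0 := @pi_gt0 R.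
  have : cos r' < cos 0 by rewrite ltr_cos ?in_itv/=; lra.
  by rewrite cos0 -WP ek kj p_sphere ltxx.
have := far k kj; rewrite -ek WP ltr_cos ?in_itv/=; first by rewrite ltNge r'r.
- lra.
- lra.
Qed.

Lemma spherical_circle_continuous (a b : R) :
  continuous (fun st : R * R => W ((1 - st.1) * a + st.1 * b) st.2).
Proof.
move=> st; rewrite /W.
have c1 : continuous (fun st : R * R => (1 - st.1) * a + st.1 * b).
  move=> z; apply: cvgD; apply: cvgM; [|exact: cvg_cst|exact: cvg_fst|exact: cvg_cst].
  by apply: cvgB; [exact: cvg_cst|exact: cvg_fst].
have c2 : continuous (fun st : R * R => 2 * pi * st.2).
  by move=> z; apply: cvgM; [exact: cvg_cst|exact: cvg_snd].
have cc (g : R -> R) (h : R * R -> R) : continuous g -> continuous h -> continuous (g \o h).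
  by move=> cg ch z; apply: continuous_comp; [exact: ch|exact: cg].
have cs := @continuous_sin R; have cco := @continuous_cos R.
apply: cvgD; first by apply: cvgZr_tmp; exact: (cc _ _ cco c1).
apply: cvgZ; first exact: (cc _ _ cs c1).
by apply: cvgD; apply: cvgZr_tmp; [exact: (cc _ _ cco c2)|exact: (cc _ _ cs c2)].
Qed.

(** The spherical radius decreases from r to r'. *)
Lemma class_shrink (f : R -> punctured_sphere p) r r' : 0 < r' <= r -> r < pi ->
  (forall k, k != j -> dot (p k) P < cos r) ->
  (forall t, unit_itv t -> set_val (f t) = W r t) ->
  is_path f /\ exists k, path_class x f = (cls (fun t => St (W r' t)) ^ k)%g.
Proof.
move=> r'r rpi far fE.
pose H (st : R * R) := emb (St (W ((1 - st.1) * r + st.1 * r') st.2)).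
have rs s : unit_itv s -> 0 < (1 - s) * r + s * r' <= r.
  move=> Is; case/andP: r'r => r'0 r'r.
  have /andP[h ->] : r' <= (1 - s) * r + s * r' <= r by apply: comb_bounds => //; rewrite ?lexx ?r'r.
  by rewrite (lt_le_trans r'0 h).
have inX s t : unit_itv s -> punctured_sphere p (W ((1 - s) * r + s * r') t).
  by move=> Is; exact: spherical_circle_in (rs s Is) rpi far.
have cH : {within square, continuous H}.
  apply: emb_continuous; last by move=> [s t] [Is It]; apply: (stereo_avoids p_sphere p_inj AA BB AB Ae Be); exact: inX.
  apply: within_stereo; last by move=> [s t] [Is It]; exact: inX.
  by apply: continuous_subspaceT; exact: spherical_circle_continuous.
have fH t : unit_itv t -> f t = H (0, t).
  by move=> It; rewrite /H /= subr0 mul1r mul0r addr0 -fE//; exact/esym/to_sphereK.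
have pH s : unit_itv s -> is_path (fun t => H (s, t)).
  move=> Is; apply: (@within_comp _ _ _ _ _ (fun t : R => (s, t)) H) cH.
    by apply: continuous_subspaceT => t; apply: (@cvg_pair _ _ _ (nbhs t) (nbhs _) (nbhs _)); [exact: cvg_cst|exact: cvg_id].
  by move=> t It; split.
have pf : is_path f by apply: (@path_ext _ _ _ f (pH 0 unit0)) => t It; rewrite fH.
split => //.
have HE : (fun t => H (1, t)) = emb \o (fun t => St (W r' t)).
  by apply/funext => t; rewrite /H /= subrr mul0r mul1r add0r.
have [|k ->] := @path_class_free _ _ x f (fun t => H (1, t)) pf (pH 1 unit1).
  exists H; split => //; first by move=> t It; rewrite fH.
  move=> s Is; rewrite /H /= /W mulr0 mulr1 cos0 sin0.
  by rewrite mulr_natl cos2pi sin2pi.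
by exists k; rewrite HE.
Qed.

Hypothesis frame : \det (col_mx u (col_mx v P) : 'M[R]_3) = 1.

(** Up to terms of second order in r, the spherical circle of radius r is sent
    to a round circle around the image of its centre. *)
Lemma stereo_spherical_circle : exists a, forall r t, dot (W r t) e < 1 ->
  let D := (1 - dot (W r t) e) * (1 - dot P e) in
  (St (W r t)).1 - (St P).1 =
    (sin r * (1 - dot P e) * cos (2 * pi * t + a) - (1 - cos r) * dot P A) / D /\
  (St (W r t)).2 - (St P).2 =
    (sin r * (1 - dot P e) * sin (2 * pi * t + a) - (1 - cos r) * dot P B) / D.
Proof.
have Pe : dot P e < 1.
  by apply: (sphere_pole p_sphere AA BB AB Ae Be (p_sphere j)); rewrite (inj_eq p_inj).
have co w w' : dot w w' = dot w B * dot w' B + dot w A * dot w' A + dot w e * dot w' e.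
  by rewrite (dot_coord p_sphere AA BB AB Ae Be); ring.
have sq w : dot w w = 1 -> dot w B ^+ 2 + dot w A ^+ 2 + dot w e ^+ 2 = 1.
  by move=> <-; rewrite [RHS]co !expr2.
have [|||||a ha] := @conformal_angle _ (dot u B) (dot u A) (dot u e) (dot v B) (dot v A) (dot v e)
  (dot P B) (dot P A) (dot P e) (sq _ uu) (sq _ vv) (sq _ (p_sphere j)).
- by rewrite -co.
- by rewrite -co.
- by rewrite -co.
- by rewrite lt_eqF.
- by rewrite -[RHS](det_frame frame direct) -/e; ring.
exists a => r t W1 D; have [hA hB] := ha (2 * pi * t).
have l0 : 1 - dot P e != 0 by rewrite subr_eq0 gt_eqF.
have w0 : 1 - dot (W r t) e != 0 by rewrite subr_eq0 gt_eqF.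
have WE w : dot (W r t) w = cos r * dot P w + sin r * (cos (2 * pi * t) * dot u w + sin (2 * pi * t) * dot v w).
  by rewrite /W !(dotDl, dotZl).
rewrite -[sin r * _ * cos _]mulrA -hA -[sin r * _ * sin _]mulrA -hB /D /St /stereo /= -/e.
move: w0; rewrite !WE => w0; split; field; by rewrite w0 l0.
Qed.

Local Ltac lra_alone :=
  clear - Q St emb P e x p_sphere p_inj AA BB AB Ae Be direct ee emb_continuous j0 uu vv uv uP vP frame; lra.

(** At a small radius, the image of the spherical circle and the round circle
    are at each time in a common open half-plane bounded by a line through the
    puncture, and both are close to the puncture; so the straight homotopy
    between them avoids all the punctures. *)
Lemma class_around_puncture (f : R -> punctured_sphere p) r : 0 < r < pi ->
  (forall k, k != j -> dot (p k) P < cos r) ->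
  (forall t, unit_itv t -> set_val (f t) = W r t) ->
  is_path f /\ exists2 d, 0 < d & forall kappa, 0 < kappa < d ->
    exists k, path_class x f = (cls (circ (St P) kappa (pi / 4)) ^ k)%g.
Proof.
move=> /andP[r0 rpi] far fE.
have Pe : dot P e < 1.
  by apply: (sphere_pole p_sphere AA BB AB Ae Be (p_sphere j)); rewrite (inj_eq p_inj).
have [d d0 hd] : exists2 d, 0 < d & forall k, k \in [seq k <- enum 'I_n | (k != j) && (k != i0)] ->
    d <= `|(St (p k)).1 - (St P).1| + `|(St (p k)).2 - (St P).2|.
  apply: finite_positive_bound => k; rewrite mem_filter => /andP[/andP[kj k0] _].
  rewrite lt_neqAle addr_ge0// andbT eq_sym; apply/eqP => h; move/eqP: kj; apply.
  apply: stereo_inj => //; have := normr_ge0 ((St (p k)).1 - (St P).1).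
  have := normr_ge0 ((St (p k)).2 - (St P).2) => h2 h1.
  have e1 : (St (p k)).1 - (St P).1 = 0 by apply: normr0_eq0; lra.
  have e2 : (St (p k)).2 - (St P).2 = 0 by apply: normr0_eq0; lra.
  have {}e1 := subr0_eq e1; have {}e2 := subr0_eq e2.
  by rewrite [LHS]surjective_pairing e1 e2 -surjective_pairing.
have Qd z : Q z -> z = St P \/ d <= `|z.1 - (St P).1| + `|z.2 - (St P).2|.
  move=> [k k0 ->]; have [->|kj] := eqVneq k j; first by left.
  by right; apply: hd; rewrite mem_filter kj k0 mem_enum.
have l0 : 0 < 1 - dot P e by rewrite subr_gt0.
set l := 1 - dot P e in l0.
have bnd w : dot w w = 1 -> [/\ `|dot w A| <= 1, `|dot w B| <= 1 & `|dot w e| <= 1].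
  move=> ww; have h : dot w A ^+ 2 + dot w B ^+ 2 + dot w e ^+ 2 = 1 := sphere_coord p_sphere AA BB AB Ae Be ww.
  have h1 := sqr_ge0 (dot w A); have h2 := sqr_ge0 (dot w B); have h3 := sqr_ge0 (dot w e).
  have H (b : R) : b ^+ 2 <= 1 -> `|b| <= 1 by rewrite -(@ler_sqr _ `|b| 1) ?nnegrE// real_normK ?num_real// expr1n.
  by split; apply: H; lra.
have [pA pB pe] := bnd _ (p_sphere j); have [_ _ ue] := bnd _ uu; have [_ _ ve] := bnd _ vv.
have l2 : l <= 2 by move: pe; rewrite ler_norml /l => /andP[]; lra.
pose eps := Num.min (l / 12) (d * l ^+ 2 / 24).
have eps0 : 0 < eps by rewrite lt_min !divr_gt0// mulr_gt0// exprn_gt0.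
have [y [y0 yr sy0 sye cy]] := small_angle eps0 (divr_gt0 r0 (ltr0Sn R 1)).
have sl : sin y < l / 12 by rewrite (lt_le_trans sye)// ge_min lexx.
have sd : sin y < d * l ^+ 2 / 24 by rewrite (lt_le_trans sye)// ge_min lexx orbT.
have sin2y : sin (y *+ 2) = 2 * sin y * cos y by rewrite sin_mulr2n mulr2n; ring.
have cos2y : 1 - cos (y *+ 2) = 2 * sin y ^+ 2.
  by rewrite cos_mulr2n cos2sin2 !mulr2n; ring.
have cy1 := cos_le1 y.
have sy1 : sin y <= 1 by exact: sin_le1.
pose r' := y *+ 2.
have r'r : 0 < r' <= r by rewrite /r' mulr2n; move: y0 yr; lra_alone.
have [pf [k0 ->]] := class_shrink r'r rpi far fE; split => //.
exists (d / 2); first by rewrite divr_gt0.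
move=> kappa /andP[kap0 kapd].
have [a ha] := stereo_spherical_circle.
pose S1 := sin r' * l; pose C1 := 1 - cos r'.
have S1E : S1 = 2 * sin y * cos y * l by rewrite /S1 sin2y.
have C1E : C1 = 2 * sin y ^+ 2 by rewrite /C1 cos2y.
have [C1le S1gt S1le s2y] := small_estimates sy0 sy1 sl l2 cy cy1.
rewrite -C1E in C1le S1gt; rewrite -S1E in S1gt S1le; rewrite -sin2y -/r' in s2y.
have We t : l / 2 <= 1 - dot (W r' t) e.
  rewrite /W !(dotDl, dotZl).
  have h1 : `|cos (2 * pi * t) * dot u e + sin (2 * pi * t) * dot v e| <= 2.
    apply: (le_trans (ler_normD _ _)); rewrite !normrM.
    have h1 : `|cos (2 * pi * t)| * `|dot u e| <= 1 * 1 by apply: ler_pM => //; exact: cos_max.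
    have h2 : `|sin (2 * pi * t)| * `|dot v e| <= 1 * 1 by apply: ler_pM => //; exact: sin_max.
    by move: h1 h2; lra_alone.
  have h2 : `|sin r' * (cos (2 * pi * t) * dot u e + sin (2 * pi * t) * dot v e)| <= (2 * sin y) * 2.
    rewrite normrM; apply: ler_pM => //.
    by case/andP: s2y => h3 h4; rewrite ger0_norm.
  have h3 : `|C1 * dot P e| <= 2 * sin y.
    rewrite normrM; have := ler_pM (normr_ge0 C1) (normr_ge0 (dot P e)) (lexx _) pe.
    by case/andP: C1le => h3 h4; rewrite mulr1 ger0_norm// => h5; exact: le_trans h5 h4.
  move: h2 h3; rewrite !ler_norml => /andP[_ h2] /andP[h3 _].
  have -> : cos r' * dot P e = dot P e - C1 * dot P e by rewrite /C1; ring.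
  by rewrite -/l; move: sl h2 h3; rewrite /l; lra_alone.
have W1 t : dot (W r' t) e < 1 by move: l0 (We t); lra_alone.
pose n1 t := cos (2 * pi * t + a); pose n2 t := sin (2 * pi * t + a).
pose D t := (1 - dot (W r' t) e) * l.
have Dge t : l ^+ 2 / 2 <= D t by rewrite /D expr2 mulrAC; apply: ler_wpM2r => //; exact: ltW.
have D0 t : 0 < D t by apply: lt_le_trans (Dge t); rewrite divr_gt0// exprn_gt0.
have N1 t : (St (W r' t)).1 - (St P).1 = (S1 * n1 t - C1 * dot P A) / D t by have [] := ha r' t (W1 t).
have N2 t : (St (W r' t)).2 - (St P).2 = (S1 * n2 t - C1 * dot P B) / D t by have [] := ha r' t (W1 t).
have nn t : n1 t ^+ 2 + n2 t ^+ 2 = 1 by exact: cos2Dsin2.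
have n1m t : `|n1 t| <= 1 by exact: cos_max.
have n2m t : `|n2 t| <= 1 by exact: sin_max.
have cE t : circ (St P) kappa a t = ((St P).1 + kappa * n1 t, (St P).2 + kappa * n2 t) by [].
clearbody S1 C1 n1 n2 D.
have small t (m q : R) : `|m| <= 1 -> `|q| <= 1 -> `|(S1 * m - C1 * q) / D t| < d / 2.
  move=> hm hq; rewrite normrM normfV (gtr0_norm (D0 t)) ltr_pdivrMr//.
  apply: (@le_lt_trans _ _ (S1 + C1)); first last.
    apply: (@lt_le_trans _ _ (d / 2 * (l ^+ 2 / 2))); first by case/andP: C1le => _; move: S1le sd; lra_alone.
    by apply: ler_wpM2l => //; rewrite divr_ge0// ltW.
  apply: (le_trans (ler_normB _ _)); rewrite !normrM.
  have C10 : 0 <= C1 by case/andP: C1le.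
  have S10 : 0 <= S1 by apply: ltW (le_lt_trans _ S1gt); rewrite mulr_ge0.
  have hS : `|S1| = S1 by rewrite ger0_norm.
  have hC : `|C1| = C1 by rewrite ger0_norm.
  rewrite hS hC; have := ler_wpM2l S10 hm; have := ler_wpM2l C10 hq.
  by lra_alone.
have posit t : 0 < ((S1 * n1 t - C1 * dot P A) / D t) * n1 t + ((S1 * n2 t - C1 * dot P B) / D t) * n2 t.
  rewrite (_ : _ + _ = (S1 * (n1 t ^+ 2 + n2 t ^+ 2) - C1 * (dot P A * n1 t + dot P B * n2 t)) / D t); last first.
    by field; rewrite gt_eqF.
  apply: divr_gt0 => //.
  rewrite nn mulr1 subr_gt0; apply: le_lt_trans S1gt.
  rewrite mulrC; apply: ler_wpM2r; first by case/andP: C1le.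
  apply: (le_trans (ler_norm _)); apply: (le_trans (ler_normD _ _)); rewrite !normrM.
  have h1 := ler_pM (normr_ge0 _) (normr_ge0 _) pA (n1m t).
  have h2 := ler_pM (normr_ge0 _) (normr_ge0 _) pB (n2m t).
  by move: h1 h2; lra_alone.
have avoid s t : unit_itv s -> unit_itv t -> ~ Q (comb s (St (W r' t)) (circ (St P) kappa a t)).
  rewrite unit_itvE => /andP[s0 s1] It /Qd.
  have E1 : (comb s (St (W r' t)) (circ (St P) kappa a t)).1 - (St P).1 =
      (1 - s) * ((S1 * n1 t - C1 * dot P A) / D t) + s * (kappa * n1 t).
    by rewrite -N1 cE /comb /=; ring.
  have E2 : (comb s (St (W r' t)) (circ (St P) kappa a t)).2 - (St P).2 =
      (1 - s) * ((S1 * n2 t - C1 * dot P B) / D t) + s * (kappa * n2 t).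
    by rewrite -N2 cE /comb /=; ring.
  have s1' : 0 <= 1 - s by lra.
  case => [h|].
    move: E1 E2; rewrite h !subrr => E1 E2.
    have : 0 = (1 - s) * (((S1 * n1 t - C1 * dot P A) / D t) * n1 t + ((S1 * n2 t - C1 * dot P B) / D t) * n2 t)
        + s * (kappa * (n1 t ^+ 2 + n2 t ^+ 2)).
      transitivity (0 * n1 t + 0 * n2 t); first by ring.
      by rewrite {1}E1 E2; ring.
    rewrite nn mulr1; have := posit t; set z := (_ + _ : R) => z0.
    have [->|sn0] := eqVneq s 0; first by rewrite mul0r addr0 subr0 mul1r => h0; move: z0; rewrite -h0 ltxx.
    have : 0 < s * kappa by rewrite mulr_gt0// lt_neqAle eq_sym sn0.
    by have := mulr_ge0 s1' (ltW z0); lra_alone.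
  rewrite E1 E2 leNgt => /negP; apply.
  have H (b m : R) : `|b| < d / 2 -> `|m| <= 1 -> `|(1 - s) * b + s * (kappa * m)| < d / 2.
    move=> hb hm; apply: (le_lt_trans (ler_normD _ _)); rewrite !normrM.
    rewrite (ger0_norm s1') (ger0_norm s0) (gtr0_norm kap0).
    have hk : kappa * `|m| <= kappa by rewrite -[leRHS]mulr1; apply: ler_wpM2l => //; exact: ltW.
    have h1 := ler_wpM2l s0 hk.
    have [s00|sn0] := eqVneq s 0; first by rewrite s00 subr0 mul1r mul0r addr0.
    have sp : 0 < s by rewrite lt_neqAle eq_sym sn0.
    have h2 := ler_wpM2l s1' (ltW hb).
    have h3 : s * kappa < s * (d / 2) by rewrite ltr_pM2l.
    by move: h1 h2 h3; lra_alone.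
  have h1 := H _ _ (small t _ _ (n1m t) pA) (n1m t).
  have h2 := H _ _ (small t _ _ (n2m t) pB) (n2m t).
  by move: h1 h2; lra_alone.
have [|||||k1 ->] := @planar_class_free_straight _ _ x Q emb emb_continuous (fun t => St (W r' t)) (circ (St P) kappa a).
- apply: within_stereo => [|t _]; last exact: spherical_circle_in r'r rpi far.
  apply: continuous_subspaceT => t.
  have -> : W r' = (fun st : R * R => W ((1 - st.1) * r' + st.1 * r') st.2) \o (fun t => (0, t)).
    by apply/funext => z /=; rewrite subr0 mul1r mul0r addr0.
  apply: (@continuous_comp _ _ _ (fun t : R => ((0 : R), t))); last exact: spherical_circle_continuous.
  by apply: (@cvg_pair _ _ _ (nbhs t) (nbhs _) (nbhs _)); [exact: cvg_cst|exact: cvg_id].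
- exact: is_path_circ.
- exact: avoid.
- by rewrite /W mulr0 mulr1 cos0 sin0 mulr_natl cos2pi sin2pi.
- exact: circ_closed.
have [|k2 ->] := @circ_rotate _ _ x Q emb emb_continuous (St P) kappa a (pi / 4).
  move=> z /Qd[->|h]; apply/eqP => h2.
    by move: h2; rewrite !subrr expr0n addr0 => /esym/eqP; rewrite sqrf_eq0 gt_eqF.
  have hk w : w ^+ 2 <= kappa ^+ 2 -> `|w| < d / 2.
    move=> hw; apply: le_lt_trans kapd.
    have kn := ltW kap0; by rewrite -(@ler_sqr _ `|w| kappa) ?nnegrE// real_normK ?num_real.
  have h5 := sqr_ge0 (z.1 - (St P).1); have h6 := sqr_ge0 (z.2 - (St P).2).
  have h3 : `|z.1 - (St P).1| < d / 2 by apply: hk; move: h2 h5 h6; lra_alone.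
  have h4 : `|z.2 - (St P).2| < d / 2 by apply: hk; move: h2 h5 h6; lra_alone.
  by move: h h3 h4; lra_alone.
by exists (k2 * k1 * k0)%g; rewrite !conjgM.
Qed.
End one_puncture.
End circles.

(** * Moduli of a simple closed curve *)

Section compactness.
Context {R : realType} {T : topologicalType} (A : set T).
Hypothesis compactA : compact A.

Lemma positive_on_compact (w : T -> R) : {within A, continuous w} ->
  (forall z, A z -> 0 < w z) -> exists2 d, 0 < d & forall z, A z -> d <= w z.
Proof.
move=> cw w0; have [A0|/set0P/negP] := pselect (A !=set0); last first.
  rewrite negbK => /eqP A0; exists 1 => // z; by rewrite A0.
have [z /set_mem Az hz] := compact_EVT_min A0 compactA cw.
by exists (w z); [exact: w0|move=> y Ay; apply: hz; exact: mem_set].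
Qed.

Lemma bounded_on_compact (w : T -> R) : {within A, continuous w} ->
  exists2 d, 0 < d & forall z, A z -> w z < d.
Proof.
move=> cw; have [A0|/set0P/negP] := pselect (A !=set0); last first.
  rewrite negbK => /eqP A0; exists 1 => // z; by rewrite A0.
have [z /set_mem Az hz] := compact_EVT_max A0 compactA cw.
exists (`|w z| + 1) => [|y Ay]; first by rewrite ltr_wpDl.
by have := hz y (mem_set Ay); have := ler_norm (w z); lra.
Qed.

(** The maximum of u and eps - v is positive on the compact set, so it is
    bounded below. *)
Lemma modulus_on_compact (u v : T -> R) eps : {within A, continuous u} -> {within A, continuous v} ->
  (forall z, A z -> eps <= v z -> 0 < u z) ->
  exists2 d, 0 < d & forall z, A z -> u z < d -> v z < eps.
Proof.
move=> cu cv uv.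
have [||d d0 hd] := @positive_on_compact (fun z => Num.max (u z) (eps - v z)).
- move=> z; apply: (@continuous_max _ (subspace A) u (fun z => eps - v z)); first exact: cu.
  by apply: cvgB; [exact: cvg_cst|exact: cv].
- move=> z Az; rewrite lt_max subr_gt0; case: (leP eps (v z)) => [/(uv _ Az) ->//|_].
  by rewrite orbT.
exists d => // z Az ud; have := hd z Az; rewrite le_max leNgt ud /=.
by lra.
Qed.

End compactness.

Section planar_curve_moduli.
Context {R : realType}.
Implicit Types (y z : R * R) (e : R).

Definition dist y z : R := Num.max `|y.1 - z.1| `|y.2 - z.2|.

Lemma dist_lt y z e : (dist y z < e) = (`|y.1 - z.1| < e) && (`|y.2 - z.2| < e).
Proof. by rewrite /dist gt_max. Qed.

Lemma distC y z : dist y z = dist z y.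
Proof. by rewrite /dist (distrC y.1) (distrC y.2). Qed.

Lemma dist_triangle y z w e e' : dist y z < e -> dist z w < e' -> dist y w < e + e'.
Proof.
rewrite !dist_lt => /andP[h1 h2] /andP[h3 h4]; apply/andP; split.
  by rewrite (_ : _ - _ = (y.1 - z.1) + (z.1 - w.1)); [apply: le_lt_trans (ler_normD _ _) _; lra|ring].
by rewrite (_ : _ - _ = (y.2 - z.2) + (z.2 - w.2)); [apply: le_lt_trans (ler_normD _ _) _; lra|ring].
Qed.

Lemma dist_gt0 y z : (0 < dist y z) = (y != z).
Proof.
rewrite /dist lt_max !normr_gt0 !subr_eq0; case: y z => y1 y2 [z1 z2] /=.
by rewrite xpair_eqE negb_and.
Qed.

Lemma dist_bound y z e L : dist y z < e -> `|y.1| < L /\ `|y.2| < L ->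
  `|z.1| < L + e /\ `|z.2| < L + e.
Proof.
rewrite dist_lt => /andP[h1 h2] [h3 h4].
have one (a b : R) : `|a - b| < e -> `|a| < L -> `|b| < L + e.
  move=> ab aL; rewrite (_ : b = a - (a - b)); last by ring.
  by apply: le_lt_trans (ler_normB _ _) _; lra.
by split; [exact: one h1 h3|exact: one h2 h4].
Qed.

Lemma within_dist (T : topologicalType) (A : set T) (F G : T -> R * R) :
  {within A, continuous F} -> {within A, continuous G} ->
  {within A, continuous (fun t => dist (F t) (G t))}.
Proof.
move=> cF cG z.
have c1 (H : T -> R * R) : {within A, continuous H} ->
    (fun v : T => (H v).1) @ nbhs (z : subspace A) --> (H z).1.
  by move=> cH; apply: (@continuous_comp (subspace A) _ _ H fst); [exact: cH|exact: cvg_fst].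
have c2 (H : T -> R * R) : {within A, continuous H} ->
    (fun v : T => (H v).2) @ nbhs (z : subspace A) --> (H z).2.
  by move=> cH; apply: (@continuous_comp (subspace A) _ _ H snd); [exact: cH|exact: cvg_snd].
apply: (@continuous_max _ (subspace A) (fun t => `|(F t).1 - (G t).1|) (fun t => `|(F t).2 - (G t).2|)).
  by apply: cvg_norm; apply: cvgB; exact: c1.
by apply: cvg_norm; apply: cvgB; exact: c2.
Qed.

Lemma compact_unit : compact (@unit_itv R).
Proof. exact: segment_compact. Qed.

Lemma compact_square : compact (@square R).
Proof. by apply: compact_setX; exact: compact_unit. Qed.

Variables (g : R -> R * R) (g_path : is_path g).

Let g_fst : {within (@square R), continuous (fun st : R * R => g st.1)}.
Proof.
apply: (@within_comp _ _ _ _ _ fst g) g_path.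
  by apply: continuous_subspaceT => ?; exact: cvg_fst.
by move=> [? ?] [].
Qed.

Let g_snd : {within (@square R), continuous (fun st : R * R => g st.2)}.
Proof.
apply: (@within_comp _ _ _ _ _ snd g) g_path.
  by apply: continuous_subspaceT => ?; exact: cvg_snd.
by move=> [? ?] [].
Qed.

Let time_dist : {within (@square R), continuous (fun st : R * R => `|st.1 - st.2|)}.
Proof.
apply: continuous_subspaceT => st; apply: cvg_norm; apply: cvgB; [exact: cvg_fst|exact: cvg_snd].
Qed.

Lemma uniform_modulus e : 0 < e -> exists2 d, 0 < d & forall s t, unit_itv s -> unit_itv t ->
  `|s - t| < d -> dist (g s) (g t) < e.
Proof.
move=> e0; have [|d d0 hd] := modulus_on_compact compact_square (eps := e) time_dist (within_dist g_fst g_snd).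
  move=> [s t] _ /= h; rewrite normr_gt0 subr_eq0; apply/eqP => st.
  by move: h; rewrite st /dist !subrr normr0 maxxx leNgt e0.
by exists d => // s t Is It h; apply: (hd (s, t)).
Qed.

(** The times s and t are compared on the circle, since the curve is closed. *)
Lemma injectivity_modulus e : 0 < e -> g 0 = g 1 -> {in `[0, 1[ &, injective g} ->
  exists2 d, 0 < d & forall s t, unit_itv s -> unit_itv t ->
  dist (g s) (g t) < d -> `|s - t| < e \/ 1 - e < `|s - t|.
Proof.
move=> e0 g01 ginj.
have cv : {within (@square R), continuous (fun st : R * R => Num.min `|st.1 - st.2| (1 - `|st.1 - st.2|))}.
  move=> st; apply: (@continuous_min _ (subspace square) (fun st : R * R => `|st.1 - st.2|) (fun st => 1 - `|st.1 - st.2|)).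
    exact: time_dist.
  by apply: cvgB; [exact: cvg_cst|exact: time_dist].
have [|d d0 hd] := modulus_on_compact compact_square (eps := e) (within_dist g_fst g_snd) cv.
  move=> [s t] [/= Is It]; rewrite le_min => /andP[h1 h2]; rewrite dist_gt0; apply/eqP => gst.
  have per u : unit_itv u -> exists u', [/\ u' \in `[0, 1[, g u = g u' & (u' = u \/ u = 1 /\ u' = 0)].
    rewrite unit_itvE => Iu; have [->|u1] := eqVneq u 1.
      by exists 0; split => //; [rewrite in_itv /= lexx ltr01|right].
    by exists u; split => //; [rewrite in_itv /= lt_neqAle u1 /=|left].
  have [s' [Is' gs es]] := per s Is; have [t' [It' gt et]] := per t It.
  have e' := ginj s' t' Is' It' (etrans (esym gs) (etrans gst gt)).
  move: h1 h2; case: es => [es|[es es']]; case: et => [et|[et et']].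
  - by rewrite -es -et e' subrr normr0; lra.
  - by rewrite et -es e' et' sub0r normrN normr1; lra.
  - by rewrite es -et -e' es' subr0 normr1; lra.
  - by rewrite es et subrr normr0; lra.
exists d => // s t Is It h; have := hd (s, t) (conj Is It) h; rewrite gt_min /=.
by case/orP => ?; [left|right; lra].
Qed.

Lemma curve_away z : (forall t, unit_itv t -> g t != z) ->
  exists2 d, 0 < d & forall t, unit_itv t -> d <= dist (g t) z.
Proof.
move=> nz; apply: (positive_on_compact compact_unit).
  by apply: within_dist => //; exact: within_cst.
by move=> t It; rewrite dist_gt0; exact: nz.
Qed.

Lemma curve_bounded z : exists2 d, 0 < d & forall t, unit_itv t -> dist (g t) z < d.
Proof.
apply: (bounded_on_compact compact_unit).
by apply: within_dist => //; exact: within_cst.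
Qed.

End planar_curve_moduli.

(** * Holonomy of the faces of a grid *)

Section conjugacy.
Context {G : groupType}.
Definition conj_to (a b : G) := exists k, a = (b ^ k)%g.

Lemma conj_to_refl a : conj_to a a.
Proof. by exists 1%g; rewrite conjg1. Qed.

Lemma conj_to_sym a b : conj_to a b -> conj_to b a.
Proof. by move=> [k ->]; exists k^-1%g; rewrite conjgK. Qed.

Lemma conj_to_trans a b c : conj_to a b -> conj_to b c -> conj_to a c.
Proof. by move=> [k ->] [l ->]; exists (l * k)%g; rewrite conjgM. Qed.

Lemma conj_toV a b : conj_to a b -> conj_to a^-1%g b^-1%g.
Proof. by move=> [k ->]; exists k; rewrite conjVg. Qed.

Lemma conj_to_mulC a b : conj_to (a * b)%g (b * a)%g.
Proof. by exists a^-1%g; rewrite conjgE invgK !mulgA mulgK. Qed.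
End conjugacy.

Section grid.
Context {R : realType} {X : topologicalType} (x : X).
Variables (Q : set (R * R)) (emb : R * R -> X).
Hypothesis emb_continuous : forall (Y : topologicalType) (D : set Y) (F : Y -> R * R),
  {within D, continuous F} -> (forall y, D y -> ~ Q (F y)) ->
  {within D, continuous (emb \o F)}.
Context {I : eqType} (idx : seq I) (pt : I -> R * R).
Hypothesis QE : forall z, Q z <-> exists2 k, k \in idx & z = pt k.
Variables (h ox oy : R).
Hypothesis h_gt0 : 0 < h.

Definition pos (v : vertex) : R * R := (ox + h * v.1%:R, oy + h * v.2%:R).

Hypothesis generic : forall k m, k \in idx ->
  (pt k).1 != ox + h * m%:R /\ (pt k).2 != oy + h * m%:R.
Hypothesis separated : forall k l, k \in idx -> l \in idx -> k != l -> h <= dist (pt k) (pt l).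
Hypothesis quadrant : forall k, k \in idx -> ox <= (pt k).1 /\ oy <= (pt k).2.

Local Notation phi := (lattice_class x Q emb pos).
Local Notation cls := (planar_class x emb).

Definition cell (z : R * R) : vertex :=
  (Num.truncn ((z.1 - ox) / h), Num.truncn ((z.2 - oy) / h)).

Lemma cellP (z : R * R) : ox <= z.1 -> oy <= z.2 ->
  (ox + h * (cell z).1%:R <= z.1 < ox + h * (cell z).1.+1%:R) /\
  (oy + h * (cell z).2%:R <= z.2 < oy + h * (cell z).2.+1%:R).
Proof.
have one (o c : R) : o <= c -> o + h * (Num.truncn ((c - o) / h))%:R <= c < o + h * (Num.truncn ((c - o) / h)).+1%:R.
  move=> oc; have /truncn_itv : 0 <= (c - o) / h by rewrite divr_ge0 ?subr_ge0// ltW.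
  by rewrite ler_pdivlMr// ltr_pdivrMr// => /andP[h1 h2]; apply/andP; split; lra.
by move=> h1 h2; split; exact: one.
Qed.

Lemma lattice_lt (o : R) a b : o + h * a%:R < o + h * b%:R -> (a < b)%N.
Proof. by rewrite ltrD2l ltr_pM2l// ltr_nat. Qed.

Lemma lattice_le a b (o : R) : (a <= b)%N -> o + h * a%:R <= o + h * b%:R.
Proof. by move=> ab; rewrite lerD2l ler_pM2l// ler_nat. Qed.

Lemma lattice_eq (o c : R) a b : o + h * a%:R <= c < o + h * a.+1%:R ->
  o + h * b%:R <= c < o + h * b.+1%:R -> a = b.
Proof.
move=> /andP[a1 a2] /andP[b1 b2]; apply/anti_leq/andP.
by split; rewrite -ltnS; [exact: lattice_lt (le_lt_trans a1 b2)|exact: lattice_lt (le_lt_trans b1 a2)].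
Qed.

Definition face_of k : vertex := ((cell (pt k)).1, (cell (pt k)).2.+1).

Definition face_box (f : vertex) := box (ox + h * f.1%:R) (ox + h * f.1.+1%:R)
  (oy + h * f.2.-1%:R) (oy + h * f.2%:R).

Lemma face_boxP k f : k \in idx -> face_box f (pt k) -> f = face_of k.
Proof.
move=> ki /andP[/andP[b1 b2] /andP[b3 b4]].
have [qx qy] := quadrant ki; have [c1 c2] := cellP qx qy.
have [n1 _] := generic f.1.+1 ki; have [_ n2] := generic f.2 ki.
have e1 : f.1 = (cell (pt k)).1.
  by apply: lattice_eq c1; rewrite b1 lt_neqAle n1.
have e2 : f.2.-1 = (cell (pt k)).2.
  apply: lattice_eq c2; rewrite b3 /=; apply: lt_le_trans (lattice_le _ (leqSpred _)).
  by rewrite lt_neqAle n2.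
case: f b3 b4 n2 e1 e2 {b1 b2 n1} => a [|b] /= b3 b4 n2 e1 e2; last by rewrite /face_of /cell /= e1 e2.
by case/eqP: n2; apply/le_anti; rewrite b3 b4.
Qed.

Lemma face_box_of k : k \in idx -> let f := face_of k in
  (ox + h * f.1%:R < (pt k).1 < ox + h * f.1.+1%:R) /\
  (oy + h * f.2.-1%:R < (pt k).2 < oy + h * f.2%:R).
Proof.
move=> ki f; have [qx qy] := quadrant ki; have [/andP[c1 ->] /andP[c2 ->]] := cellP qx qy.
have [n1 _] := generic f.1 ki; have [_ n2] := generic f.2.-1 ki.
by rewrite !andbT !lt_neqAle eq_sym n1 eq_sym n2.
Qed.

Lemma face_of_inj : {in idx &, injective face_of}.
Proof.
move=> k l ki li e; apply/eqP/negPn/negP => kl.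
have := separated ki li kl; rewrite leNgt dist_lt => /negP; apply.
have [/andP[a1 a2] /andP[a3 a4]] := face_box_of ki.
have [/andP[b1 b2] /andP[b3 b4]] := face_box_of li.
rewrite -e in b1 b2 b3 b4; set f := face_of k in a1 a2 a3 a4 b1 b2 b3 b4.
have e1 : h * f.1.+1%:R = h * f.1%:R + h by rewrite -natr1; ring.
have e2 : h * f.2%:R = h * f.2.-1%:R + h.
  by rewrite /f /= -natr1; ring.
rewrite e1 in a2 b2; rewrite e2 in a4 b4.
by rewrite !ltr_norml; apply/andP; split; apply/andP; split; lra.
Qed.

Lemma pos_face_box (f v : vertex) : v \in face_cycle f -> face_box f (pos v).
Proof.
case: f => a b; rewrite /face_cycle /face_box /box /pos /=.
have h1 := lattice_le ox (leqnSn a); have h2 := lattice_le oy (leq_pred b).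
by rewrite !inE => /or4P[]/eqP -> /=; rewrite ?lexx ?h1 ?h2.
Qed.

Lemma face_hol_trivial f : (forall k, k \in idx -> face_of k != f) -> face_hol phi f = 1%g.
Proof.
move=> nf; have fr : convex_free Q (face_box f).
  apply: box_free => z bz /QE[k ki ek]; case/eqP: (nf k ki).
  by apply/esym/face_boxP; rewrite // -ek.
pose u : vertex := (f.1.+1, f.2); pose s : seq vertex := [:: f; (f.1, f.2.-1); (f.1.+1, f.2.-1)].
transitivity (hol phi u (rcons s u)); first by [].
rewrite (hol_convex x emb_continuous fr) ?last_rcons ?seg_class1// => v vs.
apply: pos_face_box; move: vs; rewrite in_cons mem_rcons in_cons orbA orbb.
by rewrite /face_cycle -/u in_cons.
Qed.

Lemma face_hol_puncture k d : k \in idx -> 0 < d -> exists2 kappa, 0 < kappa < d &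
  conj_to (face_hol phi (face_of k)) (cls (circ (pt k) kappa (pi / 4))).
Proof.
move=> ki d0; set f := face_of k.
have [/andP[a1 a2] /andP[a3 a4]] := face_box_of ki; rewrite -/f in a1 a2 a3 a4.
pose mu := Num.min d (Num.min (Num.min ((pt k).1 - (ox + h * f.1%:R)) (ox + h * f.1.+1%:R - (pt k).1))
   (Num.min ((pt k).2 - (oy + h * f.2.-1%:R)) (oy + h * f.2%:R - (pt k).2))).
have mu0 : 0 < mu by rewrite /mu !lt_min d0 !subr_gt0 a1 a2 a3 a4.
have := lexx mu; rewrite {2}/mu !le_min => /and3P[m1 /andP[m2 m3] /andP[m4 m5]].
have s0 := @sin_pi4_gt0 R; have s1 : sin (pi / 4) <= 1 :> R := sin_le1 _.
pose kappa := mu / 2; have k0 : 0 < kappa by rewrite divr_gt0.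
have km : kappa <= mu by rewrite /kappa; lra.
have ks : kappa * sin (pi / 4) <= kappa by rewrite ler_piMr// ltW.
exists kappa; first by rewrite k0 /kappa; lra.
have [||||||| nQ c] := @quad_circ R X x Q emb emb_continuous (ox + h * f.1%:R) (ox + h * f.1.+1%:R)
   (oy + h * f.2.-1%:R) (oy + h * f.2%:R) (pt k) kappa (kappa * sin (pi / 4)); rewrite ?lexx ?mulr_gt0//; try lra.
  move=> z /QE[l li ->]; have [->|lk] := eqVneq l k.
    by left; rewrite !subrr normr0 mulr_gt0.
  right; split; last by split; lra.
  move=> /(face_boxP li) => e; case/eqP: lk; apply: face_of_inj => //.
apply: conj_to_trans c; rewrite (planar_class_quad x emb_continuous nQ).
rewrite /face_hol /face_cycle /= mulg1 !mulgA; exists 1%g; rewrite conjg1.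
by [].
Qed.

(** The sides of the large square do not meet the punctures, because these are
    not on the lines of the grid. *)
Lemma rect_hol M (rho m : R) : 0 < m -> m <= rho * sin (pi / 4) ->
  m <= - ox -> m <= ox + h * M%:R -> m <= - oy -> m <= oy + h * M%:R ->
  (forall k, k \in idx -> `|(pt k).1| < m /\ `|(pt k).2| < m) ->
  conj_to (holc phi (rect 0 0 M M)) (cls (circ (0, 0) rho (pi / 4))).
Proof.
move=> m0 mr hx0 hx1 hy0 hy1 ptm.
set x1 := ox + h * M%:R in hx1; set y1 := oy + h * M%:R in hy1.
have pM : pos (M, M) = (x1, y1) by [].
have p0M : pos (0%N, M) = (ox, y1) by rewrite /pos /= mulr0 addr0.
have pM0 : pos (M, 0%N) = (x1, oy) by rewrite /pos /= mulr0 addr0.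
have p00 : pos (0%N, 0%N) = (ox, oy) by rewrite /pos /= !mulr0 !addr0.
have h0 : ox = ox + h * 0%:R by rewrite mulr0 addr0.
have k0 : oy = oy + h * 0%:R by rewrite mulr0 addr0.
have [||||||| nQ c] := @quad_circ R X x Q emb emb_continuous ox x1 oy y1 (0, 0) rho m;
  rewrite ?subr0 ?sub0r ?lexx//.
  by move=> z /QE[l li ->]; left; rewrite !subr0; exact: ptm.
apply: conj_to_trans c; rewrite (planar_class_quad x emb_continuous nQ).
have [k ek] := holc_last phi (0%N, M) (rect 0 0 M M).
have lM : last (0%N, M) (rect 0 0 M M) = (0%N, M) := last_rect 0 0 M M.
rewrite lM in ek.
apply: conj_to_trans (_ : conj_to _ (hol phi (0%N, M) (rect 0 0 M M))) _; first by exists k.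
have hM : M = (0 + M)%N by rewrite add0n.
have mM (a : nat) : (0 < a <= 0 + M)%N -> (a <= M)%N by rewrite add0n => /andP[].
have mM' (a : nat) : (0 <= a < 0 + M)%N -> (a <= M)%N by rewrite add0n => /andP[_ /ltnW].
have side (D : set (R * R)) u s : convex_free Q D -> (forall v, v \in u :: s -> D (pos v)) ->
    hol phi u s = seg_class x Q emb (pos u) (pos (last u s)) := @hol_convex _ _ x Q emb emb_continuous pos D u s.
have vline (i : nat) : convex_free Q (box (ox + h * i%:R) (ox + h * i%:R) oy y1).
  apply: box_free => z /andP[zx _] /QE[l li ez]; have [n1 _] := generic i li.
  by case/eqP: n1; rewrite -ez; apply/le_anti; rewrite andbC.
have hline (j : nat) : convex_free Q (box ox x1 (oy + h * j%:R) (oy + h * j%:R)).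
  apply: box_free => z /andP[_ zy] /QE[l li ez]; have [_ n1] := generic j li.
  by case/eqP: n1; rewrite -ez; apply/le_anti; rewrite andbC.
have inv (i : nat) (v : vertex) : v.1 = i -> (v.2 <= M)%N -> box (ox + h * i%:R) (ox + h * i%:R) oy y1 (pos v).
  move=> <- vM; rewrite /box /pos /= lexx /=; apply/andP; split; last by rewrite /y1; apply: lattice_le.
  by have := @lattice_le 0 v.2 oy (leq0n _); rewrite -k0.
have inh (j : nat) (v : vertex) : v.2 = j -> (v.1 <= M)%N -> box ox x1 (oy + h * j%:R) (oy + h * j%:R) (pos v).
  move=> <- vM; rewrite /box /pos /= !lexx !andbT; apply/andP; split; last by rewrite /x1; apply: lattice_le.
  by have := @lattice_le 0 v.1 ox (leq0n _); rewrite -h0.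
have l1 : last (0%N, M) (vdn 0 0 M) = (0%N, 0%N) := last_vdn 0 0 M.
rewrite /rect !hol_cat l1 last_hrt last_vup.
rewrite (side _ _ _ (vline 0%N)); last first.
  move=> v; rewrite in_cons => /predU1P[->|]; first exact: inv.
  by rewrite mem_vdn => /andP[/eqP v1 /mM' v2]; exact: inv.
rewrite (side _ _ _ (hline 0%N)); last first.
  move=> v; rewrite in_cons => /predU1P[->|]; first exact: inh.
  by rewrite mem_hrt => /andP[/eqP v1 /mM v2]; exact: inh.
rewrite (side _ _ _ (vline M)); last first.
  move=> v; rewrite in_cons => /predU1P[->|]; first exact: inv.
  by rewrite mem_vup => /andP[/eqP v1 /mM v2]; exact: inv.
rewrite (side _ _ _ (hline M)); last first.
  move=> v; rewrite in_cons => /predU1P[->|]; first by exact: inh.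
  by rewrite mem_hlt => /andP[/eqP v1 /mM' v2]; exact: inh.
rewrite l1 last_hrt last_vup last_hlt !add0n pM p0M pM0 p00.
rewrite !mulgA; apply: conj_to_trans (conj_to_mulC _ _) _; rewrite !mulgA; exact: conj_to_refl.
Qed.

End grid.

(** * From a simple closed curve to a simple lattice cycle *)

Lemma weak_adj_row a b c : (a <= b.+1)%N -> (b <= a.+1)%N -> weak_adj (a, c) (b, c).
Proof. by rewrite /weak_adj /adj xpair_eqE /= !eqxx andbT; lia. Qed.

Lemma weak_adj_column a b c : (a <= b.+1)%N -> (b <= a.+1)%N -> weak_adj (c, a) (c, b).
Proof. by rewrite /weak_adj /adj xpair_eqE /= !eqxx /=; lia. Qed.

Lemma uphalf_odd k : uphalf k.*2.+1 = k.+1.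
Proof. by rewrite -[LHS]/(k.*2.+2)./2 -doubleS doubleK. Qed.

Lemma half_odd k : k.*2.+1./2 = k.
Proof. exact: uphalf_double. Qed.

Lemma half_bounds m : [/\ m <= (uphalf m).*2.+1, (uphalf m).*2 <= m.+1,
  m <= m./2.*2.+1 & m./2.*2 <= m.+1]%N.
Proof. by split; lia. Qed.

Lemma iota1_rcons m : iota 1 m.+1 = rcons (iota 1 m) m.+1.
Proof. by rewrite -cats1 -[X in iota 1 X]addn1 iotaD add1n. Qed.

Section sampling.
Context {R : realType} {X : topologicalType} (x : X).
Variables (Q : set (R * R)) (emb : R * R -> X).
Hypothesis emb_continuous : forall (Y : topologicalType) (D : set Y) (F : Y -> R * R),
  {within D, continuous F} -> (forall y, D y -> ~ Q (F y)) ->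
  {within D, continuous (emb \o F)}.
Variables (h ox oy : R).
Hypothesis h_gt0 : 0 < h.
Local Notation pos := (pos h ox oy).
Local Notation cell := (cell h ox oy).
Local Notation phi := (lattice_class x Q emb pos).
Local Notation cls := (planar_class x emb).

Variables (g : R -> R * R) (r e : R) (N : nat).
Hypothesis e_ge0 : 0 <= e.
Hypotheses (g_path : is_path g) (g_closed : g 0 = g 1) (N_gt0 : (0 < N)%N).
Hypothesis g_quadrant : forall t, unit_itv t -> ox <= (g t).1 /\ oy <= (g t).2.
Hypothesis fine : forall s t, unit_itv s -> unit_itv t -> `|s - t| <= N%:R^-1 -> dist (g s) (g t) < h.
Hypothesis room : 8 * h <= r.
Hypothesis free : forall t z, unit_itv t -> dist (g t) z < r -> ~ Q z.
Hypothesis wide : forall s t, unit_itv s -> unit_itv t -> `|s - t| <= e -> dist (g s) (g t) < r / 4.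
Hypothesis inj : forall s t, unit_itv s -> unit_itv t -> dist (g s) (g t) < 4 * h ->
  `|s - t| < e \/ 1 - e < `|s - t|.

Let K := N.*2.
Definition time m : R := m%:R / K%:R.
Definition sample k := cell (g (k%:R / N%:R)).
(** The curve is sampled at the times k / N. From one sample to the next the
    path first moves horizontally, then vertically, so that the index m
    corresponds to the time m / (2 N). *)
Definition lattice_path m : vertex := ((sample (uphalf m)).1, (sample m./2).2).
Local Notation v := lattice_path.

Let N0 : 0 < N%:R :> R. Proof. by rewrite ltr0n. Qed.
Let KE : K%:R = 2 * N%:R :> R. Proof. by rewrite /K -mul2n natrM. Qed.
Let K0 : 0 < K%:R :> R. Proof. by rewrite KE mulr_gt0. Qed.

Lemma time_unit m : (m <= K)%N -> unit_itv (time m).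
Proof. by move=> mK; rewrite unit_itvE divr_ge0//= ler_pdivrMr// mul1r ler_nat. Qed.

Lemma sample_unit k : (k <= N)%N -> unit_itv (k%:R / N%:R : R).
Proof. by move=> mK; rewrite unit_itvE divr_ge0//= ler_pdivrMr// mul1r ler_nat. Qed.

Lemma sample_close m k : (m <= K)%N -> (m <= k.*2.+1)%N -> (k.*2 <= m.+1)%N -> (k <= N)%N ->
  dist (g (time m)) (g (k%:R / N%:R)) < h.
Proof.
move=> mK mk km kN; apply: fine; [exact: time_unit|exact: sample_unit|].
rewrite (_ : time m - _ = (m%:R - k.*2%:R) / K%:R); last first.
  by rewrite /time KE -mul2n natrM; field; rewrite gt_eqF.
rewrite normrM normfV (gtr0_norm K0) ler_pdivrMr// KE (_ : _ * (2 * _) = 2); last by field; rewrite gt_eqF.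
have h1 : m%:R <= k.*2%:R + 1 :> R by rewrite natr1 ler_nat.
have h2 : k.*2%:R <= m%:R + 1 :> R by rewrite natr1 ler_nat.
by rewrite ler_norml; apply/andP; split; lra.
Qed.

Lemma sampleP k : (k <= N)%N -> let z := g (k%:R / N%:R) in
  (ox + h * (sample k).1%:R <= z.1 < ox + h * (sample k).1.+1%:R) /\
  (oy + h * (sample k).2%:R <= z.2 < oy + h * (sample k).2.+1%:R).
Proof.
move=> kN; have [h1 h2] := g_quadrant (sample_unit kN); exact: cellP.
Qed.

Lemma lattice_path_close m : (m <= K)%N -> dist (g (time m)) (pos (v m)) < 2 * h.
Proof.
move=> mK; have uN : (uphalf m <= N)%N by move: mK; rewrite /K; lia.
have dN : (m./2 <= N)%N by move: mK; rewrite /K; lia.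
have [/andP[a1 a2] _] := sampleP uN; have [_ /andP[a3 a4]] := sampleP dN.
have [u1 u2 d1 d2] := half_bounds m.
have : dist (g (time m)) (g ((uphalf m)%:R / N%:R)) < h by exact: sample_close.
have : dist (g (time m)) (g ((m./2)%:R / N%:R)) < h by exact: sample_close.
rewrite !dist_lt => /andP[_ b1] /andP[b2 _].
move: b1 b2; rewrite /pos /= !ltr_norml => /andP[b1 b2] /andP[b3 b4].
by rewrite -!natr1 in a2 a4; apply/andP; split; apply/andP; split; lra.
Qed.

Lemma lattice_path_adj m : (m < K)%N -> weak_adj (v m) (v m.+1).
Proof.
move=> mK.
have one k : (k < N)%N -> [/\ ((sample k).1 <= (sample k.+1).1.+1)%N, ((sample k.+1).1 <= (sample k).1.+1)%N,
    ((sample k).2 <= (sample k.+1).2.+1)%N & ((sample k.+1).2 <= (sample k).2.+1)%N].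
  move=> kN; have [/andP[a1 a2] /andP[a3 a4]] := sampleP (ltnW kN).
  have [/andP[b1 b2] /andP[b3 b4]] := sampleP kN.
  have : dist (g (k%:R / N%:R)) (g (k.+1%:R / N%:R)) < h.
    apply: fine; [exact: sample_unit (ltnW kN)|exact: sample_unit|].
    rewrite (_ : _ - _ = - N%:R^-1); last by rewrite -natr1; ring.
    by rewrite normrN ger0_norm// invr_ge0 ltW.
  rewrite dist_lt !ltr_norml => /andP[/andP[c1 c2] /andP[c3 c4]].
  have ee (a : nat) : h * a.+2%:R = h * a.+1%:R + h by rewrite -natr1; ring.
  by split; rewrite -ltnS; [apply: (lattice_lt h_gt0 (o := ox))|apply: (lattice_lt h_gt0 (o := ox))|
    apply: (lattice_lt h_gt0 (o := oy))|apply: (lattice_lt h_gt0 (o := oy))]; rewrite ee; lra.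
have [k [mE|mE]] : exists k, m = k.*2 \/ m = k.*2.+1.
- by exists m./2; have := odd_double_half m; case: (odd m) => /=; [right|left].
- have kN : (k < N)%N by move: mK; rewrite mE /K ltn_double.
  have [h1 h2 _ _] := one k kN.
  by rewrite /v mE uphalf_double uphalf_odd half_odd doubleK; exact: weak_adj_row.
- have kN : (k < N)%N by move: mK; rewrite mE /K; lia.
  have [_ _ h1 h2] := one k kN.
  by rewrite /v mE uphalf_odd half_odd -doubleS uphalf_double doubleK; exact: weak_adj_column.
Qed.

Lemma lattice_path_closed : v K = v 0.
Proof.
rewrite /v /sample uphalf_double doubleK /= mul0r g_closed.
by rewrite divff// gt_eqF.
Qed.

Let nbh t a := box ((g t).1 - a) ((g t).1 + a) ((g t).2 - a) ((g t).2 + a).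

Let nbh_dist t a z : dist (g t) z < a -> nbh t a z.
Proof.
rewrite dist_lt !ltr_norml => /andP[/andP[h1 h2] /andP[h3 h4]].
by rewrite /nbh /box /=; apply/andP; split; apply/andP; split; lra.
Qed.

Let nbh_free t a : unit_itv t -> a < r -> convex_free Q (nbh t a).
Proof.
move=> It ar; apply: box_free => z hz; apply: (free It).
rewrite dist_lt !ltr_norml; move: hz; rewrite /box /= => /andP[/andP[h1 h2] /andP[h3 h4]].
by apply/andP; split; apply/andP; split; lra.
Qed.

(** At each step, the arc of the curve and the edge of the lattice path lie in
    a square without punctures. *)
Lemma class_initial_arc m : (m <= K)%N -> cls (subpath g 0 (time m)) =
  (seg_class x Q emb (g 0) (pos (v 0)) * hol phi (v 0) (map v (iota 1 m)) *
   seg_class x Q emb (pos (v m)) (g (time m)))%g.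
Proof.
have I0 : unit_itv (0 : R) := unit0.
have h8 := room; have hp := h_gt0.
have r0 : 0 < r by lra.
have cg : is_path (emb \o g).
  apply: emb_continuous => // t It; apply: (free It).
  by rewrite /dist !subrr normr0 maxxx.
elim: m => [_|m IHm mK].
  have -> : time 0 = 0 by rewrite /time mul0r.
  rewrite mulg1 (seg_classV x emb_continuous (g 0)) mulgV -[RHS](path_class_cst x (emb (g 0))).
  by congr path_class; apply/funext => t; rewrite /= /subpath !(mulr0, addr0).
have Im := time_unit (ltnW mK); have Im1 := time_unit mK.
have step : cls (subpath g 0 (time m.+1)) =
    (cls (subpath g 0 (time m)) * cls (subpath g (time m) (time m.+1)))%g.
  exact: esym (path_class_subpath x cg I0 Im Im1).
have tstep s : unit_itv s -> `|time m - ((1 - s) * time m + s * time m.+1)| <= N%:R^-1.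
  rewrite unit_itvE => /andP[s0 s1].
  rewrite (_ : _ - _ = - (s / K%:R)); last by rewrite /time -natr1; ring.
  rewrite normrN ger0_norm; last by rewrite divr_ge0// ltW.
  rewrite KE ler_pdivrMr ?mulr_gt0//.
  by rewrite (_ : N%:R^-1 * (2 * N%:R) = 2); [lra|field; rewrite gt_eqF].
have fD : convex_free Q (nbh (time m) (4 * h)) by apply: nbh_free => //; lra.
have gD s : unit_itv s -> nbh (time m) (4 * h) (subpath g (time m) (time m.+1) s).
  move=> Is; apply: nbh_dist; apply: lt_trans (_ : h < _); last by lra.
  by apply: fine (tstep s Is) => //; exact: convex_comb_unit.
have vD : nbh (time m) (4 * h) (pos (v m)).
  by apply: nbh_dist; have := lattice_path_close (ltnW mK); move=> h2; apply: lt_trans h2 _; lra.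
have s0 : subpath g (time m) (time m.+1) 0 = g (time m) by rewrite /subpath; congr g; ring.
have s1 : subpath g (time m) (time m.+1) 1 = g (time m.+1) by rewrite /subpath; congr g; ring.
have vD1 : nbh (time m) (4 * h) (pos (v m.+1)).
  apply: nbh_dist; have h2 := lattice_path_close mK.
  have h1 : dist (g (time m)) (g (time m.+1)) < h.
    by rewrite -s1; apply: (fine _ _ (tstep 1 unit1)) => //; apply: (convex_comb_unit unit1 Im Im1).
  by apply: lt_trans (dist_triangle h1 h2) _; lra.
have D0 : nbh (time m) (4 * h) (g (time m)) by have := gD 0 unit0; rewrite s0.
have D1 : nbh (time m) (4 * h) (g (time m.+1)) by have := gD 1 unit1; rewrite s1.
rewrite step (IHm (ltnW mK)) (planar_class_convex x emb_continuous fD) ?s0 ?s1//; last first.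
  by apply: subpath_path.
have lm : last (v 0) (map v (iota 1 m)) = v m.
  by case: (m) => // k; rewrite iota1_rcons map_rcons last_rcons.
rewrite iota1_rcons map_rcons hol_rcons lm -!mulgA; congr (_ * (_ * _))%g.
rewrite /lattice_class (seg_class_triangle x emb_continuous fD)//.
by rewrite (seg_class_triangle x emb_continuous fD).
Qed.

Lemma class_lattice_path : conj_to (cls g) (hol phi (v 0) (map v (iota 1 K))).
Proof.
have t1 : time K = 1 by rewrite /time divff// gt_eqF.
have -> : g = subpath g 0 1 by apply/funext => t; rewrite /subpath mulr0 add0r mulr1.
have := class_initial_arc (leqnn K); rewrite t1 lattice_path_closed => ->.
rewrite -g_closed (seg_classV x emb_continuous (g 0)).
by exists (seg_class x Q emb (g 0) (pos (v 0)))^-1%g; rewrite conjgE invgK mulgA.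
Qed.

Let E := Num.truncn (e * K%:R).

Let le_E (k : nat) : (k <= E)%N = (k%:R / K%:R <= e).
Proof. by rewrite /E truncn_ge_nat ?ler_pdivrMr// mulr_ge0// ltW. Qed.

Lemma time_dist i j : (i <= j)%N -> `|time i - time j| = (j - i)%:R / K%:R.
Proof.
move=> ij; rewrite distrC /time -mulrBl -natrB// ger0_norm//.
Qed.

Local Notation near_idx := (near_index K E).

Lemma near_close i m : (i <= K)%N -> (m <= K)%N -> near_idx i m -> dist (g (time i)) (g (time m)) < r / 2.
Proof.
move=> iK mK; have h8 := room; have hp := h_gt0.
have wide' a b : (a <= K)%N -> (b <= K)%N -> (a <= b + E)%N -> (b <= a + E)%N ->
    dist (g (time a)) (g (time b)) < r / 4.
  move=> aK bK ab ba; apply: wide; [exact: time_unit|exact: time_unit|].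
  have [le|le] := leqP a b; first by rewrite time_dist// -le_E; lia.
  by rewrite distrC time_dist ?(ltnW le)// -le_E; lia.
have rr : r / 2 = r / 4 + r / 4 by field.
have g0K : g (time 0) = g (time K) by rewrite /time mul0r divff ?gt_eqF.
rewrite /near_index => /orP[/orP[/andP[h1 h2]|h1]|h1].
- by apply: lt_trans (wide' _ _ iK mK _ _) _ => //; lra.
- rewrite rr; apply: dist_triangle (wide' i K _ _ _ _) _; rewrite -?g0K; try lia.
  by apply: wide'; lia.
- rewrite rr; apply: dist_triangle (wide' i 0%N _ _ _ _) _; rewrite ?g0K; try lia.
  by apply: wide'; lia.
Qed.

Lemma collision_near i j : (i < j < K)%N -> v i = v j -> near_idx i j.
Proof.
move=> /andP[ij jK] vij.
have iK := ltnW (ltn_trans ij jK); have {jK} jK := ltnW jK.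
have h1 := lattice_path_close iK; have h2 := lattice_path_close jK.
rewrite -vij distC in h2; have h3 := dist_triangle h1 h2.
have [||] := inj (time_unit iK) (time_unit jK).
- by rewrite (_ : 4 * h = 2 * h + 2 * h)//; ring.
- rewrite time_dist ?(ltnW ij)// => /ltW; rewrite -le_E => h4.
  by rewrite /near_index; apply/orP; left; apply/orP; left; lia.
- rewrite time_dist ?(ltnW ij)// => h4; rewrite /near_index; apply/orP; right.
  have : (K - (j - i) <= E)%N.
    rewrite le_E natrB; last by lia.
    by rewrite mulrBl divff ?gt_eqF//; lra.
  by lia.
Qed.

Lemma near_trivial i t : (i < K)%N -> (forall m, m \in t -> (m < K)%N /\ near_idx i m) ->
  last (v i) (map v t) = v i -> hol phi (v i) (map v t) = 1%g.
Proof.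
move=> iK ht lt; have h8 := room; have hp := h_gt0; have Ii := time_unit (ltnW iK).
have r0 : 0 < r by have := h_gt0; lra.
have fD : convex_free Q (nbh (time i) (3 * r / 4)) by apply: nbh_free => //; lra.
rewrite (hol_convex x emb_continuous fD) ?lt ?seg_class1// => w.
rewrite in_cons => /predU1P[->|/mapP[m mt ->]]; apply: nbh_dist.
  by apply: lt_le_trans (lattice_path_close (ltnW iK)) _; lra.
have [mK nim] := ht m mt.
apply: lt_le_trans (dist_triangle (near_close (ltnW iK) (ltnW mK) nim) (lattice_path_close (ltnW mK))) _.
by lra.
Qed.

(** By injectivity of the curve, the lattice path visits a vertex twice only
    at close times ([collision_near]), and its loops made of close times lie
    in squares without punctures ([near_trivial]); so [loop_erasure] applies. *)
Theorem curve_lattice_cycle : cls g = 1%g \/ exists C, [/\ uniq C, cycle adj C, (2 < size C)%N,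
  conj_to (holc phi C) (cls g) & forall u, u \in C -> exists2 t, unit_itv t & dist (g t) (pos u) < 2 * h].
Proof.
pose s := map v (iota 0 K).
have hp := h_gt0; have [K' K'E] : exists K', K = K'.+1 by exists K.-1; rewrite prednK// /K double_gt0.
have sE : rcons (map v (iota 1 K')) (v 0) = map v (iota 1 K).
  by rewrite -lattice_path_closed K'E -map_rcons iota1_rcons.
have holE : holc phi s = hol phi (v 0) (map v (iota 1 K)) by rewrite -sE /s K'E.
have wadj a k : (a + k <= K)%N -> path weak_adj (v a) (map v (iota a.+1 k)).
  elim: k a => //= k IHk a ak; rewrite lattice_path_adj ?IHk//; lia.
have cs : cycle weak_adj s.
  suff : path weak_adj (v 0) (rcons (map v (iota 1 K')) (v 0)) by rewrite /s K'E.
  by rewrite sE; apply: wadj.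
have cg : conj_to (cls g) (holc phi s) by rewrite holE; exact: class_lattice_path.
have [||s1|[C [uC cC C2 sC kC]]] := @loop_erasure _ phi (lattice_classV x emb_continuous pos) _ K E v
    collision_near near_trivial (iota 0 K) (iota_ltn_sorted 0 K) _ cs.
- by move=> u; exact: seg_class1.
- by move=> m; rewrite mem_iota add0n.
- by left; have [k ->] := cg; rewrite /s s1 conj1g.
- right; exists C; split => //; first exact: conj_to_trans (conj_to_sym cg).
  move=> u /sC/mapP[m]; rewrite mem_iota add0n => /andP[_ mK] ->.
  by exists (time m); [exact: time_unit (ltnW mK)|exact: lattice_path_close (ltnW mK)].
Qed.

End sampling.

(** * The two sides of a simple closed curve in the plane *)

Lemma finite_common (R : realType) (I : eqType) (s : seq I) (P : I -> R -> Prop) :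
  (forall k d d', d' <= d -> P k d -> P k d') ->
  (forall k, k \in s -> exists2 d, 0 < d & P k d) ->
  exists2 d, 0 < d & forall k, k \in s -> P k d.
Proof.
move=> mono; elim: s => [|k s IHs] h; first by exists 1.
have [|d d0 hd] := IHs; first by move=> l ls; apply: h; rewrite in_cons ls orbT.
have [d' d'0 hd'] := h k (mem_head _ _).
exists (Num.min d d') => [|l]; first by rewrite lt_min d0.
rewrite in_cons => /predU1P[->|ls]; first by apply: mono hd'; rewrite ge_min lexx orbT.
by apply: mono (hd l ls); rewrite ge_min lexx.
Qed.

Lemma avoid_finite (R : realType) (s : seq R) : exists2 t : R, 0 <= t < 1 & t \notin s.
Proof.
pose f (k : nat) : R := k%:R / (size s).+1%:R.
have f_inj : injective f.
  by move=> k l /(congr1 ( *%R^~ (size s).+1%:R)); rewrite /f !divfK// => /eqP; rewrite eqr_nat => /eqP.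
pose l := [seq f k | k <- iota 0 (size s).+1].
have ul : uniq l by rewrite map_inj_uniq ?iota_uniq.
have /allPn[t /mapP[k ki ->] ts] : ~~ all (mem s) l.
  apply/negP => /allP sub; have := uniq_leq_size ul sub.
  by rewrite size_map size_iota ltnn.
exists (f k) => //; rewrite /f divr_ge0//= ltr_pdivrMr// mul1r ltr_nat.
by move: ki; rewrite mem_iota.
Qed.

(** A point c is on a line of the grid only if the offset is, in units of h,
    the fractional part of (c - o) / h; so finitely many offsets are bad. *)
Lemma generic_offset (R : realType) (s : seq R) (o h : R) : 0 < h ->
  (forall c, c \in s -> o + h <= c) ->
  exists2 o', o <= o' < o + h & forall c (m : nat), c \in s -> c != o' + h * m%:R.
Proof.
move=> h0 so; pose y c := (c - o) / h.
have [t /andP[t0 t1] nt] := avoid_finite [seq y c - (Num.truncn (y c))%:R | c <- s].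
exists (o + t * h).
  rewrite lerDl mulr_ge0 ?(ltW h0)//= ltrD2l -[ltRHS]mul1r ltr_pM2r//.
move=> c m cs; apply/eqP => ec; move/negP: nt; apply; apply/mapP; exists c => //.
have yE : y c = t + m%:R by rewrite /y ec; field; rewrite gt_eqF.
have -> : Num.truncn (y c) = m.
  by apply: truncn_def; rewrite yE lerDr t0 /= -natr1 addrC ltrD2l.
by rewrite yE addrK.
Qed.

Section conj_prod_transfer.
Context {G : groupType} {I J : eqType}.

Lemma conj_prod_pmap (F : J -> G) (a : I -> G) (lab : J -> option I) (s : seq J) g :
  (forall f, lab f = None -> F f = 1%g) ->
  (forall f k, lab f = Some k -> conj_to (F f) (a k)) ->
  conj_prod F s g -> conj_prod a (pmap lab s) g.
Proof.
move=> F1 Fa; elim: s g => //= f s IHs g [k [g' [-> /IHs gs]]].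
case e : (lab f) => [i|] /=; last by rewrite F1// conj1g mul1g.
have [l ->] := Fa f i e; exists (l * k)%g, g'; split => //.
by rewrite conjgM.
Qed.

End conj_prod_transfer.

Section two_sides_of_a_curve.
Context {R : realType} {X : topologicalType} (x : X).
Variables (Q : set (R * R)) (emb : R * R -> X).
Hypothesis emb_continuous : forall (Y : topologicalType) (D : set Y) (F : Y -> R * R),
  {within D, continuous F} -> (forall y, D y -> ~ Q (F y)) ->
  {within D, continuous (emb \o F)}.
Context {I : eqType} (idx : seq I) (pt : I -> R * R).
Hypothesis QE : forall z, Q z <-> exists2 k, k \in idx & z = pt k.
Hypotheses (idx_uniq : uniq idx) (pt_inj : {in idx &, injective pt}).
Local Notation cls := (planar_class x emb).

Variables (a : I -> pi1 R x) (b : pi1 R x).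
Hypothesis a_circle : forall k, k \in idx -> exists2 d, 0 < d &
  forall kappa, 0 < kappa < d -> conj_to (a k) (cls (circ (pt k) kappa (pi / 4))).
Hypothesis b_circle : exists rho0, forall rho, rho0 <= rho ->
  conj_to b (cls (circ (0, 0) rho (pi / 4)))^-1%g.

Section sides_from_cycle.
Variables (h ox oy : R) (M : nat) (L : R).
Hypotheses (h_gt0 : 0 < h) (L_gt0 : 0 < L).
Hypotheses (ox_low : ox + 2 * h <= - L) (oy_low : oy + 2 * h <= - L)
  (ox_high : L + 2 * h <= ox + h * M%:R) (oy_high : L + 2 * h <= oy + h * M%:R).
Hypothesis generic : forall k m, k \in idx ->
  (pt k).1 != ox + h * m%:R /\ (pt k).2 != oy + h * m%:R.
Hypothesis separated : forall k l, k \in idx -> l \in idx -> k != l -> h <= dist (pt k) (pt l).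
Hypothesis pt_bound : forall k, k \in idx -> `|(pt k).1| < L /\ `|(pt k).2| < L.
Local Notation pos := (pos h ox oy).
Local Notation phi := (lattice_class x Q emb pos).
Local Notation face_of := (face_of pt h ox oy).

Let quadrant k : k \in idx -> ox <= (pt k).1 /\ oy <= (pt k).2.
Proof.
move=> ki; have [] := pt_bound ki; rewrite !ltr_norml => /andP[h1 _] /andP[h2 _].
by have := h_gt0; have := ox_low; have := oy_low; split; lra.
Qed.

Let lab (f : vertex) : option I := ohead [seq k <- idx | face_of k == f].

Let labP f k : lab f = Some k -> k \in idx /\ face_of k = f.
Proof.
rewrite /lab; case e : [seq _ <- _ | _] => [|k' s]//= [<-].
have : k' \in [seq k <- idx | face_of k == f] by rewrite e mem_head.
by rewrite mem_filter => /andP[/eqP].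
Qed.

Let lab_face k : k \in idx -> lab (face_of k) = Some k.
Proof.
move=> ki; case e : (lab (face_of k)) => [l|].
  have [li fl] := labP e; congr Some.
  exact: (face_of_inj h_gt0 generic separated quadrant).
have : k \in [seq l <- idx | face_of l == face_of k] by rewrite mem_filter eqxx.
by move: e; rewrite /lab; case: [seq _ <- _ | _].
Qed.

Let lab_none f : lab f = None -> face_hol phi f = 1%g.
Proof.
move=> e; apply: (face_hol_trivial x emb_continuous QE h_gt0 generic quadrant) => k ki.
by apply/eqP => fk; move: e; rewrite -fk lab_face.
Qed.

Let lab_some f k : lab f = Some k -> conj_to (face_hol phi f) (a k).
Proof.
move=> /labP[ki <-]; have [d d0 hd] := a_circle ki.
have [kappa hk c] := face_hol_puncture x emb_continuous QE h_gt0 generic separated quadrant ki d0.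
exact: conj_to_trans c (conj_to_sym (hd _ hk)).
Qed.

Let rect_face k : k \in idx -> wind (rect 0 0 M M) (face_of k) = 1.
Proof.
move=> ki; rewrite wind_rect !add0n.
have [c1 c2] := face_box_of h_gt0 generic quadrant ki.
have [] := pt_bound ki; rewrite !ltr_norml => /andP[_ h1] /andP[_ h2].
have := h_gt0; have := ox_high; have := oy_high; move=> u1 u2 u3.
move: c1 c2 => /andP[c1 _] /andP[c2 _].
have l1 : ((face_of k).1 < M)%N by apply: (lattice_lt h_gt0 (o := ox)); lra.
have l2 : ((face_of k).2.-1 < M)%N by apply: (lattice_lt h_gt0 (o := oy)); lra.
by rewrite l1 [(_ < _ <= _)%N]/= l2.
Qed.

(** The weights of the two sides add up to the winding number of the large
    square, which is 1 on the faces that contain a puncture; so each puncture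
    is in a face of exactly one side. *)
Lemma sides_from_cycle C : uniq C -> cycle adj C -> (2 < size C)%N ->
  (forall u, u \in C -> `|(pos u).1| < L + 2 * h /\ `|(pos u).2| < L + 2 * h) ->
  exists A B s t, [/\ perm_eq (A ++ B) idx, conj_prod a A s, conj_prod a B t,
    exists k l, (s^-1 ^ k = t * b ^ l)%g &
    conj_to s (holc phi C) \/ conj_to s (holc phi C)^-1%g].
Proof.
move=> uC cC C2 CL.
have CM v : v \in C -> (0 < v.1 < M)%N && (0 < v.2 < M)%N.
  move=> /CL[]; rewrite /pos /= !ltr_norml => /andP[h1 h2] /andP[h3 h4].
  have := h_gt0; have := ox_high; have := oy_high; have := ox_low; have := oy_low; move=> u1 u2 u3 u4 u5.
  by apply/andP; split; apply/andP; split; [apply: (lattice_lt h_gt0 (o := ox))|apply: (lattice_lt h_gt0 (o := ox))|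
    apply: (lattice_lt h_gt0 (o := oy))|apply: (lattice_lt h_gt0 (o := oy))]; lra.
have [w [s [t [S [T [k [k1 [k2 [rS rT e ek]]]]]]]]] :=
  simple_cycle_sides (lattice_classV x emb_continuous pos) uC cC C2 CM.
have [uS wS pS] := rS; have [uT wT pT] := rT.
have ST k' : k' \in idx -> (face_of k' \in S) (+) (face_of k' \in T).
  move=> ki; have := wT (face_of k'); rewrite wS rect_face//.
  by case: (_ \in S); case: (_ \in T).
have mlab (U : seq vertex) k' : (k' \in pmap lab U) = (k' \in idx) && (face_of k' \in U).
  rewrite mem_pmap; apply/mapP/andP => [[f fU /esym/labP[ki fk]]|[ki fU]].
    by rewrite ki fk.
  by exists (face_of k'); rewrite ?lab_face.
have ulab (U : seq vertex) : uniq U -> uniq (pmap lab U).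
  apply: (@pmap_uniq _ _ _ face_of) => f; case e' : (lab f) => [k'|]//=.
  by have [] := labP e'.
have [rho0 hb] := b_circle.
have bc : conj_to b (holc phi (rect 0 0 M M))^-1%g.
  pose rho := Num.max rho0 (L / sin (pi / 4)).
  apply: conj_to_trans (hb rho _) _; first by rewrite le_max lexx.
  apply/conj_toV/conj_to_sym.
  have := h_gt0; have := ox_high; have := oy_high; have := ox_low; have := oy_low; move=> u1 u2 u3 u4 u5.
  apply: (rect_hol x emb_continuous QE h_gt0 generic (m := L)) => //; try lra.
  by rewrite -ler_pdivrMr ?sin_pi4_gt0// le_max lexx orbT.
have [kb ekb] := conj_to_sym bc.
exists (pmap lab S), (pmap lab T), s, t; split.
- apply: uniq_perm => //.
    rewrite cat_uniq !ulab// andbT /=; apply/hasPn => k'; rewrite mlab => /andP[ki kT].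
    by rewrite /= mlab ki /=; have := ST k' ki; rewrite kT addbT.
  move=> k'; rewrite mem_cat !mlab -andb_orr; case ki : (k' \in idx) => //=.
  by have := ST k' ki; case: (_ \in S); case: (_ \in T).
- exact: conj_prod_pmap lab_none lab_some pS.
- exact: conj_prod_pmap lab_none lab_some pT.
- by exists k1, (kb * k2)%g; rewrite e conjgM ekb.
- by case: ek => ->; [left|right]; exists k.
Qed.

End sides_from_cycle.

(** The mesh h is small with respect to the distances between the punctures
    and from them to the curve, and to the injectivity modulus of the curve;
    the offsets keep the punctures off the lines of the grid; and the large
    square of side M contains the curve and the punctures. *)
Theorem two_sides (g : R -> R * R) : is_path g -> g 0 = g 1 -> {in `[0, 1[ &, injective g} ->
  (forall t, unit_itv t -> ~ Q (g t)) ->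
  cls g = 1%g \/ exists A B s t, [/\ perm_eq (A ++ B) idx, conj_prod a A s, conj_prod a B t,
    exists k l, (s^-1 ^ k = t * b ^ l)%g &
    conj_to s (cls g) \/ conj_to s (cls g)^-1%g].
Proof.
move=> g_path g01 g_inj gQ.
have [r r0 hr] : exists2 r, 0 < r & forall k, k \in idx -> forall t, unit_itv t -> r <= dist (g t) (pt k).
  apply: finite_common => [k d d' dd hd t It|k ki]; first exact: le_trans dd (hd t It).
  by apply: curve_away => // t It; apply/eqP => gt; apply: (gQ t It); apply/QE; exists k.
have [sg sg0 hsg] : exists2 r, 0 < r & forall k, k \in idx -> forall l, l \in idx -> k != l -> r <= dist (pt k) (pt l).
  apply: finite_common => [k d d' dd hd l li kl|k ki]; first exact: le_trans dd (hd l li kl).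
  apply: finite_common => [l d d' dd hd kl|l li]; first exact: le_trans dd (hd kl).
  have [->|kl] := eqVneq k l; first by exists 1; rewrite ?eqxx.
  exists (dist (pt k) (pt l)) => //; rewrite dist_gt0.
  by apply/eqP => /(pt_inj ki li)/eqP; rewrite (negbTE kl).
have [d1 d10 hd1] := uniform_modulus g_path (divr_gt0 r0 (ltr0Sn R 3)).
pose e := d1 / 2; have e0 : 0 < e by rewrite divr_gt0.
have [d2 d20 hd2] := injectivity_modulus g_path e0 g01 g_inj.
pose h := Num.min (r / 8) (Num.min sg (d2 / 4)).
have h0 : 0 < h by rewrite !lt_min sg0 !divr_gt0.
have := lexx h; rewrite {2}/h !le_min => /and3P[hr8 hsg' hd4].
have [d3 d30 hd3] := uniform_modulus g_path h0.
pose N := (Num.truncn d3^-1).+1.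
have hN : N%:R^-1 < d3.
  by rewrite -[ltRHS]invrK ltf_pV2 ?posrE ?invr_gt0 ?ltr0n// truncnS_gt.
have [L1 L10 hL1] := curve_bounded g_path (0, 0).
have [L2 L20 hL2] : exists2 d : R, 0 < d & forall k, k \in idx -> d * dist (pt k) (0, 0) < 1.
  have dp (y : R * R) : 0 <= dist y (0, 0) by rewrite /dist le_max normr_ge0.
  apply: (@finite_common R I idx (fun k d => d * dist (pt k) (0, 0) < 1)) => [k d d' dd|k ki].
    by apply: le_lt_trans; rewrite ler_wpM2r.
  exists (1 + dist (pt k) (0, 0))^-1; first by rewrite invr_gt0 ltr_pwDl.
  by rewrite mulrC ltr_pdivrMr ?mul1r ?ltrDr ?ltr_pwDl// ltrDr.
pose L := L1 + L2^-1.
have L0 : 0 < L by rewrite addr_gt0 ?invr_gt0.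
have gL t : unit_itv t -> `|(g t).1| < L /\ `|(g t).2| < L.
  move=> It; have := hL1 t It; rewrite dist_lt !subr0 /= => /andP[h1 h2].
  by split; rewrite /L; apply: ltr_wpDr => //; rewrite invr_ge0 ltW.
have ptL k : k \in idx -> `|(pt k).1| < L /\ `|(pt k).2| < L.
  move=> ki; have := hL2 k ki; rewrite mulrC -ltr_pdivlMr// mul1r dist_lt !subr0 /= => /andP[h1 h2].
  by split; rewrite /L; apply: ltr_wpDl => //; exact: ltW.
have offset (f : I -> R) : (forall k, k \in idx -> `|f k| < L) ->
    exists2 o, - L - 3 * h <= o < - L - 2 * h & forall k (m : nat), k \in idx -> f k != o + h * m%:R.
  move=> fL; have [c /mapP[k ki ->]|o ho gen] := @generic_offset _ [seq f k | k <- idx] (- L - 3 * h) h h0.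
    by have := fL k ki; rewrite ltr_norml => /andP[]; lra.
  exists o; first by rewrite (_ : - L - 2 * h = - L - 3 * h + h)//; ring.
  by move=> k m ki; apply: gen; exact: map_f.
have [ox /andP[ox1 ox2] genx] := offset (fun k => (pt k).1) (fun k ki => (ptL k ki).1).
have [oy /andP[oy1 oy2] geny] := offset (fun k => (pt k).2) (fun k ki => (ptL k ki).2).
(* margins of several cells keep the lattice path strictly inside the large square *)
pose M := ((Num.truncn (2 * L / h)).+1 + 9)%N.
have hM : 2 * L + 9 * h < h * M%:R.
  have : 2 * L / h < (Num.truncn (2 * L / h)).+1%:R by exact: truncnS_gt.
  by rewrite ltr_pdivrMr// /M natrD mulrDr mulrC; lra.
have free t z : unit_itv t -> dist (g t) z < r -> ~ Q z.
  by move=> It hz /QE[k ki ek]; move: hz; rewrite ek ltNge hr.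
have quad t : unit_itv t -> ox <= (g t).1 /\ oy <= (g t).2.
  move=> It; have [] := gL t It; rewrite !ltr_norml => /andP[h1 _] /andP[h2 _].
  by split; lra.
have fine s t : unit_itv s -> unit_itv t -> `|s - t| <= N%:R^-1 -> dist (g s) (g t) < h.
  by move=> Is It st; apply: hd3 => //; exact: le_lt_trans st hN.
have wide s t : unit_itv s -> unit_itv t -> `|s - t| <= e -> dist (g s) (g t) < r / 4.
  by move=> Is It st; apply: hd1 => //; apply: le_lt_trans st _; rewrite /e; lra.
have inj s t : unit_itv s -> unit_itv t -> dist (g s) (g t) < 4 * h -> `|s - t| < e \/ 1 - e < `|s - t|.
  by move=> Is It st; apply: hd2 => //; apply: lt_le_trans st _; lra.
have room : 8 * h <= r by lra.
have [|[C [uC cC C2 gC near]]] := curve_lattice_cycle x emb_continuous h0 (ltW e0) g_path g01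
  (ltn0Sn _ : (0 < N)%N) quad fine room free wide inj; first by left.
right.
have b1 : ox + 2 * h <= - L by lra.
have b2 : oy + 2 * h <= - L by lra.
have b3 : L + 2 * h <= ox + h * M%:R by lra.
have b4 : L + 2 * h <= oy + h * M%:R by lra.
have generic k m : k \in idx -> (pt k).1 != ox + h * m%:R /\ (pt k).2 != oy + h * m%:R.
  by move=> ki; split; [exact: genx|exact: geny].
have separated k l : k \in idx -> l \in idx -> k != l -> h <= dist (pt k) (pt l).
  by move=> ki li kl; apply: le_trans hsg' _; exact: hsg.
have vertices u : u \in C -> `|(pos h ox oy u).1| < L + 2 * h /\ `|(pos h ox oy u).2| < L + 2 * h.
  by move=> /near[t0 It0 gu]; exact: dist_bound gu (gL t0 It0).
have [A [B [s [t [AB pA pB k sC]]]]] :=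
  sides_from_cycle h0 L0 b1 b2 b3 b4 generic separated ptL uC cC C2 vertices.
exists A, B, s, t; split => //.
case: sC => sC; [left|right]; first exact: conj_to_trans sC gC.
by apply: conj_to_trans sC _; exact: conj_toV.
Qed.

End two_sides_of_a_curve.

(** * Displacement bounds *)

Section displacement_bounds.
Context {R : realType} {G : groupType} (rho : {multiplicative G -> PSL2 R}) (rho' : G -> R -> R).
Hypotheses (lift_over : forall g, lies_over (rho' g) (rho g))
  (lift_mul : forall g h, rho' (g * h)%g = rho' g \o rho' h).

Definition displacement_le (g : G) (A : int) := forall y, rho' g y <= y + 2 * pi * A%:~R.

Lemma lift1 y : rho' 1%g y = y.
Proof.
have e := congr1 (@^~ y) (lift_mul 1 1); rewrite mulg1 /= in e.
apply/eqP; case: ltgtP => //.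
- by move/(lift_mono (lift_over 1)); rewrite -e ltxx.
- by move/(lift_mono (lift_over 1)); rewrite -e ltxx.
Qed.

Lemma displacement_leM g h A B : displacement_le g A -> displacement_le h B -> displacement_le (g * h)%g (A + B).
Proof.
move=> hA hB y; rewrite lift_mul /=; have := hA (rho' h y); have := hB y.
by rewrite intrD mulrDr; lra.
Qed.

Lemma displacement_le_conj g h A : conj_to g h -> displacement_le h A -> displacement_le g A.
Proof.
move=> [k ->] hA y; rewrite conjgE !lift_mul /=.
apply: le_trans (lift_monoW (lift_over _) (hA (rho' k y))) _.
rewrite (lift_2pi_int _ _ (lift_over _)).
by rewrite -[rho' k^-1%g (rho' k y)]/((rho' k^-1%g \o rho' k) y) -lift_mul mulVg lift1.
Qed.

Lemma displacement_le_weaken g A B : A <= B -> displacement_le g A -> displacement_le g B.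
Proof.
move=> AB h y; apply: le_trans (h y) _; rewrite lerD2l ler_wpM2l ?ler_int//.
by have := @pi_gt0 R; lra.
Qed.

Lemma displacement_le_conj_prod (I : eqType) (a : I -> G) (w : I -> int) (s : seq I) g :
  (forall k, displacement_le (a k) (w k)) -> conj_prod a s g -> displacement_le g (\sum_(k <- s) w k).
Proof.
move=> aw; elim: s g => [|i s IHs] g /=.
  by move=> -> y; rewrite lift1 big_nil mulr0 addr0.
move=> [k [h [-> hs]]]; rewrite big_cons; apply: displacement_leM; last exact: IHs.
by apply: displacement_le_conj (aw i); exists k.
Qed.

Lemma hyperbolic_displacement_le g : hyperbolic (rho g) ->
  exists m : int, ~ displacement_le g m /\ ~ displacement_le g^-1%g (- m).
Proof.
move=> /(hyperbolic_displacement (lift_over g))[m [[y hy] [z hz]]]; exists m; split.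
  by move=> /(_ y); rewrite leNgt hy.
move=> /(_ (rho' g z)).
rewrite -[rho' g^-1%g _]/((rho' g^-1%g \o rho' g) z) -lift_mul mulVg lift1.
by rewrite mulrNz mulrN; lra.
Qed.

(** The displacement of a lift of g takes values on both sides of some 2 pi m,
    so the bound for s exceeds m and the bound for its inverse exceeds - m, or
    the other way round if s is conjugate to the inverse of g. *)
Lemma hyperbolic_two_sides g s A B : hyperbolic (rho g) -> conj_to s g \/ conj_to s g^-1%g ->
  displacement_le s A -> displacement_le s^-1%g B -> 2 <= A + B.
Proof.
move=> /hyperbolic_displacement_le[m [n1 n2]] sg hA hB.
have [h1|h1] : (m < A /\ - m < B) \/ (- m < A /\ m < B); [|lia|lia].
have nle h D D' : ~ displacement_le h D -> displacement_le h D' -> D < D'.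
  by move=> nD hD'; rewrite ltNge; apply/negP => /displacement_le_weaken/(_ hD').
case: sg => sg; [left|right]; split; apply: nle.
- exact: n1.
- exact: displacement_le_conj (conj_to_sym sg) hA.
- exact: n2.
- exact: displacement_le_conj (conj_toV (conj_to_sym sg)) hB.
- exact: n2.
- exact: displacement_le_conj (conj_to_sym sg) hA.
- exact: n1.
- have := conj_toV (conj_to_sym sg); rewrite invgK => sg'.
  exact: displacement_le_conj sg' hB.
Qed.

End displacement_bounds.

(** * The two sides of a simple closed curve on the sphere *)

Section curves_on_the_sphere.
Context {R : realType} {n : nat} (p : 'I_n -> 'rV[R]_3).
Hypotheses (p_sphere : forall i, dot (p i) (p i) = 1) (p_inj : injective p).
Variables (x : punctured_sphere p) (c : 'I_n -> pi1 R x).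
Hypothesis c_peripheral : peripheral_family c.

(** The projection from p i0 reduces this to the plane, the circle around p i0
    becoming a large circle run clockwise around the other punctures. *)
Theorem simple_curve_two_sides (i0 : 'I_n) g :
  (exists2 f, simple_closed_curve f & represented_by g f) ->
  g = 1%g \/ exists A B s t, [/\ perm_eq (i0 :: A ++ B) (enum 'I_n), conj_prod c A s,
    conj_prod c B t, exists k l, (s^-1 ^ k = t * c i0 ^ l)%g & conj_to s g \/ conj_to s g^-1%g].
Proof.
move=> [f [[cf f01] f_inj] gf].
have [f0 [u0 [v0 [r0 [[uu vv uv up vp] det hr far f0E]]]] cf0] := c_peripheral i0.
have vu : dot v0 u0 = 0 by rewrite dotC.
pose idx := [seq k <- enum 'I_n | k != i0].
pose pt k := stereo p i0 v0 u0 (p k).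
pose Q := planar_puncture p i0 v0 u0; pose emb := to_sphere x i0 v0 u0.
have emb_continuous := @continuous_to_sphere _ _ p p_sphere x i0 v0 u0 vv uu vu vp up.
have mi k : (k \in idx) = (k != i0) by rewrite mem_filter mem_enum andbT.
have QE z : Q z <-> exists2 k, k \in idx & z = pt k.
  by split=> -[k]; [move=> ? ->; exists k|rewrite mi => ? ->; exists k]; rewrite ?mi.
have pt_inj : {in idx &, injective pt}.
  move=> j k; rewrite !mi => j0 k0.
  exact: (stereo_inj p_sphere p_inj vv uu vu vp up).
have iu : uniq idx by rewrite filter_uniq ?enum_uniq.
have a_circle k : k \in idx -> exists2 d, 0 < d & forall kappa, 0 < kappa < d ->
    conj_to (c k) (planar_class x emb (circ (pt k) kappa (pi / 4))).
  rewrite mi => k0; have [fk [u [v [r [[uu' vv' uv' up' vp'] det' hr' far' fE']]]] cfk] := c_peripheral k.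
  have [pf [d d0 hd]] := class_around_puncture p_sphere p_inj x vv uu vu vp up det k0 uu' vv' uv' up' vp' det' hr' far' fE'.
  exists d => // kappa hk; apply: conj_to_trans (hd kappa hk).
  exact: represented_path_class pf cfk.
have b_circle : exists rho0, forall rho, rho0 <= rho ->
    conj_to (c i0) (planar_class x emb (circ (0, 0) rho (pi / 4)))^-1%g.
  have [pf [rho0 [_ [_ h]]]] := class_at_infinity p_sphere p_inj x vv uu vu vp up hr far f0E.
  exists rho0 => rho hrho; apply: conj_to_trans (h rho hrho).
  exact: represented_path_class pf cf0.
pose G t := stereo p i0 v0 u0 (set_val (f t)).
have GK t : emb (G t) = f t by exact: (to_sphereK p_sphere p_inj x vv uu vu vp up).
have clsG : conj_to g (planar_class x emb G).
  have -> : planar_class x emb G = path_class x f by congr path_class; apply/funext.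
  exact: represented_path_class cf gf.
have [||||e1|[A [B [s [t [AB pA pB kl sC]]]]]] := two_sides emb_continuous QE iu pt_inj a_circle b_circle (g := G).
- apply: (@within_comp _ _ _ _ setT f (fun y => stereo p i0 v0 u0 (set_val y))) => //.
  apply: continuous_subspaceT.
  exact: (continuous_stereo p_sphere vv uu vu vp up).
- by rewrite /G f01.
- by move=> s t Is It e; apply: f_inj => //; rewrite -!GK e.
- move=> t It; apply: (stereo_avoids p_sphere p_inj vv uu vu vp up).
  exact: set_val_in.
- by left; move: clsG; rewrite e1 => -[k ->]; rewrite conj1g.
right; exists A, B, s, t; split => //.
  have i0i : i0 \in enum 'I_n by rewrite mem_enum.
  rewrite (permPr (perm_to_rem i0i)) perm_cons (rem_filter _ (enum_uniq _)).
  exact: AB.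
case: sC => sC; [left|right]; first exact: conj_to_trans sC (conj_to_sym clsG).
by apply: conj_to_trans sC _; exact/conj_toV/conj_to_sym.
Qed.

End curves_on_the_sphere.

(** * Super-maximal representations *)

Theorem theorem2 (R : realType) (n : nat) (hn : (3 <= n)%N)
  (p : 'I_n -> 'rV[R]_3)
  (p_sphere : forall i, dot (p i) (p i) = 1) (p_inj : injective p)
  (x : punctured_sphere p) (c : 'I_n -> pi1 R x)
  (c_peripheral : peripheral_family c)
  (rho : {multiplicative pi1 R x -> PSL2 R}) :
  super_maximal c rho -> totally_non_hyperbolic rho.
Proof.
move=> sm g gf hyp.
have [rho' [lift_over lift_mul] eu] : exists2 rho', is_lift rho rho' &
    n%:R - 1 <= (- \sum_i translation_number (rho' (c i)) + Theta c rho) / (2 * pi).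
  have p0 := @pi_gt0 R.
  by case: sm => -[v [rho' lr ->] e]; exists rho'; rewrite // -e; lra.
pose w i := sval (cid (peripheral_displacement (lift_over (c i)))).
have wE i : 2 * pi * (w i)%:~R = 2 * pi + translation_number (rho' (c i)) - theta (rho (c i)).
  by rewrite /w; case: cid => A [].
have wB i : displacement_le rho' (c i) (w i) by rewrite /w; case: cid => A [].
(* the sum of the w i is n minus the relative Euler class *)
have w1 : \sum_i w i <= 1.
  rewrite -(ler_int R) rmorph_sum /=.
  have p0 : 0 < 2 * pi :> R by have := @pi_gt0 R; lra.
  rewrite -(ler_pM2l p0) mulr_sumr (eq_bigr _ (fun i _ => wE i)).
  rewrite sumrB big_split /= sumr_const card_ord.
  move: eu; rewrite ler_pdivlMr// /Theta -mulr_natr; lra.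
pose i0 : 'I_n := Ordinal (leq_trans (isT : 0 < 3)%N hn).
have [e1|[A [B [s [t [AB pA pB [k [l e]] sg]]]]]] := simple_curve_two_sides p_sphere p_inj c_peripheral i0 gf.
  have [m [n1 n2]] := hyperbolic_displacement_le lift_over lift_mul hyp.
  have b1 : displacement_le rho' 1%g 0 by move=> y; rewrite (lift1 lift_over lift_mul) mulr0 addr0.
  have [m0|m0] := leP 0 m; first by apply: n1; rewrite e1; apply: displacement_le_weaken b1.
  by apply: n2; rewrite e1 invg1; apply: displacement_le_weaken b1; lia.
have bs : displacement_le rho' s (\sum_(k <- A) w k) := displacement_le_conj_prod lift_over lift_mul wB pA.
have bt : displacement_le rho' t (\sum_(k <- B) w k) := displacement_le_conj_prod lift_over lift_mul wB pB.
have bi : displacement_le rho' s^-1%g (\sum_(k <- B) w k + w i0).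
  apply: (displacement_le_conj lift_over lift_mul) (_ : conj_to _ (t * c i0 ^ l)%g) _.
    by rewrite -e; exists k^-1%g; rewrite conjgK.
  apply: (displacement_leM lift_mul bt); apply: (displacement_le_conj lift_over lift_mul) (wB i0).
  by exists l.
have := hyperbolic_two_sides lift_over lift_mul hyp sg bs bi.
have : \sum_i w i = \sum_(k <- A) w k + (\sum_(k <- B) w k + w i0).
  rewrite -big_enum -(perm_big _ AB) big_cons big_cat /=; ring.
by move: w1 => /[swap] -> h1 h2; have := le_trans h2 h1.
Qed.
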